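(* Let $\Omega \subset \mathbb{R}^d$ be open, let $p \in (2-\frac{1}{d},\infty)$ and $s \in (0,1]$. Suppose $u \in H^{s,p}(\mathbb{R}^d)$ satisfies $$\int_{\mathbb{R}^d} |D^s u|^{p-2} D^s u \cdot D^s \varphi \, dx = 0 \qquad \text{for all } \varphi \in C_c^\infty(\Omega).$$ Then $v := I_{1-s} u$ satisfies $$-\operatorname{div}(|Dv|^{p-2} Dv) \in L^\infty_{loc}(\Omega),$$ that is, there is a function $\mu \in L^\infty_{loc}(\Omega)$ such that $\int_{\mathbb{R}^d} |Dv|^{p-2} Dv \cdot D\phi \, dx = \int_{\Omega} \mu\, \phi \, dx$ for all $\phi \in C_c^\infty(\Omega)$.
   Context: Functions are real valued and $d \ge 1$. $D$ is the ordinary (distributional) gradient. For $s \in (0,1)$ the fractional gradient is $D^s u = (\frac{\partial^s u}{\partial x_1^s}, \ldots, \frac{\partial^s u}{\partial x_d^s})$, where $$\frac{\partial^s u}{\partial x_i^s}(x) = c_{d,s} \int_{\mathbb{R}^d} \frac{u(x)-u(y)}{|x-y|^{d+s}} \, \frac{x_i-y_i}{|x-y|} \, dy, \qquad i=1,\ldots,d,$$ and $c_{d,s} = 2^s \pi^{-d/2}\, \Gamma(\frac{d+s+1}{2})/\Gamma(\frac{1-s}{2})$ is the normalizing constant for which $D^s = D I_{1-s}$ on $C_c^\infty(\mathbb{R}^d)$. For $s=1$, $D^1 = D$. For $u \in L^p(\mathbb{R}^d)$, $D^s u$ is understood in the distributional sense: $\int_{\mathbb{R}^d} \frac{\partial^s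 u}{\partial x_i^s}\, \varphi \, dx = -\int_{\mathbb{R}^d} u\, \frac{\partial^s \varphi}{\partial x_i^s} \, dx$ for all $\varphi \in C_c^\infty(\mathbb{R}^d)$. The space $H^{s,p}(\mathbb{R}^d)$ consists of all $u \in L^p(\mathbb{R}^d)$ with $[u]_{H^{s,p}(\mathbb{R}^d)} := (\int_{\mathbb{R}^d} |D^s u|^p)^{1/p} < \infty$. The expression $|z|^{p-2}z$ is taken to be $0$ at $z=0$. For $\sigma \in (0,1)$, $I_\sigma$ denotes the Riesz potential, the inverse of the fractional Laplacian $(-\Delta)^{\sigma/2} f(x) = \tilde c_{d,\sigma} \int_{\mathbb{R}^d} \frac{f(x)-f(y)}{|x-y|^{d+\sigma}} \, dy$ (whose Fourier symbol is $|\xi|^\sigma$); it is given, for $\sigma<d$, by convolution with $\frac{\Gamma((d-\sigma)/2)}{\pi^{d/2} 2^{\sigma} \Gamma(\sigma/2)} |x|^{\sigma-d}$. $I_0$ is the identity. The function $v = I_{1-s}u$ enters the conclusion only through its gradient, which is $Dv = D I_{1-s} u = D^s u \in L^p(\mathbb{R}^d;\mathbb{R}^d)$; this identity is the meaning of $Dv$ also when the convolution integral defining $I_{1-s}u$ does not converge absolutely. *)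

(* Defs.v *)
From HB Require Import structures.
From mathcomp Require Import all_boot all_order all_algebra.
From mathcomp Require Import all_classical all_reals all_analysis.

Set Implicit Arguments.
Unset Strict Implicit.
Unset Printing Implicit Defensive.

Import Order.TTheory GRing.Theory Num.Theory.
Import numFieldNormedType.Exports.

Local Open Scope classical_set_scope.
Local Open Scope ring_scope.

(* R^d is 'rV[R]_d.  The library gives it its topology (through the sup norm)
   but no measure.  Its sigma-algebra is the one generated by the coordinates,
   as in the library for tuples. *)
Definition measure_rV_display : measure_display.
Proof. exact: default_measure_display. Qed.

Section measurable_rV.
Context {R : realType} (n : nat).

Definition coord_rV (i : 'I_n) (x : 'rV[R]_n) : measurableTypeR R := x ord0 i.

Let rV_set0 : g_sigma_preimage coord_rV set0.
Proof. exact: sigma_algebra0. Qed.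

Let rV_setC A : g_sigma_preimage coord_rV A -> g_sigma_preimage coord_rV (~` A).
Proof. exact: sigma_algebraC. Qed.

Let rV_bigcup (F : _^nat) : (forall i, g_sigma_preimage coord_rV (F i)) ->
  g_sigma_preimage coord_rV (\bigcup_i (F i)).
Proof. exact: sigma_algebra_bigcup. Qed.

HB.instance Definition _ := @isMeasurable.Build measure_rV_display
  'rV[R]_n (g_sigma_preimage coord_rV) rV_set0 rV_setC rV_bigcup.

Lemma measurable_coord_rV (i : 'I_n) :
  measurable_fun [set: 'rV[R]_n] (coord_rV i).
Proof.
move=> _ Y mY; rewrite setTI; apply: sub_sigma_algebra => /=.
rewrite -bigcup_seq/=; exists i => /=; first by rewrite mem_index_enum.
by exists Y => //; rewrite setTI.
Qed.

Lemma measurable_fun_coord_rVP d (T : measurableType d) (f : T -> 'rV[R]_n) :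
  (forall i, measurable_fun [set: T] (coord_rV i \o f)) ->
  measurable_fun [set: T] f.
Proof.
move=> mf _ A mA; rewrite setTI.
have sub : g_sigma_preimage (fun i => coord_rV i \o f) `<=` measurable.
  apply: smallest_sub; first exact: sigma_algebra_measurable.
  move=> B; rewrite -bigcup_seq => -[i _ [C mC <-]].
  exact: mf.
by apply: sub; rewrite g_sigma_preimage_comp; exists A => //; rewrite setTI.
Qed.

End measurable_rV.

Section lebesgue_rV.
Context {R : realType}.

Definition cons_rV n (tx : measurableTypeR R * 'rV[R]_n) : 'rV[R]_n.+1 :=
  \row_i oapp (fun j => tx.2 ord0 j) tx.1 (unlift ord0 i).

Definition uncons_rV n (x : 'rV[R]_n.+1) : measurableTypeR R * 'rV[R]_n :=
  (x ord0 ord0, \row_j x ord0 (lift ord0 j)).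

Lemma cons_rVK n : cancel (@cons_rV n) (@uncons_rV n).
Proof.
move=> [t x]; rewrite /uncons_rV /cons_rV mxE unlift_none /=; congr pair.
by apply/rowP => j; rewrite !mxE liftK.
Qed.

Lemma uncons_rVK n : cancel (@uncons_rV n) (@cons_rV n).
Proof.
move=> x; apply/rowP => i; rewrite mxE; case: unliftP => [j|] -> //=.
by rewrite mxE.
Qed.

Lemma measurable_cons_rV n : measurable_fun [set: _] (@cons_rV n).
Proof.
apply: measurable_fun_coord_rVP => i.
case: (unliftP ord0 i) => [j|] ->.
  rewrite (_ : _ \o _ = coord_rV j \o snd); last first.
    by apply/funext => -[t x]; rewrite /coord_rV /= mxE liftK.
  by apply: measurableT_comp; [exact: measurable_coord_rV|exact: measurable_snd].
rewrite (_ : _ \o _ = fst); first exact: measurable_fst.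
by apply/funext => -[t x]; rewrite /coord_rV /= mxE unlift_none.
Qed.

Lemma measurable_uncons_rV n : measurable_fun [set: _] (@uncons_rV n).
Proof.
apply: measurable_fun_pair; first exact: (measurable_coord_rV ord0).
apply: measurable_fun_coord_rVP => j.
rewrite (_ : _ \o _ = coord_rV (lift ord0 j)); first exact: measurable_coord_rV.
by apply/funext => x; rewrite /coord_rV /= mxE.
Qed.

Section step.
Context n (m : {sigma_finite_measure set 'rV[R]_n -> \bar R}).

Definition lebesgue_cons : set 'rV[R]_n.+1 -> \bar R :=
  pushforward (lebesgue_measure \x m)%E (@cons_rV n).

Let lebesgue_cons0 : lebesgue_cons set0 = 0%E.
Proof. by rewrite /lebesgue_cons /pushforward preimage_set0 measure0. Qed.

Let lebesgue_cons_ge0 A : (0 <= lebesgue_cons A)%E.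
Proof.
exact: (@measure_ge0 _ _ _ (lebesgue_measure \x m)%E).
Qed.

Let lebesgue_cons_sigma_additive : semi_sigma_additive lebesgue_cons.
Proof.
move=> F mF tF mUF; rewrite /lebesgue_cons /pushforward preimage_bigcup.
have mpre A : measurable A -> measurable (@cons_rV n @^-1` A).
  by move=> mA; rewrite -[X in measurable X]setTI; exact: measurable_cons_rV.
apply: measure_semi_sigma_additive => [k||].
- by apply: mpre; exact: (mF k).
- apply/trivIsetP => /= i j _ _ ij; rewrite -preimage_setI.
  by move/trivIsetP : tF => /(_ _ _ _ _ ij) ->//; rewrite preimage_set0.
- by rewrite -preimage_bigcup; exact: mpre.
Qed.

HB.instance Definition _ := isMeasure.Build _ _ _ lebesgue_cons
  lebesgue_cons0 lebesgue_cons_ge0 lebesgue_cons_sigma_additive.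

(* Reproved: the library's sigma-finiteness of product measures is not
   canonically inferred here, its instance for probabilities takes over. *)
Let lebesgue_cons_sigma_finite : sigma_finite setT lebesgue_cons.
Proof.
have mcons A : measurable A -> measurable (@uncons_rV n @^-1` A).
  by move=> mA; rewrite -[X in measurable X]setTI; exact: measurable_uncons_rV.
have /sigma_finiteP[F [TF ndF Foo]] := sigma_finiteT (@lebesgue_measure R).
have /sigma_finiteP[G [TG ndG Goo]] := sigma_finiteT m.
exists (fun k => @uncons_rV n @^-1` (F k `*` G k)).
  rewrite -preimage_bigcup -(preimage_setT (@uncons_rV n)); congr (_ @^-1` _).
  rewrite -setXTT TF TG predeqE => -[x y]; split.
    move=> [/= [i _ Fix] [k _ Gky]]; exists (maxn i k) => //; split.
    - by move: x Fix; exact/subsetPset/ndF/leq_maxl.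
    - by move: y Gky; exact/subsetPset/ndG/leq_maxr.
  by move=> [i _ []/= ? ?]; split; exists i.
move=> k; have [mF Fk] := Foo k; have [mG Gk] := Goo k; split.
  by apply: mcons; exact: measurableX.
rewrite /lebesgue_cons /pushforward (_ : _ @^-1` _ = F k `*` G k).
  by rewrite product_measure1E// lte_mul_pinfty// ge0_fin_numE.
by rewrite /preimage; apply/funext => x; rewrite /mkset cons_rVK.
Qed.

HB.instance Definition _ := Measure_isSigmaFinite.Build _ _ _ lebesgue_cons
  lebesgue_cons_sigma_finite.

End step.

Fixpoint lebesgue_rV n : {sigma_finite_measure set 'rV[R]_n -> \bar R} :=
  if n is n'.+1 then lebesgue_cons (lebesgue_rV n') else \d_(0 : 'rV[R]_0).

End lebesgue_rV.

Definition dotv {R : realType} {d} (x y : 'rV[R]_d) : R :=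
  \sum_i x ord0 i * y ord0 i.

(* The Euclidean norm; the library's norm on 'rV[R]_d is the sup norm. *)
Definition enorm {R : realType} {d} (x : 'rV[R]_d) : R := Num.sqrt (dotv x x).

Section test_functions.
Context {R : realType} {d : nat}.
Implicit Types (phi : 'rV[R]_d -> R) (Omega : set 'rV[R]_d).

Definition partial (i : 'I_d) phi : 'rV[R]_d -> R := fun x => 'D_'e_i phi x.

Definition gradient phi (x : 'rV[R]_d) : 'rV[R]_d := \row_i partial i phi x.

(* Partial derivatives of all orders exist and are continuous; a multi-index is
   a list of coordinates. *)
Definition smooth phi := forall l : seq 'I_d,
  continuous (foldr partial phi l) /\
  forall i x, derivable (foldr partial phi l) x 'e_i.

Definition supp phi : set 'rV[R]_d := closure [set x | phi x != 0].

Definition test_function Omega phi :=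
  [/\ smooth phi, compact (supp phi) & supp phi `<=` Omega].

End test_functions.

Definition Gamma {R : realType} (a : R) : R :=
  \int[lebesgue_measure]_(t in `]0, +oo[) (t `^ (a - 1) * expR (- t)).

Section fractional_gradient.
Context {R : realType} {d : nat}.
Implicit Types (s p : R) (phi u : 'rV[R]_d -> R) (G : 'rV[R]_d -> 'rV[R]_d).
Let leb : {sigma_finite_measure set 'rV[R]_d -> \bar R} := lebesgue_rV d.

Definition fgrad_const s : R :=
  2 `^ s * pi `^ (- (d%:R / 2)) * Gamma ((d%:R + s + 1) / 2)
  / Gamma ((1 - s) / 2).

(* On the diagonal y = x the integrand is 0, since 0^-1 = 0. *)
Definition fpartial s (i : 'I_d) phi (x : 'rV[R]_d) : R :=
  fgrad_const s * \int[leb]_y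
    ((phi x - phi y) / enorm (x - y) `^ (d%:R + s)
     * ((x ord0 i - y ord0 i) / enorm (x - y))).

(* D^s of a test function, pointwise. *)
Definition fgrad_test s phi (x : 'rV[R]_d) : 'rV[R]_d :=
  if s == 1 then gradient phi x else \row_i fpartial s i phi x.

Definition locally_integrable_rV (f : 'rV[R]_d -> R) :=
  measurable_fun [set: 'rV[R]_d] f /\
  forall K, compact K -> leb.-integrable K (EFin \o f).

(* G is D^s u in the distributional sense, for u in some L^p. *)
Definition is_fgrad s u G := forall i : 'I_d,
  locally_integrable_rV (fun x => G x ord0 i) /\
  forall phi, test_function [set: 'rV[R]_d] phi ->
    \int[leb]_x (G x ord0 i * phi x) =
    - \int[leb]_x (u x * fgrad_test s phi x ord0 i).

(* D^s u, determined up to a null set when it exists: a representative is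
   chosen. *)
Definition fgrad s u : 'rV[R]_d -> 'rV[R]_d :=
  xget (fun=> 0) [set G | is_fgrad s u G].

Definition Hsp_seminorm s p u : \bar R :=
  'N[leb]_p%:E[EFin \o enorm \o fgrad s u]%E.

Definition Hsp s p : set ('rV[R]_d -> R) := [set u |
  [/\ u \in Lfun leb p%:E, exists G, is_fgrad s u G
    & (Hsp_seminorm s p u < +oo)%E]].

(* Dv for v = I_{1-s} u.  By definition D I_{1-s} u = D^s u, an identity which
   gives Dv its meaning even if the convolution defining the Riesz potential
   I_{1-s} u diverges. *)
Definition riesz_gradient s u : 'rV[R]_d -> 'rV[R]_d := fgrad s u.

(* |z|^{p-2} z, which is 0 at z = 0 for every p. *)
Definition pflux p (z : 'rV[R]_d) : 'rV[R]_d := enorm z `^ (p - 2) *: z.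

Definition Linfty_loc (Omega : set 'rV[R]_d) (f : 'rV[R]_d -> R) :=
  measurable_fun Omega f /\
  forall K, compact K -> K `<=` Omega ->
    exists C : R, {ae leb, forall x, K x -> `|f x| <= C}.

End fractional_gradient.

(* Main.v *)
Require Import Defs.
From HB Require Import structures.
From mathcomp Require Import all_boot all_order all_algebra.
From mathcomp Require Import all_classical all_reals all_analysis.
From mathcomp Require Import measurable_realfun ring lra.

Set Implicit Arguments.
Unset Strict Implicit.
Unset Printing Implicit Defensive.

Import Order.TTheory GRing.Theory Num.Theory.
Import numFieldNormedType.Exports.

Local Open Scope classical_set_scope.
Local Open Scope ring_scope.


Section measurable_rV_functions.
Context {R : realType} (n : nat).
Implicit Types f : 'rV[R]_n -> R.

Lemma measurable_rVT dT (T : measurableType dT) (f : T -> 'rV[R]_n) :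
  (forall i, measurable_fun setT (fun t => f t ord0 i)) ->
  measurable_fun setT f.
Proof. by move=> mf; apply: measurable_fun_coord_rVP => i; exact: mf. Qed.

Lemma measurable_coordT dT (T : measurableType dT) (f : T -> 'rV[R]_n) i :
  measurable_fun setT f -> measurable_fun setT (fun t => f t ord0 i).
Proof. by move=> mf; exact: (measurableT_comp (measurable_coord_rV i) mf). Qed.

Lemma measurable_box (c : 'rV[R]_n) (r : R) :
  measurable [set y : 'rV[R]_n | forall i, c ord0 i - r < y ord0 i < c ord0 i + r].
Proof.
rewrite (_ : mkset _ = \bigcap_(i in [set: 'I_n])
  (coord_rV i @^-1` [set` `](c ord0 i - r), (c ord0 i + r)[%R])); last first.
  apply/seteqP; split => y /= h i.
    by move=> _ /=; rewrite in_itv/=; exact: h.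
  by have := h i Logic.I; rewrite /= in_itv.
apply: fin_bigcap_measurable => // i _.
rewrite -[X in measurable X]setTI; apply: measurable_coord_rV => //.
Qed.

Lemma rat_near (x e : R) : 0 < e -> exists q : rat, `|x - ratr q| < e.
Proof.
move=> e0; have /rat_in_itvoo[q] : x - e < x + e by rewrite ltrBlDr -addrA ltrDl addr_gt0.
by rewrite in_itv/= => /andP[h1 h2]; exists q; rewrite ltr_norml; apply/andP; split; lra.
Qed.

(** The coordinate sigma-algebra contains the open sets because boxes with
    rational centres and radii form a countable base of the topology. *)
Lemma open_measurable_rV (U : set 'rV[R]_n) : open U -> measurable U.
Proof.
move=> oU.
pose box (q : 'rV[rat]_n * rat) : set 'rV[R]_n :=
  [set y : 'rV[R]_n | forall i, ratr (q.1 ord0 i) - ratr q.2 < y ord0 i < ratr (q.1 ord0 i) + ratr q.2].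
have mbox q : measurable (box q).
  have := measurable_box (\row_i ratr (q.1 ord0 i)) (ratr q.2).
  rewrite (_ : mkset _ = box q)//.
  by apply/seteqP; split => y /= h i; have := h i; rewrite mxE.
rewrite (_ : U = \bigcup_(q : 'rV[rat]_n * rat)
    (if `[< box q `<=` U >] then box q else set0)); last first.
  apply/seteqP; split => [x Ux|x [q _]]; last by case: asboolP => // h /h.
  have /nbhs_ballP[e /= e0 eU] := open_nbhs_nbhs (conj oU Ux).
  have [r /andP[r0 re]] : exists r : rat, 0 < (ratr r : R) < e / 2.
    have /rat_in_itvoo[q] : (0:R) < e / 2 by rewrite divr_gt0.
    by rewrite in_itv/= => h; exists q.
  have /choice[c hc] : forall i, exists q : rat, `|x ord0 i - ratr q| < ratr r.
    by move=> i; exact: rat_near.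
  exists (\row_i c i, r) => //; case: asboolP => [_ i|]; rewrite /= ?mxE.
    by have := hc i; rewrite ltr_norml => /andP[? ?]; apply/andP; split; lra.
  move=> h; exfalso; apply: h => y hy; apply: eU; split=> // i j; rewrite ord1.
  have := hy j; rewrite /= mxE => /andP[h1 h2].
  have := hc j; rewrite ltr_norml => /andP[h3 h4].
  by rewrite /ball /= ltr_norml; apply/andP; split; lra.
apply: countable_bigcupT_measurable => [|q]; last by case: ifP.
exact: countableP.
Qed.

Lemma continuous_measurable_rV f : continuous f -> measurable_fun setT f.
Proof.
move=> /continuousP cf; apply: (measurability _ (RGenOpens.measurableE R)).
move=> _ [_ [a [b ->] <-]]; rewrite setTI; apply: open_measurable_rV.
exact/cf/interval_open.
Qed.

End measurable_rV_functions.

Section affine_line.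
Context {R : realType}.
Local Notation mu := (@lebesgue_measure R).
Implicit Types f : R -> \bar R.

Lemma measurable_affine (a b : R) : measurable_fun setT (fun t : R => a * t + b).
Proof. by apply: measurable_funD => //; exact: measurable_funM. Qed.

Let ge0_integral_posaffine (a b : R) f : 0 < a ->
  measurable_fun setT f -> (forall t, 0 <= f t)%E ->
  (\int[mu]_t f (a * t + b)%R = (a^-1)%:E * \int[mu]_t f t)%E.
Proof.
move=> a0 mf f0.
have ai0 : 0 <= a^-1 by rewrite invr_ge0 ltW.
pose phi (t : measurableTypeR R) : measurableTypeR R := a * t + b.
have mphi : measurable_fun setT phi by exact: measurable_affine.
transitivity (\int[pushforward mu phi]_t f t)%E.
  by rewrite ge0_integral_pushforward// preimage_setT.
rewrite -[a^-1]/(NngNum ai0)%:num -ge0_integral_mscale//.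
apply: eq_measure_integral => A mA _.
have a_n0 : a != 0 by rewrite gt_eqF.
pose nu : {measure set (measurableTypeR R) -> \bar R} := mscale (NngNum (ltW a0))
  (measure_function_pushforward__canonical__measure_function_Measure mu mphi).
have e : mu A = nu A.
  apply: (lebesgue_measure_unique (mu := nu)) => // _ [[x y] _ <-]; rewrite /nu.
  have pre : phi @^-1` `]x, y] = `](x - b) / a, (y - b) / a]%classic.
    apply/seteqP; split => t /=; rewrite !in_itv/= /phi ltr_pdivrMr// ler_pdivlMr// mulrC;
      by move=> /andP[? ?]; apply/andP; split; lra.
  transitivity (a%:E * mu (phi @^-1` `]x, y]))%E => //; rewrite pre.
  rewrite !lebesgue_measure_itv/= !lte_fin ltr_pM2r ?invr_gt0// ltrD2r.
  case: ifP => _; last by rewrite mule0.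
  by rewrite -!EFinD -EFinM; congr EFin; field.
transitivity (((a^-1)%:E * mu A)%E) => //.
by rewrite e /nu /mscale/= muleA -EFinM mulVf// mul1e.
Qed.

Lemma ge0_integral_affine (a b : R) f : a != 0 ->
  measurable_fun setT f -> (forall t, 0 <= f t)%E ->
  (\int[mu]_t f (a * t + b)%R = (`|a|^-1)%:E * \int[mu]_t f t)%E.
Proof.
move=> a0 mf f0; have [ap|an|/eqP] := ltgtP a 0; last by rewrite (negbTE a0).
- pose g t := f (- t).
  have mg : measurable_fun setT g.
    by apply: measurableT_comp => //; exact: oppr_measurable.
  have := @ge0_integral_posaffine (- a) (- b) g.
  rewrite oppr_gt0 => /(_ ap mg (fun t => f0 _)).
  rewrite /g; under eq_integral do rewrite mulNr -opprD opprK.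
  move=> ->; rewrite ltr0_norm//; congr (_ * _)%E.
  pose phi (t : measurableTypeR R) : measurableTypeR R := - t.
  have mphi : measurable_fun setT phi by exact: oppr_measurable.
  transitivity (\int[pushforward mu phi]_t f t)%E.
    by rewrite ge0_integral_pushforward// preimage_setT.
  by apply: eq_measure_integral => A mA _; exact: lebesgue_measureN.
- by rewrite ge0_integral_posaffine// gtr0_norm.
Qed.

End affine_line.

Section integral_rV.
Context {R : realType}.
Local Notation mu := (@lebesgue_measure R).
Local Notation leb := (@lebesgue_rV R _).

Lemma measurable_cons_rVT n dT (T : measurableType dT) (f : T -> R) (g : T -> 'rV[R]_n) :
  measurable_fun setT f -> measurable_fun setT g ->
  measurable_fun setT (fun t => cons_rV (f t : measurableTypeR R, g t)).
Proof.
move=> mf mg; apply: (measurableT_comp (@measurable_cons_rV R n)).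
exact: measurable_fun_pair.
Qed.

Lemma ge0_integral_rVS n (f : 'rV[R]_n.+1 -> \bar R) :
  measurable_fun setT f -> (forall x, 0 <= f x)%E ->
  (\int[lebesgue_rV n.+1]_x f x =
   \int[mu]_t \int[lebesgue_rV n]_x f (cons_rV (t : measurableTypeR R, x)))%E.
Proof.
move=> mf f0.
transitivity (\int[pushforward (mu \x lebesgue_rV n)%E (@cons_rV R n)]_x f x)%E.
  by [].
rewrite ge0_integral_pushforward//; last exact: measurable_cons_rV.
rewrite preimage_setT fubini_tonelli1//.
  by apply: measurableT_comp => //; exact: measurable_cons_rV.
by move=> x; exact: f0.
Qed.

Lemma ge0_integral_rV0 (f : 'rV[R]_0 -> \bar R) :
  (\int[lebesgue_rV 0]_x f x = f 0%R)%E.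
Proof.
rewrite (_ : f = cst (f 0)); last by apply/funext => x; rewrite (thinmx0 x).
rewrite integral_cst//= diracT ?mule1//.
Qed.

(** Every map that acts on each coordinate by an affine bijection scales
    Lebesgue measure; translations, dilations and reflections of one or of all
    coordinates are the instances in use. *)
Lemma ge0_integral_diag_affine n (a b : 'I_n -> R) (f : 'rV[R]_n -> \bar R) :
  (forall i, a i != 0) -> measurable_fun setT f -> (forall x, 0 <= f x)%E ->
  (\int[lebesgue_rV n]_x f (\row_i (a i * x ord0 i + b i))%R =
   (\prod_i `|a i|^-1)%:E * \int[lebesgue_rV n]_x f x)%E.
Proof.
elim: n => [|n IH] in a b f *; move=> a0 mf f0.
  by rewrite !ge0_integral_rV0 big_ord0 mul1e; congr f; apply/rowP => -[].
have mA m (c e : 'I_m -> R) : measurable_fun setT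
    (fun x : 'rV[R]_m => \row_i (c i * x ord0 i + e i)).
  apply: measurable_rVT => i; under eq_fun do rewrite mxE.
  apply: measurable_funD => //; apply: measurable_funM => //.
  exact: measurable_coordT.
rewrite ge0_integral_rVS//; last first.
  exact: (measurableT_comp mf (mA _ a b)).
rewrite ge0_integral_rVS//.
pose a' i := a (lift ord0 i); pose b' i := b (lift ord0 i).
have mfc (t : R) : measurable_fun setT (fun x => f (cons_rV (t : measurableTypeR R, x))).
  by apply: (measurableT_comp mf); exact: measurable_cons_rVT.
have E (t : R) : (\int[lebesgue_rV n]_x f (\row_i (a i * (cons_rV (t : measurableTypeR R, x)) ord0 i + b i))%R
   = (\prod_i `|a' i|^-1)%:E * \int[lebesgue_rV n]_x f (cons_rV ((a ord0 * t + b ord0)%R : measurableTypeR R, x)))%E.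
  rewrite -(IH a' b' (fun x => f (cons_rV ((a ord0 * t + b ord0)%R : measurableTypeR R, x))))//.
    apply: eq_integral => x _; congr f; apply/rowP => i; rewrite !mxE.
    by case: (unliftP ord0 i) => [j|] -> /=; rewrite ?mxE.
  by move=> i; exact: a0.
under eq_integral do rewrite E.
pose g t := (\int[lebesgue_rV n]_x f (cons_rV (t : measurableTypeR R, x)))%E.
have mg : measurable_fun setT g.
  apply: (measurable_fun_fubini_tonelli_F (fun tx => f (cons_rV tx))) => //.
  exact: (measurableT_comp mf (@measurable_cons_rV R n)).
have g0 t : (0 <= g t)%E by exact: integral_ge0.
have pr0 : 0 <= \prod_i `|a' i|^-1 by apply: prodr_ge0 => i _; rewrite invr_ge0.
rewrite ge0_integralZl_EFin//; last 2 first.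
- by move=> t _; exact: (g0 (a ord0 * t + b ord0)).
- by apply: (measurableT_comp mg); exact: measurable_affine.
- rewrite [X in (_ * X)%E](_ : _ = \int[mu]_t g (a ord0 * t + b ord0)%R)%E//.
  by rewrite (@ge0_integral_affine R _ _ g)// muleA -EFinM big_ord_recl mulrC.
Qed.

End integral_rV.

Section integral_rV_affine.
Context {R : realType} (n : nat).
Local Notation leb := (@lebesgue_rV R n).
Implicit Types f : 'rV[R]_n -> R.

Lemma measurable_diag_affine (a b : 'I_n -> R) : measurable_fun setT
  (fun x : 'rV[R]_n => \row_i (a i * x ord0 i + b i)).
Proof.
apply: measurable_rVT => i; under eq_fun do rewrite mxE.
apply: measurable_funD => //; apply: measurable_funM => //.
exact: measurable_coordT.
Qed.

Lemma integrable_diag_affine (a b : 'I_n -> R) f : (forall i, a i != 0) ->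
  leb.-integrable setT (EFin \o f) ->
  leb.-integrable setT (EFin \o (fun x => f (\row_i (a i * x ord0 i + b i)))).
Proof.
move=> a0 /integrableP[/measurable_EFinP mf foo]; apply/integrableP; split.
  by apply/measurable_EFinP; exact: (measurableT_comp mf (measurable_diag_affine a b)).
rewrite (@ge0_integral_diag_affine _ _ a b (fun x => `|(f x)%:E|)%E)//.
  by rewrite lte_mul_pinfty// lee_fin prodr_ge0// => i _; rewrite invr_ge0.
by apply/measurable_EFinP; exact: measurableT_comp.
Qed.

Lemma Rintegral_diag_affine (a b : 'I_n -> R) f : (forall i, a i != 0) ->
  leb.-integrable setT (EFin \o f) ->
  \int[leb]_x f (\row_i (a i * x ord0 i + b i)) =
  \prod_i `|a i|^-1 * \int[leb]_x f x.
Proof.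
move=> a0 fi; have /integrableP[mf foo] := fi.
rewrite /Rintegral integralE [in RHS]integralE.
pose g := EFin \o (fun x : 'rV[R]_n => f (\row_i (a i * x ord0 i + b i))).
have Ep : (\int[leb]_x g^\+ x = (\prod_i `|a i|^-1)%:E * \int[leb]_x (EFin \o f)^\+ x)%E.
  rewrite -(@ge0_integral_diag_affine _ _ a b (((EFin \o f)^\+)%E))//.
    by apply: eq_integral => x _; rewrite !funeposE.
  exact: measurable_funepos.
have En : (\int[leb]_x g^\- x = (\prod_i `|a i|^-1)%:E * \int[leb]_x (EFin \o f)^\- x)%E.
  rewrite -(@ge0_integral_diag_affine _ _ a b (((EFin \o f)^\-)%E))//.
    by apply: eq_integral => x _; rewrite !funenegE.
  exact: measurable_funeneg.
rewrite -/g Ep En.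
have := integrable_pos_fin_num measurableT fi; have := integrable_neg_fin_num measurableT fi.
by move=> h1 h2; rewrite -muleBr// ?fin_num_adde_defr// fineM// fin_numB h1 h2.
Qed.

Lemma rowD (x y : 'rV[R]_n) : \row_i (1 * x ord0 i + y ord0 i) = x + y.
Proof. by apply/rowP => i; rewrite !mxE mul1r. Qed.

Lemma rowNB (x y : 'rV[R]_n) : \row_i (-1 * x ord0 i + y ord0 i) = y - x.
Proof. by apply/rowP => i; rewrite !mxE mulN1r addrC. Qed.

Lemma rowZ (l : R) (x : 'rV[R]_n) : \row_i (l * x ord0 i + 0) = l *: x.
Proof. by apply/rowP => i; rewrite !mxE addr0. Qed.

Lemma integrable_shift f c : leb.-integrable setT (EFin \o f) ->
  leb.-integrable setT (EFin \o (fun x => f (x + c))).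
Proof.
move=> fi.
rewrite (_ : _ \o _ = EFin \o (fun x : 'rV[R]_n => f (\row_i (cst 1 i * x ord0 i + c ord0 i)))).
  by apply: integrable_diag_affine fi => i; rewrite /cst oner_neq0.
by apply/funext => x /=; rewrite -rowD.
Qed.

Lemma Rintegral_shift f c : leb.-integrable setT (EFin \o f) ->
  \int[leb]_x f (x + c) = \int[leb]_x f x.
Proof.
move=> fi; rewrite -[RHS]mul1r -[in RHS](_ : \prod_(i < n) `|1|^-1 = 1 :> R); last first.
  by rewrite big1// => i _; rewrite normr1 invr1.
rewrite -(@Rintegral_diag_affine (cst 1) (fun i => c ord0 i))//; last first.
  by move=> i; exact: oner_neq0.
by under [RHS]eq_Rintegral do rewrite rowD.
Qed.

Lemma integrable_subl f c : leb.-integrable setT (EFin \o f) ->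
  leb.-integrable setT (EFin \o (fun x => f (c - x))).
Proof.
move=> fi.
rewrite (_ : _ \o _ = EFin \o (fun x : 'rV[R]_n => f (\row_i (cst (-1) i * x ord0 i + c ord0 i)))).
  by apply: integrable_diag_affine fi => i; rewrite /cst oppr_eq0 oner_neq0.
by apply/funext => x /=; rewrite -rowNB.
Qed.

Lemma Rintegral_subl f c : leb.-integrable setT (EFin \o f) ->
  \int[leb]_x f (c - x) = \int[leb]_x f x.
Proof.
move=> fi; rewrite -[RHS]mul1r -[in RHS](_ : \prod_(i < n) `|-1|^-1 = 1 :> R); last first.
  by rewrite big1// => i _; rewrite normrN1 invr1.
rewrite -(@Rintegral_diag_affine (cst (-1)) (fun i => c ord0 i))//; last first.
  by move=> i; rewrite oppr_eq0 oner_neq0.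
by under [RHS]eq_Rintegral do rewrite rowNB.
Qed.

Lemma integrable_scale f (l : R) : l != 0 -> leb.-integrable setT (EFin \o f) ->
  leb.-integrable setT (EFin \o (fun x => f (l *: x))).
Proof.
move=> l0 fi.
rewrite (_ : _ \o _ = EFin \o (fun x : 'rV[R]_n => f (\row_i (cst l i * x ord0 i + 0)))).
  by apply: integrable_diag_affine fi => i; rewrite /cst l0.
by apply/funext => x /=; rewrite -rowZ.
Qed.

Lemma Rintegral_scale f (l : R) : 0 < l -> leb.-integrable setT (EFin \o f) ->
  \int[leb]_x f (l *: x) = l ^- n * \int[leb]_x f x.
Proof.
move=> l0 fi.
rewrite -exprVn -[X in X * _](_ : \prod_(i < n) `|l|^-1 = _); last first.
  by rewrite prodr_const card_ord gtr0_norm.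
rewrite -(@Rintegral_diag_affine (cst l) (cst 0))//; last first.
  by move=> i; rewrite gt_eqF.
by under [RHS]eq_Rintegral do rewrite rowZ.
Qed.

(** The reflection of one coordinate. *)
Definition reflect_coord (i : 'I_n) (x : 'rV[R]_n) : 'rV[R]_n :=
  \row_j ((if j == i then -1 else 1) * x ord0 j + 0).

Lemma Rintegral_odd_coord f i : leb.-integrable setT (EFin \o f) ->
  (forall x, f (reflect_coord i x) = - f x) -> \int[leb]_x f x = 0.
Proof.
move=> fi fN.
have := @Rintegral_diag_affine (fun j => if j == i then -1 else 1) (cst 0) f.
move=> /(_ _ fi); rewrite (eq_Rintegral _ (g := fun x => (-1) * f x)); last first.
  by move=> x _; rewrite mulN1r -fN.
rewrite RintegralZl// mulN1r big1 => [H|j _]; last first.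
  by case: ifP => _; rewrite ?normrN1 ?normr1 invr1.
have /H : forall i0, (if i0 == i then -1 else 1 : R) != 0.
  by move=> j; case: ifP => _; rewrite ?oppr_eq0 oner_neq0.
rewrite mul1r => e; lra.
Qed.

End integral_rV_affine.

Section tensor.
Context {R : realType}.

(** Tonelli's theorem for products of functions of one coordinate. *)
Lemma ge0_integral_tensor n (f : 'I_n -> R -> R) :
  (forall i, measurable_fun setT (f i)) -> (forall i t, 0 <= f i t) ->
  (\int[lebesgue_rV n]_x (\prod_i f i (x ord0 i))%:E =
   \prod_i \int[lebesgue_measure]_t (f i t)%:E)%E.
Proof.
elim: n => [|n IH] in f *; move=> mf f0.
  by rewrite ge0_integral_rV0 !big_ord0.
have mp m (g : 'I_m -> R -> R) : (forall i, measurable_fun setT (g i)) ->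
    measurable_fun setT (fun x : 'rV[R]_m => \prod_i g i (x ord0 i)).
  move=> mg; apply: measurable_prod => i _.
  by apply: (measurableT_comp (mg i)); exact: measurable_coordT.
rewrite ge0_integral_rVS//; last 2 first.
- by apply/measurable_EFinP; exact: mp.
- by move=> x; rewrite lee_fin prodr_ge0.
rewrite big_ord_recl -(IH (fun i => f (lift ord0 i)))//.
have I0 : (0 <= \int[lebesgue_rV n]_x (\prod_i f (lift ord0 i) (x ord0 i))%:E)%E.
  by apply: integral_ge0 => x _; rewrite lee_fin prodr_ge0.
rewrite -ge0_integralZr//; last 2 first.
- by apply/measurable_EFinP; exact: mf.
- by move=> t _; rewrite lee_fin.
apply: eq_integral => t _.
rewrite -ge0_integralZl_EFin//; last 2 first.
- by move=> x _; rewrite lee_fin prodr_ge0.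
- by apply/measurable_EFinP; exact: (mp _ (fun i => f (lift ord0 i))).
apply: eq_integral => x _; rewrite -EFinM; congr EFin.
rewrite big_ord_recl; congr (_ * _).
  by rewrite mxE unlift_none.
by apply: eq_bigr => i _; rewrite mxE liftK.
Qed.

End tensor.

Section real_integrals.
Context d (T : measurableType d) (R : realType) (mu : {measure set T -> \bar R}).
Implicit Types f g : T -> R.

Lemma dom_integrable f g : measurable_fun setT f -> (forall x, `|f x| <= g x) ->
  mu.-integrable setT (EFin \o g) -> mu.-integrable setT (EFin \o f).
Proof.
move=> mf fg gi; apply: (le_integrable _ _ _ gi) => //; first exact/measurable_EFinP.
move=> x _ /=; rewrite lee_fin (le_trans (fg x))//; exact: ler_norm.
Qed.

Lemma integrableT_measurable f : mu.-integrable setT (EFin \o f) -> measurable_fun setT f.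
Proof. by case/integrableP => /measurable_EFinP. Qed.

Lemma integrable_normr f : mu.-integrable setT (EFin \o f) ->
  mu.-integrable setT (EFin \o (fun x => `|f x|)).
Proof. by move=> fi; apply: (integrable_norm fi). Qed.

Lemma integrable_scaler f (k : R) : mu.-integrable setT (EFin \o f) ->
  mu.-integrable setT (EFin \o (fun x => k * f x)).
Proof.
move=> fi; have := integrableZl measurableT k fi.
by apply: eq_integrable => // x _ /=; rewrite EFinM.
Qed.

Lemma integrable_addr f g : mu.-integrable setT (EFin \o f) ->
  mu.-integrable setT (EFin \o g) -> mu.-integrable setT (EFin \o (fun x => f x + g x)).
Proof.
move=> fi gi; have := integrableD measurableT fi gi.
by apply: eq_integrable => // x _ /=; rewrite EFinD.
Qed.

Lemma integrable_subr f g : mu.-integrable setT (EFin \o f) ->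
  mu.-integrable setT (EFin \o g) -> mu.-integrable setT (EFin \o (fun x => f x - g x)).
Proof.
move=> fi gi; have := integrableB measurableT fi gi.
by apply: eq_integrable => // x _ /=; rewrite EFinB.
Qed.

Lemma integrable_ltyP f : measurable_fun setT f -> (forall x, 0 <= f x) ->
  (\int[mu]_x (f x)%:E < +oo)%E -> mu.-integrable setT (EFin \o f).
Proof.
move=> mf f0 foo; apply/integrableP; split; first exact/measurable_EFinP.
by under eq_integral do rewrite /= ger0_norm//.
Qed.

Lemma EFin_Rintegral f : mu.-integrable setT (EFin \o f) ->
  ((\int[mu]_x f x)%:E = \int[mu]_x (f x)%:E)%E.
Proof. by move=> fi; rewrite /Rintegral fineK//; exact: integrable_fin_num. Qed.

Lemma normr_Rintegral_le f g : mu.-integrable setT (EFin \o f) ->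
  mu.-integrable setT (EFin \o g) -> (forall x, `|f x| <= g x) ->
  `|\int[mu]_x f x| <= \int[mu]_x g x.
Proof.
move=> fi gi fg; apply: (le_trans (le_normr_Rintegral _ _)) => //.
by apply: le_Rintegral => //; exact: integrable_normr.
Qed.

Lemma Rintegral_gt0 f : mu.-integrable setT (EFin \o f) ->
  (forall x, 0 <= f x) -> ~ {ae mu, forall x, f x = 0} -> 0 < \int[mu]_x f x.
Proof.
move=> fi f0 fn0; rewrite lt_neqAle Rintegral_ge0// andbT; apply/eqP => /esym e.
apply: fn0; have := EFin_Rintegral fi; rewrite e => /esym e'.
have : (\int[mu]_x `|(EFin \o f) x| = 0)%E.
  by rewrite -[RHS]e'; apply: eq_integral => x _ /=; rewrite ger0_norm.
move/(ae_eq_integral_abs _ measurableT (measurable_int _ fi)).1.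
by apply: filterS => x /(_ I) /= [].
Qed.

Lemma cvg_Rintegral_dominated (f_ : nat -> T -> R) f g :
  (forall n, measurable_fun setT (f_ n)) ->
  (forall x, f_ n x @[n --> \oo] --> f x) ->
  (forall n x, `|f_ n x| <= g x) -> mu.-integrable setT (EFin \o g) ->
  \int[mu]_x f_ n x @[n --> \oo] --> \int[mu]_x f x.
Proof.
move=> mf ff fg gi.
have mfl : measurable_fun setT f by apply: (measurable_fun_cvg mf) => x _; exact: ff.
have [|||||fi _ cv] := @dominated_convergence _ _ _ mu setT measurableT
    (fun n => EFin \o f_ n) (EFin \o f) (EFin \o g).
- by move=> n; exact/measurable_EFinP.
- exact/measurable_EFinP.
- by apply: aeW => x _; apply: cvg_EFin; [exact: nearW|exact: ff].
- exact: gi.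
- by apply: aeW => x n _; rewrite /= lee_fin.
by apply: fine_cvg; rewrite EFin_Rintegral.
Qed.

Lemma continuous_Rintegral_dominated (V : pseudoMetricType R) (F : V -> T -> R) (y0 : V) g :
  (forall y, measurable_fun setT (F y)) ->
  (forall x, F y x @[y --> y0] --> F y0 x) ->
  (\forall y \near y0, forall x, `|F y x| <= g x) ->
  mu.-integrable setT (EFin \o g) ->
  \int[mu]_x F y x @[y --> y0] --> \int[mu]_x F y0 x.
Proof.
move=> mF cF Fg gi; apply/cvgrPdist_lt => e e0.
apply: contrapT => /= nn.
have [r /= r0 Fgr] := (nbhs_ballP _ _).1 Fg.
have /choice[y hy] : forall n : nat, exists y, ball y0 (Num.min r n.+1%:R^-1) y /\
    e <= `|\int[mu]_x F y0 x - \int[mu]_x F y x|.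
  move=> n; apply: contrapT => H; apply: nn; apply/nbhs_ballP.
  exists (Num.min r n.+1%:R^-1) => /= [|y yb]; first by rewrite lt_min r0 invr_gt0 ltr0n.
  by rewrite ltNge; apply/negP => he; apply: H; exists y.
have yc : y n @[n --> \oo] --> y0.
  apply/cvg_ballP => eps eps0; near=> n.
  apply: le_ball (hy n).1; rewrite ge_min; apply/orP; right.
  rewrite invf_ple ?posrE// ?ltr0n//.
  apply: (@le_trans _ _ n%:R); last by rewrite ler_nat.
  near: n; exact: nbhs_infty_ger.
have /cvgrPdist_lt/(_ e e0)[N _ /(_ N (leqnn N))] :
    \int[mu]_x F (y n) x @[n --> \oo] --> \int[mu]_x F y0 x.
  apply: (cvg_Rintegral_dominated (g := g)) => //.
  - by move=> x; exact: (cvg_comp _ _ yc (cF x)).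
  - move=> n; apply: Fgr; apply: le_ball (hy n).1; by rewrite ge_min lexx.
by rewrite ltNge (hy N).2.
Unshelve. all: by end_near. Qed.

End real_integrals.

Section fubini_real.
Context d1 d2 (T1 : measurableType d1) (T2 : measurableType d2) (R : realType).
Variable m1 : {sigma_finite_measure set T1 -> \bar R}.
Variable m2 : {sigma_finite_measure set T2 -> \bar R}.
Implicit Types f : T1 * T2 -> R.

Lemma measurable_Rintegral2 f : measurable_fun setT f ->
  measurable_fun setT (fun x => \int[m2]_y f (x, y)).
Proof.
move=> mf; apply: (measurableT_comp (fine_measurable measurableT)).
rewrite (_ : (fun x => _) = (fun x => \int[m2]_y (EFin \o f)^\+ (x, y) -
    \int[m2]_y (EFin \o f)^\- (x, y))%E); last first.
  apply/funext => x; rewrite integralE; congr (_ - _)%E.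
    by apply: eq_integral => y _; rewrite !funeposE.
  by apply: eq_integral => y _; rewrite !funenegE.
have mf' : measurable_fun setT (EFin \o f) by exact/measurable_EFinP.
apply: emeasurable_funB.
  by apply: measurable_fun_fubini_tonelli_F => //; exact: measurable_funepos.
by apply: measurable_fun_fubini_tonelli_F => //; exact: measurable_funeneg.
Qed.

Lemma measurable_Rintegral1 f : measurable_fun setT f ->
  measurable_fun setT (fun y => \int[m1]_x f (x, y)).
Proof.
move=> mf; apply: (measurableT_comp (fine_measurable measurableT)).
rewrite (_ : (fun y => _) = (fun y => \int[m1]_x (EFin \o f)^\+ (x, y) -
    \int[m1]_x (EFin \o f)^\- (x, y))%E); last first.
  apply/funext => y; rewrite integralE; congr (_ - _)%E.
    by apply: eq_integral => x _; rewrite !funeposE.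
  by apply: eq_integral => x _; rewrite !funenegE.
have mf' : measurable_fun setT (EFin \o f) by exact/measurable_EFinP.
apply: emeasurable_funB.
  by apply: measurable_fun_fubini_tonelli_G => //; exact: measurable_funepos.
by apply: measurable_fun_fubini_tonelli_G => //; exact: measurable_funeneg.
Qed.

Lemma integrable_Rintegral2 f : (m1 \x m2)%E.-integrable setT (EFin \o f) ->
  m1.-integrable setT (EFin \o (fun x => \int[m2]_y f (x, y))).
Proof.
move=> fi; have := integrable_fubini_F fi.
have mf : measurable_fun setT f by case/integrableP : fi => /measurable_EFinP.
apply: (le_integrable measurableT).
  by apply/measurable_EFinP; exact: measurable_Rintegral2.
move=> x _ /=; rewrite /Rintegral -/(fubini_F m2 (EFin \o f) x).
by case: (fubini_F _ _ _) => [r||]//=; rewrite leey.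
Qed.

Let RintegralE f : (m1 \x m2)%E.-integrable setT (EFin \o f) ->
  (\int[m1]_x \int[m2]_y f (x, y) = fine (\int[m1 \x m2]_z (f z)%:E)%E)%R.
Proof.
move=> fi; rewrite -(integral12_prod_meas1 fi) /Rintegral; congr fine.
have mf : measurable_fun setT f by case/integrableP : fi => /measurable_EFinP.
apply: ae_eq_integral => //.
- by apply/measurable_EFinP; exact: measurable_Rintegral2.
- exact: (measurable_fubini_F fi).
apply: filterS (ae_integrable1 fi) => x ix _ /=.
by rewrite fineK//; exact: integrable_fin_num.
Qed.

Let RintegralE' f : (m1 \x m2)%E.-integrable setT (EFin \o f) ->
  (\int[m2]_y \int[m1]_x f (x, y) = fine (\int[m1 \x m2]_z (f z)%:E)%E)%R.
Proof.
move=> fi; rewrite -(integral21_prod_meas1 fi) /Rintegral; congr fine.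
have mf : measurable_fun setT f by case/integrableP : fi => /measurable_EFinP.
apply: ae_eq_integral => //.
- by apply/measurable_EFinP; exact: measurable_Rintegral1.
- exact: (measurable_fubini_G fi).
apply: filterS (ae_integrable2 fi) => x ix _ /=.
by rewrite fineK//; exact: integrable_fin_num.
Qed.

Lemma Rintegral_swap f : (m1 \x m2)%E.-integrable setT (EFin \o f) ->
  \int[m1]_x \int[m2]_y f (x, y) = \int[m2]_y \int[m1]_x f (x, y).
Proof. by move=> fi; rewrite RintegralE// RintegralE'. Qed.

Lemma integrable_iterated f : measurable_fun setT f ->
  (\int[m1]_x \int[m2]_y `|f (x, y)|%:E < +oo)%E ->
  (m1 \x m2)%E.-integrable setT (EFin \o f).
Proof. by move=> mf; rewrite integrable12ltyP//; exact/measurable_EFinP. Qed.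

Lemma integrable_tensor_dominated f (a : T1 -> R) (b : T2 -> R) :
  measurable_fun setT f -> (forall x y, `|f (x, y)| <= a x * b y) ->
  m1.-integrable setT (EFin \o a) -> m2.-integrable setT (EFin \o b) ->
  (m1 \x m2)%E.-integrable setT (EFin \o f).
Proof.
move=> mf fab ai bi; apply: integrable_iterated => //.
have [ma ioa] := integrableP _ _ _ ai; have [mb iob] := integrableP _ _ _ bi.
have ma' := integrableT_measurable ai; have mb' := integrableT_measurable bi.
apply: (@le_lt_trans _ _ (\int[m1]_x \int[m2]_y (`|a x| * `|b y|)%:E)%E).
  apply: ge0_le_integral => //.
  - by move=> x _; exact: integral_ge0.
  - apply: (measurable_fun_fubini_tonelli_F (fun z => `|f z|%:E)) => //.
    by apply/measurable_EFinP; exact: measurableT_comp.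
  - apply: (measurable_fun_fubini_tonelli_F (fun z => (`|a z.1| * `|b z.2|)%:E)) => //.
    apply/measurable_EFinP; apply: measurable_funM; apply: measurableT_comp => //.
    + exact: (measurableT_comp ma').
    + exact: (measurableT_comp mb').
  move=> x _; apply: ge0_le_integral => //.
  - apply/measurable_EFinP; apply: measurableT_comp => //.
    exact: (measurableT_comp mf (measurable_pair1 x)).
  - apply/measurable_EFinP; apply: measurable_funM => //; exact: measurableT_comp.
  move=> y _; rewrite lee_fin -normrM (le_trans (fab x y))//; exact: ler_norm.
under eq_integral => x _.
  under eq_integral do rewrite EFinM.
  rewrite ge0_integralZl_EFin//; last by apply/measurable_EFinP; exact: measurableT_comp.
  over.
rewrite ge0_integralZr//.
- by rewrite lte_mul_pinfty// ?integral_ge0// ge0_fin_numE// integral_ge0.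
- by apply/measurable_EFinP; exact: measurableT_comp.
- exact: integral_ge0.
Qed.

End fubini_real.

Section half_line.
Context {R : realType}.
Local Notation mu := (@lebesgue_measure R).
Implicit Types (a c g t : R) (f : R -> R).

Lemma integral_powR_itv g a b : g != 0 -> 0 < a -> a < b ->
  (\int[mu]_(t in `[a, b]) (t `^ (g - 1))%:E = (g^-1 * (b `^ g - a `^ g))%:E)%E.
Proof.
move=> g0 a0 ab.
have pos t : t \in `[a, b] -> t \in `]0, +oo[.
  by rewrite !in_itv/= andbT => /andP[at_ _]; exact: lt_le_trans at_.
have dP (h t : R) : 0 < t -> derivable (fun t => t `^ h) t 1.
  by move=> t0; apply: derivable_powR; rewrite in_itv/= t0.
have cP (h t : R) : 0 < t -> {for t, continuous (fun t => t `^ h)}.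
  by move=> t0; apply: differentiable_continuous; apply/derivable1_diffP; exact: dP.
rewrite (@continuous_FTC2 _ _ (fun t => g^-1 * t `^ g) a b)//.
- by rewrite -EFinB -mulrBr.
- apply: derivable_within_continuous => t tab; apply: dP.
  by have := pos _ tab; rewrite in_itv/= andbT.
- split.
  + move=> t; rewrite in_itv/= => /andP[at_ _]; apply: derivableM => //.
    by apply: dP; exact: (lt_trans a0 at_).
  + apply: cvgM; first exact: cvg_cst.
    apply: cvg_at_right_filter; exact: (cP g a).
  + apply: cvgM; first exact: cvg_cst.
    apply: cvg_at_left_filter; apply: cP; exact: (lt_trans a0 ab).
- move=> t; rewrite in_itv/= => /andP[at_ _]; rewrite derive1E deriveM//; last first.
    by apply: dP; exact: (lt_trans a0 at_).
  have t0 : 0 < t by exact: (lt_trans a0 at_).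
  rewrite derive_cst scaler0 addr0 -derive1E powR_derive1 ?in_itv/= ?t0//.
  by rewrite /GRing.scale/= mulrA mulVf// mul1r.
Qed.

(** Powers on the half-line, extended by zero to the left. *)
Definition hpow g t : R := if 0 < t then t `^ (g - 1) else 0.

Lemma hpow_ge0 g t : 0 <= hpow g t.
Proof. by rewrite /hpow; case: ifP => // _; exact: powR_ge0. Qed.

Lemma measurable_hpow g : measurable_fun setT (hpow g).
Proof.
by apply: measurable_fun_ifT => //; exact: measurable_fun_ltr.
Qed.

Lemma hpow_min_integrable g1 g2 : 0 < g1 -> g2 < 0 ->
  mu.-integrable setT (EFin \o (fun t => Num.min (hpow g1 t) (hpow g2 t))).
Proof.
move=> g10 g20; have mm : measurable_fun setT (fun t => Num.min (hpow g1 t) (hpow g2 t)).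
  by apply: measurable_minr; exact: measurable_hpow.
apply: integrable_ltyP => //; first by move=> t; rewrite le_min !hpow_ge0.
pose F n : set R := `[n.+2%:R^-1, n.+2%:R]%classic.
have n1 n : 1 < n.+2%:R :> R by rewrite ltr1n.
have n0 n : 0 < n.+2%:R^-1 :> R by rewrite invr_gt0 ltr0n.
have n2 n : n.+2%:R^-1 < 1 :> R by rewrite invf_lt1.
have Fn : {homo F : n m / (n <= m)%N >-> (n <= m)%O}.
  move=> n m nm; apply/subsetPset => t; rewrite /F /= !in_itv/= => /andP[h1 h2].
  rewrite (le_trans h2) ?ler_nat ?ltnS// (le_trans _ h1)//.
  by rewrite lef_pV2 ?posrE ?ltr0n// ler_nat.
pose h t := (Num.min (hpow g1 t) (hpow g2 t))%:E.
have mh : measurable_fun setT h by exact/measurable_EFinP.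
have h0 t : (0 <= h t)%E by rewrite lee_fin le_min !hpow_ge0.
have bnd n : (\int[mu]_(t in F n) h t <= (g1^-1 - g2^-1)%:E)%E.
  rewrite (_ : F n = `[n.+2%:R^-1, 1%R]%classic `|` `]1%R, n.+2%:R]%classic); last first.
    by rewrite /F (@itv_bndbnd_setU _ _ _ (BRight 1))// bnd_simp ?ltW.
  rewrite ge0_integral_setU//=; last 2 first.
  - exact: measurable_funTS.
  - apply/disj_setPS => t [] /=; rewrite !in_itv/= => /andP[_ h1] /andP[h2 _].
    by have := le_lt_trans h1 h2; rewrite ltxx.
  rewrite EFinB; apply: leeD.
  + apply: (@le_trans _ _ (\int[mu]_(t in `[(n.+2%:R^-1)%R, 1%R]) (t `^ (g1 - 1))%:E)%E).
      apply: ge0_le_integral => //=.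
      * exact: measurable_funTS.
      * by apply/measurable_EFinP; exact: measurable_funTS.
      move=> t; rewrite in_itv/= => /andP[ht _]; rewrite lee_fin /hpow (lt_le_trans _ ht)//.
      by rewrite ge_min lexx.
    rewrite integral_powR_itv ?gt_eqF// lee_fin powR1 -[leRHS]mulr1.
    by rewrite ler_pM2l ?invr_gt0// gerBl powR_ge0.
  + apply: (@le_trans _ _ (\int[mu]_(t in `[1%R, n.+2%:R]) (t `^ (g2 - 1))%:E)%E).
      rewrite -[leRHS]integral_itv_obnd_cbnd; last first.
        by apply/measurable_EFinP; exact: measurable_funTS.
      apply: ge0_le_integral => //=.
      * exact: measurable_funTS.
      * by apply/measurable_EFinP; exact: measurable_funTS.
      move=> t; rewrite in_itv/= => /andP[ht _]; rewrite lee_fin /hpow (lt_trans _ ht)//.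
      by rewrite ge_min lexx orbT.
    rewrite integral_powR_itv ?lt_eqF// lee_fin powR1 -[leRHS]mulrN1.
    by rewrite ler_nM2l ?invr_lt0// lerBrDr addNr powR_ge0.
have cv : (\int[mu]_(t in F n) h t)%E @[n --> \oo] -->
    (\int[mu]_(t in \bigcup_n F n) h t)%E.
  apply: ge0_nondecreasing_set_cvg_integral => //.
  - by move=> n; exact: measurable_itv.
  - by move=> n; exact: measurable_funTS.
apply: (@le_lt_trans _ _ (g1^-1 - g2^-1)%:E); last exact: ltry.
rewrite (_ : (\int[mu]_t h t)%E = \int[mu]_(t in \bigcup_n F n) h t)%E.
  rewrite -(cvg_lim _ cv)//; apply: lime_le; last exact: nearW.
  by apply/cvg_ex; eexists; exact: cv.
rewrite [RHS]integral_mkcond; apply: eq_integral => t _.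
rewrite patchE; case: ifPn => // /negP tF; rewrite /h /hpow.
case: ltP => [t0|_]; last by rewrite minxx.
exfalso; apply: tF; rewrite inE.
have [n hn] : exists n : nat, t <= n%:R /\ t^-1 <= n%:R.
  exists (maxn (Num.truncn t).+1 (Num.truncn t^-1).+1); split.
    by rewrite (le_trans (ltW (truncnS_gt t)))// ler_nat leq_maxl.
  by rewrite (le_trans (ltW (truncnS_gt t^-1)))// ler_nat leq_maxr.
exists n => //; rewrite /F /= in_itv/=; apply/andP; split.
  by rewrite invf_ple ?posrE ?ltr0n// (le_trans hn.2)// ler_nat -addn2 leq_addr.
by rewrite (le_trans hn.1)// ler_nat -addn2 leq_addr.
Qed.

Lemma Rintegral_gt0_itv f (a b : R) : a < b -> mu.-integrable setT (EFin \o f) ->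
  (forall t, 0 <= f t) -> (forall t, a < t < b -> 0 < f t) -> 0 < \int[mu]_t f t.
Proof.
move=> ab fi f0 fab; apply: Rintegral_gt0 => // -[N [mN N0 hN]].
have : (mu `]a, b[%classic <= mu N)%E.
  apply: le_measure; rewrite ?inE//.
  move=> t /=; rewrite in_itv/= => /fab ft; apply: hN => /= e.
  by rewrite e ltxx in ft.
by rewrite N0 lebesgue_measure_itv/= lte_fin ab -EFinB lee_fin subr_le0 leNgt ab.
Qed.

Lemma hpow_expR_integrable a c : 0 < a -> 0 < c ->
  mu.-integrable setT (EFin \o (fun t => hpow a t * expR (- (c * t)))).
Proof.
move=> a0 c0; have a1 : 0 < a + 1 by rewrite addr_gt0.
pose k := c / (a + 1); have k0 : 0 < k by rewrite divr_gt0.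
pose K := Num.max 1 (expR (- ((a + 1) * ln k))).
have Ki := integrable_scaler K (hpow_min_integrable a0 (ltrN10 R)).
apply: dom_integrable Ki.
  apply: measurable_funM; first exact: measurable_hpow.
  apply: (measurableT_comp (@measurable_expR R)); exact: measurableT_comp.
move=> t; rewrite ger0_norm ?mulr_ge0 ?hpow_ge0 ?expR_ge0//.
have K1 : 1 <= K by rewrite /K le_max lexx.
rewrite {2 3}/hpow /hpow; case: ltP => t0; last by rewrite mul0r minxx mulr0.
rewrite minr_pMr ?(le_trans ler01)// le_min; apply/andP; split.
  rewrite mulrC ler_pM ?expR_ge0 ?powR_ge0// (le_trans _ K1)// -expR0 ler_expR.
  by rewrite oppr_le0 mulr_ge0 ?ltW.
have -> : t `^ (a - 1) = t `^ (a + 1) * t `^ (- 1 - 1).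
  by rewrite -powRD ?(gt_eqF t0) ?implybT//; congr (_ `^ _); lra.
rewrite mulrAC ler_wpM2r ?powR_ge0// /powR gt_eqF// -expRD.
rewrite /K le_max; apply/orP; right; rewrite ler_expR.
have := ln_sublinear (mulr_gt0 k0 t0); rewrite lnM ?posrE// => /ltW h.
have : (a + 1) * (ln k + ln t) <= (a + 1) * (k * t) by rewrite ler_pM2l.
rewrite [X in _ <= X](_ : _ = c * t) => [|]; first lra.
by rewrite /k mulrA [_ * (c / _)]mulrC divfK// gt_eqF.
Qed.

Lemma Gamma_hpow a : Gamma a = \int[mu]_t (hpow a t * expR (- t)).
Proof.
rewrite /Gamma Rintegral_mkcond; apply: eq_Rintegral => t _.
rewrite patchE /hpow; case: ifPn; rewrite ?inE ?notin_setE /= in_itv/= andbT.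
  by move=> ->.
by move/negP/negbTE => ->; rewrite mul0r.
Qed.

Lemma Gamma_gt0 a : 0 < a -> 0 < Gamma a.
Proof.
move=> a0; rewrite Gamma_hpow; apply: (@Rintegral_gt0_itv _ 0 1) => //.
- have := hpow_expR_integrable a0 ltr01; apply: eq_integrable => // t _ /=.
  by rewrite mul1r.
- by move=> t; rewrite mulr_ge0 ?hpow_ge0 ?expR_ge0.
- by move=> t /andP[t0 _]; rewrite mulr_gt0 ?expR_gt0// /hpow t0 powR_gt0.
Qed.

Lemma integrable_affine f (a b : R) : a != 0 -> mu.-integrable setT (EFin \o f) ->
  mu.-integrable setT (EFin \o (fun t => f (a * t + b))).
Proof.
move=> a0 /integrableP[/measurable_EFinP mf foo]; apply/integrableP; split.
  by apply/measurable_EFinP; apply: (measurableT_comp mf); exact: measurable_affine.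
rewrite (@ge0_integral_affine _ _ _ (fun x => `|(f x)%:E|)%E)//.
  by rewrite lte_mul_pinfty.
by apply/measurable_EFinP; exact: measurableT_comp.
Qed.

Lemma Rintegral_dilate f c : 0 < c -> mu.-integrable setT (EFin \o f) ->
  \int[mu]_t f (c * t) = c^-1 * \int[mu]_t f t.
Proof.
move=> c0 fi; have /integrableP[mf foo] := fi.
have cn0 : c != 0 by rewrite gt_eqF.
rewrite /Rintegral integralE [in RHS]integralE.
have Ep : (\int[mu]_t (fun t => (f (c * t))%:E)^\+ t = (c^-1)%:E * \int[mu]_t (EFin \o f)^\+ t)%E.
  rewrite -[c in RHS]gtr0_norm// -(@ge0_integral_affine R c 0 (((EFin \o f)^\+)%E))//.
    by apply: eq_integral => x _; rewrite !funeposE addr0.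
  exact: measurable_funepos.
have En : (\int[mu]_t (fun t => (f (c * t))%:E)^\- t = (c^-1)%:E * \int[mu]_t (EFin \o f)^\- t)%E.
  rewrite -[c in RHS]gtr0_norm// -(@ge0_integral_affine R c 0 (((EFin \o f)^\-)%E))//.
    by apply: eq_integral => x _; rewrite !funenegE addr0.
  exact: measurable_funeneg.
rewrite Ep En.
have := integrable_pos_fin_num measurableT fi; have := integrable_neg_fin_num measurableT fi.
by move=> h1 h2; rewrite -muleBr// ?fin_num_adde_defr// fineM// fin_numB h1 h2.
Qed.

Lemma Rintegral_dilateZ f c : 0 < c -> mu.-integrable setT (EFin \o f) ->
  mu.-integrable setT (EFin \o (fun t => c * f (c * t))) /\
  \int[mu]_t f t = \int[mu]_t (c * f (c * t)).
Proof.
move=> c0 fi; have ci : mu.-integrable setT (EFin \o (fun t => f (c * t))).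
  have := integrable_affine 0 (lt0r_neq0 c0) fi.
  by apply: eq_integrable => // t _ /=; rewrite addr0.
split; first exact: integrable_scaler.
by rewrite RintegralZl// Rintegral_dilate// mulrA mulfV ?mul1r// gt_eqF.
Qed.

Lemma hpowM a c t : 0 < c -> hpow a (c * t) = c `^ (a - 1) * hpow a t.
Proof.
move=> c0; rewrite /hpow pmulr_rgt0//; case: ifPn => // [t0|_]; last by rewrite mulr0.
by rewrite powRM// ltW.
Qed.

(** The subordination formula: a negative power is a superposition of
    exponentials. *)
Lemma Rintegral_hpow_expR a c : 0 < a -> 0 < c ->
  \int[mu]_t (hpow a t * expR (- (c * t))) = c `^ (- a) * Gamma a.
Proof.
move=> a0 c0; rewrite Gamma_hpow.
have gi : mu.-integrable setT (EFin \o (fun t => hpow a t * expR (- t))).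
  have := hpow_expR_integrable a0 ltr01; apply: eq_integrable => // t _ /=.
  by rewrite mul1r.
have := Rintegral_dilate c0 gi.
have -> : \int[mu]_t (hpow a (c * t) * expR (- (c * t))) =
    \int[mu]_t (c `^ (a - 1) * (hpow a t * expR (- (c * t)))).
  by apply: eq_Rintegral => t _; rewrite hpowM// mulrA.
rewrite RintegralZl//; last exact: hpow_expR_integrable.
move=> h; have : c `^ (1 - a) * (c `^ (a - 1) * \int[mu]_t (hpow a t * expR (- (c * t)))) =
    c `^ (1 - a) * (c^-1 * \int[mu]_t (hpow a t * expR (- t))) by rewrite h.
rewrite !mulrA -powRD ?(gt_eqF c0) ?implybT// -powR_inv1 ?ltW// -powRD ?(gt_eqF c0) ?implybT//.
by rewrite (_ : 1 - a + (a - 1) = 0) ?powRr0 ?mul1r; [move=> ->; congr (_ `^ _ * _)|]; lra.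
Qed.

End half_line.

Section euclidean_norm.
Context {R : realType} (n : nat).
Implicit Types (x y z : 'rV[R]_n) (l : R).

Lemma dotv_ge0 x : 0 <= dotv x x.
Proof. by apply: sumr_ge0 => i _; rewrite -expr2 sqr_ge0. Qed.

Lemma enorm_ge0 x : 0 <= enorm x. Proof. exact: sqrtr_ge0. Qed.

Lemma sqr_enorm x : enorm x ^+ 2 = \sum_i x ord0 i ^+ 2.
Proof. by rewrite /enorm sqr_sqrtr ?dotv_ge0//; apply: eq_bigr => i _; rewrite expr2. Qed.

Lemma enorm_le x l : 0 <= l -> \sum_i x ord0 i ^+ 2 <= l ^+ 2 -> enorm x <= l.
Proof. by move=> l0; rewrite -sqr_enorm ler_sqr ?nnegrE ?enorm_ge0. Qed.

Lemma enorm0 : enorm (0 : 'rV[R]_n) = 0.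
Proof.
apply/eqP; rewrite eq_le enorm_ge0 andbT enorm_le//.
by rewrite big1 ?expr0n//= => i _; rewrite mxE expr0n.
Qed.

Lemma enormZ l x : enorm (l *: x) = `|l| * enorm x.
Proof.
apply/eqP; rewrite -(eqrXn2 (ltn0Sn 1)) ?mulr_ge0 ?enorm_ge0//.
rewrite exprMn !sqr_enorm real_normK ?num_real// mulr_sumr.
by apply/eqP/eq_bigr => i _; rewrite mxE exprMn.
Qed.

Lemma enormN x : enorm (- x) = enorm x.
Proof. by rewrite -scaleN1r enormZ normrN1 mul1r. Qed.

Lemma enormB x y : enorm (x - y) = enorm (y - x).
Proof. by rewrite -enormN opprB. Qed.

Lemma coord_le_enorm x i : `|x ord0 i| <= enorm x.
Proof.
rewrite -ler_sqr ?nnegrE ?enorm_ge0// sqr_enorm real_normK ?num_real//.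
by rewrite (bigD1 i)//= lerDl sumr_ge0// => j _; rewrite sqr_ge0.
Qed.

Lemma enorm_eq0 x : enorm x = 0 -> x = 0.
Proof.
move=> e; apply/rowP => i; rewrite mxE; apply/eqP; rewrite -normr_le0 -e.
exact: coord_le_enorm.
Qed.

Lemma dotv_le x y : `|dotv x y| <= enorm x * enorm y.
Proof.
have [/eqP|x0] := eqVneq (enorm x) 0.
  move/eqP/enorm_eq0 => ->; rewrite enorm0 mul0r /dotv big1 ?normr0// => i _.
  by rewrite mxE mul0r.
have [/eqP|y0] := eqVneq (enorm y) 0.
  move/eqP/enorm_eq0 => ->; rewrite enorm0 mulr0 /dotv big1 ?normr0// => i _.
  by rewrite mxE mulr0.
have xp : 0 < enorm x by rewrite lt_neqAle eq_sym x0 enorm_ge0.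
have yp : 0 < enorm y by rewrite lt_neqAle eq_sym y0 enorm_ge0.
have key (e : R) : e ^+ 2 = 1 -> 0 <= 2 * (enorm x * enorm y) * (enorm x * enorm y + e * dotv x y).
  move=> e2; have := dotv_ge0 (enorm y *: x + (e * enorm x) *: y).
  rewrite /dotv (_ : \sum_i _ = enorm y ^+ 2 * \sum_i x ord0 i ^+ 2 +
     enorm x ^+ 2 * (\sum_i y ord0 i ^+ 2) + 2 * e * (enorm x * enorm y) * \sum_i x ord0 i * y ord0 i).
    by rewrite -!sqr_enorm => h; apply: le_trans h _; rewrite le_eqVlt; apply/orP; left; apply/eqP; ring.
  rewrite !mulr_sumr -!big_split/=; apply: eq_bigr => i _; rewrite !mxE.
  transitivity (enorm y ^+ 2 * x ord0 i ^+ 2 + e ^+ 2 * (enorm x ^+ 2 * y ord0 i ^+ 2) +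
      2 * e * (enorm x * enorm y) * (x ord0 i * y ord0 i)); first ring.
  by rewrite e2 mul1r.
have xy : 0 < 2 * (enorm x * enorm y) by rewrite !mulr_gt0.
have h1 := key 1 (expr1n _ _).
have h2 := key (-1); rewrite sqrrN expr1n in h2; have {}h2 := h2 erefl.
rewrite !pmulr_rge0// in h1 h2; rewrite ler_norml; apply/andP; split; lra.
Qed.

Lemma enormD x y : enorm (x + y) <= enorm x + enorm y.
Proof.
rewrite -ler_sqr ?nnegrE ?addr_ge0 ?enorm_ge0// sqrrD !sqr_enorm.
rewrite (_ : \sum_i (x + y) ord0 i ^+ 2 = \sum_i x ord0 i ^+ 2 + dotv x y *+ 2 + \sum_i y ord0 i ^+ 2).
  rewrite lerD2r lerD2l lerMn2r/= (le_trans (ler_norm _))//; exact: dotv_le.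
rewrite /dotv -sumrMnl -!big_split/=; apply: eq_bigr => i _; rewrite mxE.
by rewrite sqrrD.
Qed.

Lemma enorm_dist x y : `|enorm x - enorm y| <= enorm (x - y).
Proof.
have h1 := enormD (x - y) y; have h2 := enormD (y - x) x.
rewrite !subrK in h1 h2; rewrite (enormB y x) in h2.
by rewrite ler_norml; apply/andP; split; lra.
Qed.

Lemma sumr_le_const (f : 'I_n -> R) l : (forall i, f i <= l) ->
  \sum_i f i <= n%:R * l.
Proof.
move=> fl; apply: (le_trans (ler_sum _ (fun i _ => fl i))).
by rewrite sumr_const card_ord mulr_natl.
Qed.

Lemma sum_coord_le x : \sum_i `|x ord0 i| <= n%:R * enorm x.
Proof.
by apply: sumr_le_const => i; exact: coord_le_enorm.
Qed.

Lemma enorm_le_norm x : enorm x <= n%:R * `|x|.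
Proof.
have h i : `|x ord0 i| <= `|x|.
  rewrite [leRHS]/Num.Def.normr/= mx_normrE; apply/bigmax_geP; right.
  by exists (ord0, i).
rewrite (@le_trans _ _ (\sum_i `|x ord0 i|))//; last first.
  exact: sumr_le_const.
rewrite enorm_le ?sumr_ge0// expr2 mulr_suml; apply: ler_sum => i _.
rewrite -[leLHS]real_normK ?num_real// expr2 ler_wpM2l//.
by rewrite (bigD1 i)//= lerDl sumr_ge0.
Qed.

Lemma norm_le_enorm x : `|x| <= enorm x.
Proof.
rewrite [leLHS]/Num.Def.normr/= mx_normrE; apply/bigmax_leP; split; first exact: enorm_ge0.
by move=> [i j] _ /=; rewrite (ord1 i); exact: coord_le_enorm.
Qed.

Lemma measurable_enormT dT (T : measurableType dT) (f : T -> 'rV[R]_n) :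
  measurable_fun setT f -> measurable_fun setT (fun t => enorm (f t)).
Proof.
move=> mf; apply: (measurableT_comp (continuous_measurable_fun (@sqrt_continuous R))).
rewrite /dotv; apply: measurable_sum => i.
by apply: measurable_funM; exact: measurable_coordT.
Qed.

Lemma measurable_rVD dT (T : measurableType dT) (f g : T -> 'rV[R]_n) :
  measurable_fun setT f -> measurable_fun setT g ->
  measurable_fun setT (fun t => f t + g t).
Proof.
move=> mf mg; apply: measurable_rVT => i; under eq_fun do rewrite mxE.
by apply: measurable_funD; exact: measurable_coordT.
Qed.

Lemma measurable_rVZ dT (T : measurableType dT) (f : T -> R) (g : T -> 'rV[R]_n) :
  measurable_fun setT f -> measurable_fun setT g ->
  measurable_fun setT (fun t => f t *: g t).
Proof.
move=> mf mg; apply: measurable_rVT => i; under eq_fun do rewrite mxE.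
by apply: measurable_funM => //; exact: measurable_coordT.
Qed.

Lemma measurable_rVB dT (T : measurableType dT) (f g : T -> 'rV[R]_n) :
  measurable_fun setT f -> measurable_fun setT g ->
  measurable_fun setT (fun t => f t - g t).
Proof.
move=> mf mg; apply: measurable_rVT => i; under eq_fun do rewrite !mxE.
by apply: measurable_funB; exact: measurable_coordT.
Qed.

Lemma continuous_enorm : continuous (@enorm R n).
Proof.
move=> x; apply/(@cvgrPdist_le _ _ _ (nbhs x)) => e e0; near=> y.
rewrite (le_trans (enorm_dist _ _))// (le_trans (enorm_le_norm _))//.
rewrite (@le_trans _ _ (n.+1%:R * `|x - y|))//.
  by rewrite ler_wpM2r// ler_nat.
rewrite mulrC -ler_pdivlMr ?ltr0n//.
near: y; apply/nbhs_ballP; exists (e / n.+1%:R) => /=; first by rewrite divr_gt0// ltr0n.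
by move=> y; rewrite -ball_normE /= => /ltW.
Unshelve. all: by end_near. Qed.

End euclidean_norm.

Section gaussian.
Context {R : realType}.
Local Notation mu := (@lebesgue_measure R).

Lemma Rintegral_tensor n (f : 'I_n -> R -> R) :
  (forall i, mu.-integrable setT (EFin \o f i)) -> (forall i t, 0 <= f i t) ->
  (lebesgue_rV n).-integrable setT (EFin \o (fun x : 'rV[R]_n => \prod_i f i (x ord0 i))) /\
  \int[lebesgue_rV n]_x \prod_i f i (x ord0 i) = \prod_i \int[mu]_t f i t.
Proof.
move=> fi f0.
have mf i : measurable_fun setT (f i) by exact: integrableT_measurable (fi i).
have E : (\int[lebesgue_rV n]_x (\prod_i f i (x ord0 i))%:E = (\prod_i \int[mu]_t f i t)%:E)%E.
  rewrite ge0_integral_tensor// -prodEFin; apply: eq_bigr => i _.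
  by rewrite EFin_Rintegral.
split; last by rewrite /Rintegral E.
apply: integrable_ltyP => [|x|].
- by apply: measurable_prod => i _; apply: (measurableT_comp (mf i)); exact: measurable_coordT.
- by rewrite prodr_ge0.
- by rewrite E ltry.
Qed.

Let gaussi : mu.-integrable setT (EFin \o (fun t : R => expR (- t ^+ 2))).
Proof. exact: integrableT_gauss. Qed.

Let gauss0 : 0 < \int[mu]_t expR (- t ^+ 2).
Proof.
apply: (@Rintegral_gt0_itv _ _ 0 1) => // t _; exact: expR_gt0.
Qed.

Let gauss2i : mu.-integrable setT (EFin \o (fun t : R => t ^+ 2 * expR (- t ^+ 2))).
Proof.
have k0 : (Num.sqrt 2)^-1 != 0 :> R by rewrite invr_eq0 gt_eqF// sqrtr_gt0.
have := integrable_scaler 2 (@integrable_affine R (fun t => expR (- t ^+ 2)) _ 0 k0 gaussi).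
apply: dom_integrable.
  apply: measurable_funM; first exact: measurable_funX.
  by apply: (measurableT_comp (@measurable_expR R)); apply: measurableT_comp => //; exact: measurable_funX.
move=> t; rewrite ger0_norm; last by rewrite mulr_ge0 ?sqr_ge0 ?expR_ge0.
have -> : ((Num.sqrt 2)^-1 * t + 0) ^+ 2 = 2^-1 * t ^+ 2.
  by rewrite addr0 exprMn exprVn sqr_sqrtr.
have -> : - t ^+ 2 = - (2^-1 * t ^+ 2) - (2^-1 * t ^+ 2) by lra.
rewrite expRD mulrA ler_wpM2r ?expR_ge0// expRN ler_pdivrMr ?expR_gt0//.
have := expR_ge1Dx (2^-1 * t ^+ 2); lra.
Qed.

Variable n : nat.
Local Notation leb := (@lebesgue_rV R n).
Implicit Types (l : R) (z : 'rV[R]_n).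

Definition gauss l z : R := expR (- (l * enorm z ^+ 2)).

Lemma gauss_ge0 l z : 0 <= gauss l z. Proof. exact: expR_ge0. Qed.

Lemma measurable_gaussT dT (T : measurableType dT) (f : T -> R) (g : T -> 'rV[R]_n) :
  measurable_fun setT f -> measurable_fun setT g ->
  measurable_fun setT (fun t => gauss (f t) (g t)).
Proof.
move=> mf mg; apply: (measurableT_comp (@measurable_expR R)).
apply: measurableT_comp => //; apply: measurable_funM => //.
by apply: measurable_funX; exact: measurable_enormT.
Qed.

Let gauss1E z : gauss 1 z = \prod_i expR (- z ord0 i ^+ 2).
Proof. by rewrite /gauss mul1r sqr_enorm -expR_sum -sumrN. Qed.

Definition gauss_mass : R := \int[leb]_z gauss 1 z.

Lemma integrable_gauss1 : leb.-integrable setT (EFin \o gauss 1).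
Proof.
have [+ _] := @Rintegral_tensor n (fun=> fun t => expR (- t ^+ 2)) (fun=> gaussi) (fun _ _ => expR_ge0 _).
by apply: eq_integrable => // z _ /=; rewrite gauss1E.
Qed.

Lemma gauss_mass_gt0 : 0 < gauss_mass.
Proof.
have [_ e] := @Rintegral_tensor n (fun=> fun t => expR (- t ^+ 2)) (fun=> gaussi) (fun _ _ => expR_ge0 _).
rewrite /gauss_mass (eq_Rintegral _ (g := fun z => \prod_i expR (- z ord0 i ^+ 2))); last by move=> z _; exact: gauss1E.
by rewrite e prodr_gt0.
Qed.

Lemma gauss_scale l z : 0 < l -> gauss l z = gauss 1 (Num.sqrt l *: z).
Proof.
move=> l0; rewrite /gauss mul1r enormZ exprMn real_normK ?num_real//.
rewrite (sqr_sqrtr (ltW l0)); reflexivity.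
Qed.

Lemma integrable_gauss l : 0 < l -> leb.-integrable setT (EFin \o gauss l).
Proof.
move=> l0; have := @integrable_scale R n (gauss 1) (Num.sqrt l).
rewrite gt_eqF ?sqrtr_gt0// => /(_ isT integrable_gauss1).
by apply: eq_integrable => // z _ /=; rewrite (gauss_scale z l0).
Qed.

Lemma sqrtrXn l : 0 < l -> Num.sqrt l ^- n = l `^ (- (n%:R / 2)).
Proof.
move=> l0; rewrite -powR12_sqrt ?ltW// -powR_invn ?powR_ge0// -powRrM.
by congr (_ `^ _); lra.
Qed.

Lemma Rintegral_gauss l : 0 < l -> \int[leb]_z gauss l z = l `^ (- (n%:R / 2)) * gauss_mass.
Proof.
move=> l0; rewrite -sqrtrXn// -Rintegral_scale ?sqrtr_gt0//; last exact: integrable_gauss1.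
by apply: eq_Rintegral => z _; rewrite (gauss_scale z l0).
Qed.

Lemma integrable_sqr_gauss l : 0 < l ->
  leb.-integrable setT (EFin \o (fun z => enorm z ^+ 2 * gauss l z)).
Proof.
move=> l0; have l2 : 0 < l / 2 by rewrite divr_gt0.
apply: (dom_integrable _ _ (integrable_scaler (2 / l) (integrable_gauss l2))).
  apply: measurable_funM; last exact: measurable_gaussT.
  by apply: measurable_funX; exact: measurable_enormT.
move=> z; rewrite ger0_norm; last by rewrite mulr_ge0 ?sqr_ge0 ?gauss_ge0.
rewrite /gauss.
have -> : - (l * enorm z ^+ 2) = - (l / 2 * enorm z ^+ 2) - (l / 2 * enorm z ^+ 2) by lra.
rewrite expRD mulrA ler_wpM2r ?expR_ge0// expRN ler_pdivrMr ?expR_gt0//.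
have h := expR_ge1Dx (l / 2 * enorm z ^+ 2).
rewrite -ler_pdivrMl ?divr_gt0// invf_div; lra.
Qed.

Lemma integrable_norm_gauss l : 0 < l ->
  leb.-integrable setT (EFin \o (fun z => enorm z * gauss l z)).
Proof.
move=> l0; apply: (dom_integrable _ _ (integrable_addr (integrable_gauss l0) (integrable_sqr_gauss l0))).
  by apply: measurable_funM; [exact: measurable_enormT|exact: measurable_gaussT].
move=> z; rewrite ger0_norm ?mulr_ge0 ?enorm_ge0 ?gauss_ge0//.
rewrite -[X in _ <= X + _]mul1r -mulrDl ler_wpM2r ?gauss_ge0//.
have := sqr_ge0 (enorm z - 1); have := sqr_ge0 (enorm z); rewrite sqrrB; lra.
Qed.

Definition gauss_moment : R :=
  (\int[mu]_t (t ^+ 2 * expR (- t ^+ 2))) * (\int[mu]_t expR (- t ^+ 2)) ^+ n.-1.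

Lemma gauss_moment_gt0 : 0 < gauss_moment.
Proof.
apply: mulr_gt0; last exact: exprn_gt0.
apply: (@Rintegral_gt0_itv _ _ 0 1) => // t; first by rewrite mulr_ge0 ?sqr_ge0 ?expR_ge0.
by move=> /andP[t0 _]; rewrite mulr_gt0 ?expR_gt0// exprn_gt0.
Qed.

(** The second moment is the same in every direction. *)
Lemma Rintegral_coord2_gauss (i : 'I_n) :
  \int[leb]_z (z ord0 i ^+ 2 * gauss 1 z) = gauss_moment.
Proof.
pose f (j : 'I_n) (t : R) := (if j == i then t ^+ 2 else 1) * expR (- t ^+ 2).
have fi j : mu.-integrable setT (EFin \o f j).
  have [ji|ji] := boolP (j == i).
    by apply: eq_integrable gauss2i => // t _; rewrite /= /f ji.
  by apply: eq_integrable gaussi => // t _; rewrite /= /f (negbTE ji) mul1r.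
have f0 j t : 0 <= f j t.
  by rewrite mulr_ge0 ?expR_ge0//; case: ifP; rewrite ?sqr_ge0.
have [_ e] := Rintegral_tensor fi f0.
rewrite (_ : \int[leb]_z _ = \int[leb]_z \prod_j f j (z ord0 j)); last first.
  apply: eq_Rintegral => z _; rewrite gauss1E /f big_split/=; congr (_ * _).
  by rewrite (bigD1 i)//= eqxx big1 ?mulr1// => j /negbTE ->.
rewrite e (bigD1 i)//= {1}/f eqxx /gauss_moment; congr (_ * _).
under eq_bigr => j ji.
  rewrite /f (negbTE ji); under eq_Rintegral do rewrite mul1r; over.
by rewrite prodr_const cardC1 card_ord.
Qed.

Lemma integrable_coord_gauss l (i : 'I_n) : 0 < l ->
  leb.-integrable setT (EFin \o (fun z => z ord0 i * gauss l z)).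
Proof.
move=> l0; apply: (dom_integrable _ _ (integrable_norm_gauss l0)).
  by apply: measurable_funM; [exact: measurable_coordT|exact: measurable_gaussT].
move=> z; rewrite normrM (ger0_norm (gauss_ge0 _ _)) ler_wpM2r ?gauss_ge0//.
exact: coord_le_enorm.
Qed.

Lemma enorm_reflect (i : 'I_n) z : enorm (reflect_coord i z) = enorm z.
Proof.
congr Num.sqrt; apply: eq_bigr => j _; rewrite mxE addr0.
by case: ifP => _; rewrite ?mul1r ?mulN1r ?mulrNN.
Qed.

Lemma Rintegral_coord_gauss l (i : 'I_n) : 0 < l ->
  \int[leb]_z (z ord0 i * gauss l z) = 0.
Proof.
move=> l0; apply: (Rintegral_odd_coord (i := i)); first exact: integrable_coord_gauss.
by move=> z; rewrite /gauss enorm_reflect mxE eqxx addr0 mulN1r mulNr.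
Qed.

(** Completing the square. *)
Lemma gauss_mul (l h : R) (w v : 'rV[R]_n) : 0 < l -> 0 < h ->
  gauss l w * gauss h (v - w) =
  gauss (l * h / (l + h)) v * gauss (l + h) (w - (h / (l + h)) *: v).
Proof.
move=> l0 h0; have lh : l + h != 0 by rewrite gt_eqF// addr_gt0.
rewrite /gauss -!expRD; congr expR; rewrite !sqr_enorm -!opprD; congr (- _).
rewrite !mulr_sumr -!big_split/=; apply: eq_bigr => i _; rewrite !mxE.
by field.
Qed.

Lemma Rintegral_coord_gauss_conv (l h : R) (v : 'rV[R]_n) (i : 'I_n) : 0 < l -> 0 < h ->
  \int[leb]_w (w ord0 i * gauss l w * gauss h (v - w)) =
  h / (l + h) * (l + h) `^ (- (n%:R / 2)) * gauss_mass *
    (v ord0 i * gauss (l * h / (l + h)) v).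
Proof.
move=> l0 h0; have lh : 0 < l + h by rewrite addr_gt0.
set k := h / (l + h); set m := l * h / (l + h).
pose f (w : 'rV[R]_n) := (w ord0 i + k * v ord0 i) * gauss (l + h) w.
have fi : leb.-integrable setT (EFin \o f).
  have := integrable_addr (integrable_coord_gauss i lh)
    (integrable_scaler (k * v ord0 i) (integrable_gauss lh)).
  by apply: eq_integrable => // w _ /=; rewrite -mulrDl.
transitivity (\int[leb]_w (gauss m v * f (w - k *: v))).
  apply: eq_Rintegral => w _; rewrite -mulrA gauss_mul// -/k -/m /f !mxE subrK.
  by rewrite mulrCA.
rewrite RintegralZl//; last exact: (integrable_shift (- (k *: v)) fi).
rewrite (Rintegral_shift (- (k *: v)) fi) /f.
under eq_Rintegral do rewrite mulrDl.
rewrite RintegralD//; last 2 first.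
- exact: integrable_coord_gauss.
- exact: (integrable_scaler (k * v ord0 i) (integrable_gauss lh)).
rewrite Rintegral_coord_gauss// add0r RintegralZl//; last exact: integrable_gauss.
by rewrite Rintegral_gauss//; ring.
Qed.

End gaussian.

Section fubini_real_extra.
Context d1 d2 (T1 : measurableType d1) (T2 : measurableType d2) (R : realType).
Variable m1 : {sigma_finite_measure set T1 -> \bar R}.
Variable m2 : {sigma_finite_measure set T2 -> \bar R}.
Implicit Types f : T1 * T2 -> R.

Lemma integrable_Rintegral1 f : (m1 \x m2)%E.-integrable setT (EFin \o f) ->
  m2.-integrable setT (EFin \o (fun y => \int[m1]_x f (x, y))).
Proof.
move=> fi; have mf : measurable_fun setT (EFin \o f) by case/integrableP : fi.
have mf' : measurable_fun setT f by exact/measurable_EFinP.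
apply: (@integrable_Rintegral2 _ _ _ _ _ m2 m1 (fun z => f (z.2, z.1))).
apply: integrable_iterated; first exact: (measurableT_comp mf' (measurable_fun_pair measurable_snd measurable_fst)).
by move: fi; rewrite (@integrable21ltyP _ _ _ _ _ m1 m2 _ mf).
Qed.

Lemma integrable_iterated_Rintegral f (g : T1 -> R) : measurable_fun setT f ->
  (forall z, 0 <= f z) -> (forall x, m2.-integrable setT (EFin \o (fun y => f (x, y)))) ->
  m1.-integrable setT (EFin \o g) -> (forall x, \int[m2]_y f (x, y) <= g x) ->
  (m1 \x m2)%E.-integrable setT (EFin \o f).
Proof.
move=> mf f0 fi gi fg; apply: integrable_iterated => //.
have g0 x : 0 <= g x by apply: le_trans (fg x); apply: Rintegral_ge0.
apply: (@le_lt_trans _ _ (\int[m1]_x (g x)%:E)%E).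
  apply: ge0_le_integral => //.
  - by move=> x _; exact: integral_ge0.
  - apply: (measurable_fun_fubini_tonelli_F (fun z => `|f z|%:E)) => //.
    by apply/measurable_EFinP; exact: measurableT_comp.
  - by apply/measurable_EFinP; exact: integrableT_measurable gi.
  move=> x _; under eq_integral do rewrite ger0_norm//.
  by rewrite -EFin_Rintegral// lee_fin.
by rewrite -EFin_Rintegral// ltry.
Qed.

End fubini_real_extra.

Section kernels.
Context {R : realType} (n : nat).
Local Notation leb := (@lebesgue_rV R n).
Local Notation mu := (@lebesgue_measure R).
Implicit Types (a l s : R) (w x : 'rV[R]_n).

Definition min1 (r : R) : R := Num.min 1 r.

Lemma min1_ge0 (r : R) : 0 <= r -> 0 <= min1 r.
Proof. by move=> r0; rewrite /min1 le_min ler01. Qed.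

Lemma measurable_min1 dT (T : measurableType dT) (f : T -> R) :
  measurable_fun setT f -> measurable_fun setT (fun t => min1 (f t)).
Proof. by move=> mf; apply: measurable_minr. Qed.

Lemma measurable_powRT dT (T : measurableType dT) (f : T -> R) a :
  measurable_fun setT f -> measurable_fun setT (fun t => f t `^ a).
Proof. by move=> mf; apply: (measurableT_comp (measurable_powR a)). Qed.

Lemma enorm_gt0 w : w != 0 -> 0 < enorm w.
Proof.
by move=> w0; rewrite lt_neqAle enorm_ge0 andbT eq_sym; apply: contraNN w0 => /eqP/enorm_eq0 ->.
Qed.

Lemma subordination (g : R) a w : 0 < a -> (w = 0 -> g = 0) ->
  mu.-integrable setT (EFin \o (fun l => g * (hpow a l * gauss l w))) /\
  \int[mu]_l (g * (hpow a l * gauss l w)) = Gamma a * (g * enorm w `^ (- (a * 2))).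
Proof.
move=> a0 gw; have [w0|w0] := eqVneq w 0.
  rewrite gw// mul0r mulr0; split.
    by apply: eq_integrable (integrable0 mu setT) => // l _ /=; rewrite mul0r.
  by rewrite /Rintegral integral0_eq// => l _; rewrite mul0r.
have e0 := enorm_gt0 w0.
have c0 : 0 < enorm w ^+ 2 by rewrite exprn_gt0.
have i0 : mu.-integrable setT (EFin \o (fun l => hpow a l * gauss l w)).
  by apply: eq_integrable (hpow_expR_integrable a0 c0) => // l _ /=; rewrite /gauss (mulrC l).
split; first exact: integrable_scaler.
rewrite RintegralZl// mulrCA; congr (_ * _).
have -> : enorm w `^ (- (a * 2)) = (enorm w ^+ 2) `^ (- a).
  by rewrite -powR_mulrn ?ltW// -powRrM; congr (_ `^ _); lra.
rewrite mulrC -Rintegral_hpow_expR//.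
by apply: eq_Rintegral => l _; rewrite /gauss (mulrC l).
Qed.

Let mkf a (g : 'rV[R]_n -> R) : measurable_fun setT g ->
  measurable_fun setT (fun z : R * 'rV[R]_n => g z.2 * (hpow a z.1 * gauss z.1 z.2)).
Proof.
move=> mg; apply: measurable_funM; first exact: measurableT_comp.
apply: measurable_funM; first exact: (measurableT_comp (measurable_hpow a)).
exact: measurable_gaussT.
Qed.

(** The kernel is integrable because after subordination its Gaussian layers
    have mass comparable to the minimum of l^(-n/2) and l^(-(n+1)/2). *)
Lemma integrable_min1_kernel s : 0 < s < 1 ->
  leb.-integrable setT (EFin \o (fun w => min1 (enorm w) * enorm w `^ (- (n%:R + s)))).
Proof.
move=> /andP[s0 s1]; pose a := (n%:R + s) / 2.
have a0 : 0 < a by rewrite divr_gt0// ltr_wpDl.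
pose f (z : R * 'rV[R]_n) := min1 (enorm z.2) * (hpow a z.1 * gauss z.1 z.2).
have m0 w : 0 <= min1 (enorm w) by rewrite min1_ge0// enorm_ge0.
have mmin : measurable_fun setT (fun w : 'rV[R]_n => min1 (enorm w)).
  by apply: measurable_min1; exact: measurable_enormT.
have mff : measurable_fun setT f by exact: (mkf a mmin).
pose M := \int[leb]_z (enorm z * gauss 1 z).
pose K := gauss_mass n + M.
have M0 : 0 <= M by apply: Rintegral_ge0 => z _; rewrite mulr_ge0 ?enorm_ge0 ?gauss_ge0.
have N0 := @gauss_mass_gt0 R n.
pose h l := Num.min (hpow (s / 2) l) (hpow ((s - 1) / 2) l).
have hi : mu.-integrable setT (EFin \o h) by apply: hpow_min_integrable; lra.
have fi l : leb.-integrable setT (EFin \o (fun w => f (l, w))).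
  have [l0|l0] := ltP 0 l; last first.
    apply: eq_integrable (integrable0 leb setT) => // w _.
    by rewrite /= /f /hpow ltNge l0/= mul0r mulr0.
  apply: (dom_integrable _ _ (integrable_scaler (hpow a l) (integrable_gauss n l0))).
    exact: (measurableT_comp mff (measurable_pair1 l)).
  move=> w; rewrite /f ger0_norm; last by rewrite !mulr_ge0 ?hpow_ge0 ?gauss_ge0.
  rewrite -[leRHS]mul1r ler_wpM2r ?mulr_ge0 ?hpow_ge0 ?gauss_ge0//.
  by rewrite /min1 ge_min lexx.
have int : (mu \x leb)%E.-integrable setT (EFin \o f).
  apply: (@integrable_iterated_Rintegral _ _ _ _ _ mu leb f (fun l => K * h l)) => //.
  - by move=> z; rewrite !mulr_ge0 ?hpow_ge0 ?gauss_ge0.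
  - exact: integrable_scaler.
  move=> l; have [l0|l0] := ltP 0 l; last first.
    rewrite /Rintegral integral0_eq => [|w _].
      by rewrite /h /hpow ltNge l0/= minxx mulr0.
    by rewrite /f /hpow ltNge l0/= mul0r mulr0.
  have sl : 0 < Num.sqrt l by rewrite sqrtr_gt0.
  have h1 : \int[leb]_w f (l, w) <= hpow a l * (l `^ (- (n%:R / 2)) * gauss_mass n).
    rewrite -Rintegral_gauss// -RintegralZl//; last exact: integrable_gauss.
    apply: le_Rintegral => //; first exact/integrable_scaler/integrable_gauss.
    move=> w _; rewrite /f -[leRHS]mul1r ler_wpM2r ?mulr_ge0 ?hpow_ge0 ?gauss_ge0//.
    by rewrite /min1 ge_min lexx.
  have h2 : \int[leb]_w f (l, w) <= hpow a l * ((Num.sqrt l)^-1 * (l `^ (- (n%:R / 2)) * M)).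
    rewrite -sqrtrXn// -Rintegral_scale//; last exact: integrable_norm_gauss.
    have isc := integrable_scale (lt0r_neq0 sl) (integrable_norm_gauss n ltr01).
    rewrite -RintegralZl// -RintegralZl//; last exact: integrable_scaler.
    apply: le_Rintegral => //; first exact/integrable_scaler/integrable_scaler.
    move=> w _; rewrite /f enormZ (gtr0_norm sl) -gauss_scale// -(mulrA (Num.sqrt l)) mulKf ?gt_eqF//.
    rewrite mulrCA ler_wpM2l ?hpow_ge0// ler_wpM2r ?gauss_ge0//.
    by rewrite /min1 ge_min lexx orbT.
  have e1 : hpow a l * l `^ (- (n%:R / 2)) = l `^ (s / 2 - 1).
    rewrite /hpow l0 -powRD; first by congr (_ `^ _); rewrite /a; lra.
    by rewrite (gt_eqF l0) implybT.
  have e2 : l `^ (s / 2 - 1) * (Num.sqrt l)^-1 = l `^ ((s - 1) / 2 - 1).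
    rewrite -powR12_sqrt ?ltW// -powRN -powRD; first by congr (_ `^ _); lra.
    by rewrite (gt_eqF l0) implybT.
  rewrite /h /hpow l0 -/(hpow _ _) minr_pMr; last by rewrite addr_ge0// ltW.
  rewrite le_min; apply/andP; split.
    rewrite (le_trans h1)// mulrA e1 mulrC ler_wpM2r ?powR_ge0//.
    by rewrite lerDl.
  rewrite (le_trans h2)// mulrCA mulrA -e2 !mulrA.
  rewrite [X in X <= _](_ : _ = M * (l `^ (s / 2 - 1) / Num.sqrt l)).
    by rewrite -!mulrA ler_wpM2r ?mulr_ge0 ?powR_ge0 ?invr_ge0 ?ltW// ltrDr.
  by rewrite -e1; ring.
have := integrable_scaler (Gamma a)^-1 (integrable_Rintegral1 int).
apply: eq_integrable => // w _ /=; congr EFin; rewrite /f.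
have [|_ ->] := @subordination (min1 (enorm w)) a w a0.
  by move=> ->; rewrite enorm0 /min1 min_r.
rewrite mulKf ?gt_eqF ?Gamma_gt0//.
by rewrite /a -mulrA mulVf ?mulr1.
Qed.

Lemma integrable_subordinated (g : 'rV[R]_n -> R) a : 0 < a ->
  measurable_fun setT g -> (forall w, 0 <= g w) -> g 0 = 0 ->
  leb.-integrable setT (EFin \o (fun w => g w * enorm w `^ (- (a * 2)))) ->
  (mu \x leb)%E.-integrable setT
    (EFin \o (fun z => g z.2 * (hpow a z.1 * gauss z.1 z.2))).
Proof.
move=> a0 mg g0 g00 gi; pose f (z : R * 'rV[R]_n) := g z.2 * (hpow a z.1 * gauss z.1 z.2).
have mff : measurable_fun setT f by exact: (mkf a mg).
have sub w := @subordination (g w) a w a0 (fun e => etrans (congr1 g e) g00).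
have : (leb \x mu)%E.-integrable setT (EFin \o (fun z => f (z.2, z.1))).
  apply: (@integrable_iterated_Rintegral _ _ _ _ _ leb mu _
    (fun w => Gamma a * (g w * enorm w `^ (- (a * 2))))) => //.
  - exact: (measurableT_comp mff (measurable_fun_pair measurable_snd measurable_fst)).
  - by move=> z; rewrite /f !mulr_ge0 ?hpow_ge0 ?gauss_ge0.
  - by move=> w; exact: (sub w).1.
  - exact: integrable_scaler.
  - by move=> w; rewrite (sub w).2.
move=> fi; apply: integrable_iterated => //.
have mff' : measurable_fun setT (EFin \o f) by exact/measurable_EFinP.
have mffs : measurable_fun setT (EFin \o (fun z => f (z.2, z.1))).
  by apply/measurable_EFinP; exact: (measurableT_comp mff (measurable_fun_pair measurable_snd measurable_fst)).
move: fi; rewrite (@integrable12ltyP _ _ _ _ _ leb mu _ mffs).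
by rewrite -(@integrable21ltyP _ _ _ _ _ mu leb _ mff') (@integrable12ltyP _ _ _ _ _ mu leb _ mff').
Qed.

Definition enorm1 x : R := Num.max 1 (enorm x).

Lemma enorm1_ge1 x : 1 <= enorm1 x. Proof. by rewrite /enorm1 le_max lexx. Qed.

Lemma enorm1_gt0 x : 0 < enorm1 x. Proof. exact: lt_le_trans (enorm1_ge1 x). Qed.

Lemma measurable_enorm1T dT (T : measurableType dT) (f : T -> 'rV[R]_n) :
  measurable_fun setT f -> measurable_fun setT (fun t => enorm1 (f t)).
Proof. by move=> mf; apply: measurable_maxr => //; exact: measurable_enormT. Qed.

Lemma integrable_enorm1 s : 0 < s < 1 ->
  leb.-integrable setT (EFin \o (fun x => enorm1 x `^ (- (n%:R + s)))).
Proof.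
move=> s01; have := integrable_addr (integrable_scaler (expR 1) (@integrable_gauss R n 1 ltr01))
  (integrable_min1_kernel s01).
apply: dom_integrable.
  by apply: measurable_powRT; exact: measurable_enorm1T.
move=> x; rewrite ger0_norm ?powR_ge0// /enorm1.
have [x1|x1] := leP (enorm x) 1.
  rewrite powR1 ler_wpDr//.
    by rewrite mulr_ge0 ?powR_ge0// min1_ge0// enorm_ge0.
  rewrite /gauss mul1r -expRD -[leLHS]expR0 ler_expR subr_ge0.
  by rewrite exprn_ile1// enorm_ge0.
rewrite /min1 (min_l (ltW x1)) mul1r ler_wpDl//.
by rewrite mulr_ge0 ?expR_ge0 ?gauss_ge0.
Qed.

End kernels.

Section line_derivatives.
Context {R : realType} (d : nat).
Implicit Types (f g : 'rV[R]_d -> R) (x v w z : 'rV[R]_d) (i j : 'I_d).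

Lemma derivable_line f x v (t : R) : derivable f (x + t *: v) v ->
  derivable (fun t : R => f (x + t *: v)) t 1 /\
  'D_1 (fun t : R => f (x + t *: v)) t = 'D_v f (x + t *: v).
Proof.
suff E : (fun h : R => h^-1 *: (((fun t : R => f (x + t *: v)) \o shift t) (h *: 1) - f (x + t *: v))) =
    (fun h : R => h^-1 *: ((f \o shift (x + t *: v)) (h *: v) - f (x + t *: v))).
  by rewrite /derivable /derive E.
apply/funext => h /=; congr (_ *: (f _ - _)).
by rewrite [h *: 1]mulr1 scalerDl addrCA.
Qed.

Lemma derivable_at_line f x v :
  derivable (fun t : R => f (x + t *: v)) 0 1 ->
  derivable f x v /\ 'D_v f x = 'D_1 (fun t : R => f (x + t *: v)) 0.
Proof.
suff E : (fun h : R => h^-1 *: (((fun t : R => f (x + t *: v)) \o shift 0) (h *: 1) - f (x + 0 *: v))) =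
    (fun h : R => h^-1 *: ((f \o shift x) (h *: v) - f x)).
  by rewrite /derivable /derive E.
apply/funext => h /=; rewrite scale0r !addr0; congr (_ *: (f _ - _)).
by rewrite [h *: 1]mulr1 addrC.
Qed.

Lemma line_MVT f i x (h : R) : (forall y, derivable f y 'e_i) ->
  exists2 c : R, `|c| <= `|h| & f (x + h *: 'e_i) - f x = h * partial i f (x + c *: 'e_i).
Proof.
move=> df; pose g t := f (x + t *: 'e_i).
have dg (t : R) : is_derive t 1 g (partial i f (x + t *: 'e_i)).
  have [h1 h2] := derivable_line (df (x + t *: 'e_i)).
  by rewrite /partial -h2; exact: DeriveDef.
have cg (a b : R) : {within `[a, b], continuous g}.
  by apply: derivable_within_continuous => t _; exact: (@ex_derive _ _ _ _ _ _ _ (dg t)).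
have g0 : g 0 = f x by rewrite /g scale0r addr0.
have [h0|h0|->] := ltgtP h 0.
- have [|c hc e] := MVT h0 (fun t _ => dg t); first exact: cg.
  move: hc; rewrite in_itv/= => /andP[c1 c2]; exists c.
    by rewrite !ltr0_norm// lerN2 ltW.
  by rewrite -/(g h) -g0; move: e; lra.
- have [|c hc e] := MVT h0 (fun t _ => dg t); first exact: cg.
  move: hc; rewrite in_itv/= => /andP[c1 c2]; exists c.
    by rewrite !gtr0_norm// ltW.
  by rewrite -/(g h) -g0; move: e; lra.
- by exists 0 => //; rewrite scale0r addr0 subrr mul0r.
Qed.

(** Bounded partial derivatives make a function Lipschitz: change one
    coordinate at a time. *)
Lemma lipschitz_partial f (M : R) : (forall i y, derivable f y 'e_i) ->
  (forall i y, `|partial i f y| <= M) ->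
  forall x v, `|f (x + v) - f x| <= M * \sum_i `|v ord0 i|.
Proof.
move=> df fM x v.
pose tr (k : nat) : 'rV[R]_d := \row_j (if (j < k)%N then v ord0 j else 0).
have key k : (k <= d)%N -> `|f (x + tr k) - f x| <= M * \sum_(i < d | (i < k)%N) `|v ord0 i|.
  elim: k => [_|k IH kd].
    rewrite (_ : tr 0%N = 0); last by apply/rowP => j; rewrite !mxE.
    by rewrite addr0 subrr normr0 big_pred0// mulr0.
  pose i0 := Ordinal kd.
  have e : tr k.+1 = tr k + v ord0 i0 *: 'e_i0.
    apply/rowP => j; rewrite !mxE eqxx/= ltnS leq_eqVlt -[(j == k :> nat)]/(j == i0).
    by have [->|ji] := eqVneq j i0; rewrite ?ltnn ?mulr1 ?mulr0 ?add0r ?addr0.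
  have [c _ hc] := line_MVT (x + tr k) (v ord0 i0) (df i0).
  rewrite (bigD1 i0)//= (_ : \sum_(_ < d | _) _ = \sum_(i < d | (i < k)%N) `|v ord0 i|); last first.
    apply: eq_bigl => j; rewrite ltnS leq_eqVlt -[(j == k :> nat)]/(j == i0).
    by have [->|ji] := eqVneq j i0; rewrite ?ltnn ?andbF ?andbT//.
  rewrite e addrA -[X in `|X|](subrKA (f (x + tr k))) hc mulrDr.
  apply: (le_trans (ler_normD _ _)); apply: lerD; last by apply: IH; exact: ltnW.
  by rewrite normrM mulrC ler_wpM2r.
have := key d (leqnn d); rewrite (_ : tr d = v); last first.
  by apply/rowP => j; rewrite mxE ltn_ord.
by rewrite (eq_bigl xpredT)// => i; rewrite ltn_ord.
Qed.

Lemma derivable_transl f v i x : derivable f (x + v) 'e_i ->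
  derivable (fun y => f (y + v)) x 'e_i /\
  partial i (fun y => f (y + v)) x = partial i f (x + v).
Proof.
suff E : (fun h : R => h^-1 *: (((fun y => f (y + v)) \o shift x) (h *: 'e_i) - f (x + v))) =
    (fun h : R => h^-1 *: ((f \o shift (x + v)) (h *: 'e_i) - f (x + v))).
  by rewrite /partial /derivable /derive E.
by apply/funext => h /=; rewrite addrA.
Qed.

Lemma min1_lipschitz f (M : R) : (forall i y, derivable f y 'e_i) ->
  (forall y, `|f y| <= M) -> (forall i y, `|partial i f y| <= M) ->
  forall x v, `|f x - f (x - v)| <= (2 + d%:R) * M * min1 (enorm v).
Proof.
move=> df f0 f1 x v; have M0 : 0 <= M by apply: le_trans (f0 x).
rewrite /min1; case: (leP 1 (enorm v)) => _.
  rewrite mulr1 mulrDl (le_trans (ler_normB _ _))//.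
  have := f0 x; have := f0 (x - v); have : 0 <= d%:R * M by rewrite mulr_ge0.
  by lra.
have := lipschitz_partial df f1 (x - v) v; rewrite subrK => h; apply: (le_trans h).
rewrite mulrAC [leRHS]mulrC ler_wpM2l// (le_trans (sum_coord_le _))//.
by rewrite mulrDl lerDr mulr_ge0// enorm_ge0.
Qed.

(** A second difference is small in both increments at once. *)
Lemma second_difference_le f (M : R) : (forall i y, derivable f y 'e_i) ->
  (forall j i y, derivable (partial j f) y 'e_i) ->
  (forall y, `|f y| <= M) -> (forall i y, `|partial i f y| <= M) ->
  (forall j i y, `|partial i (partial j f) y| <= M) ->
  forall x z w, `|f x - f (x - z) - f (x - w) + f (x - z - w)| <=
    (2 + d%:R) * ((2 + d%:R) * M) * (min1 (enorm z) * min1 (enorm w)).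
Proof.
move=> df ddf f0 f1 f2 x z w.
pose g y := f y - f (y - z).
have tg i y : derivable (fun y => f (y - z)) y 'e_i /\
    partial i (fun y => f (y - z)) y = partial i f (y - z).
  exact: derivable_transl.
have dg i y : derivable g y 'e_i by apply: derivableB => //; exact: (tg i y).1.
have pg i y : partial i g y = partial i f y - partial i f (y - z).
  by rewrite /partial /g deriveB//; [congr (_ - _); exact: (tg i y).2|exact: (tg i y).1].
have M0 : 0 <= M by apply: le_trans (f0 x).
have := @min1_lipschitz g ((2 + d%:R) * M * min1 (enorm z)) dg.
rewrite (_ : f x - _ - _ + _ = g x - g (x - w)); last first.
  by rewrite /g [x - w - z]addrAC; ring.
move=> /(_ _ _ x w) h; apply: le_trans (h _ _) _.
- by move=> y; exact: min1_lipschitz.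
- by move=> i y; rewrite pg; exact: min1_lipschitz.
- by rewrite !mulrA.
Qed.

End line_derivatives.

Section test_function_theory.
Context {R : realType} (d : nat).
Local Notation leb := (@lebesgue_rV R d).
Implicit Types (phi : 'rV[R]_d -> R) (x v w z : 'rV[R]_d) (i j : 'I_d).

Lemma smooth_continuous phi : smooth phi -> continuous phi.
Proof. by move=> /(_ [::])[]. Qed.

Lemma smooth_derivable phi : smooth phi -> forall i x, derivable phi x 'e_i.
Proof. by move=> /(_ [::])[]. Qed.

Lemma smooth_partial phi i : smooth phi -> smooth (partial i phi).
Proof. by move=> sphi l; have := sphi (rcons l i); rewrite foldr_rcons. Qed.

Lemma supp_notin phi x : ~ supp phi x -> phi x = 0.
Proof.
move=> h; apply: contrapT => /eqP phix; apply: h.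
by apply: (@subset_closure _ [set x | phi x != 0]).
Qed.

Lemma near_notin_supp phi x : ~ supp phi x -> \forall y \near x, phi y = 0.
Proof.
move=> h; have : open (~` supp phi) by apply: closed_openC; exact: closed_closure.
rewrite openE => /(_ x h); apply: filterS => y; exact: supp_notin.
Qed.

Lemma partial_notin_supp phi i x : ~ supp phi x -> partial i phi x = 0.
Proof.
move=> nx; rewrite /partial -(derive_cst (V := 'rV[R]_d) (W := R) 0 x 'e_i).
apply: near_eq_derive; by apply: filterS (near_notin_supp nx).
Qed.

Lemma closed_supp phi : closed (supp phi). Proof. exact: closed_closure. Qed.

Lemma supp_subset phi (A : set 'rV[R]_d) : closed A ->
  (forall x, phi x != 0 -> A x) -> supp phi `<=` A.
Proof.
move=> /closure_id cA h; rewrite cA; apply: closure_subset => x; exact: h.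
Qed.

Lemma supp_partial phi i : supp (partial i phi) `<=` supp phi.
Proof.
apply: supp_subset => [|x]; first exact: closed_supp.
by apply: contraPP => /partial_notin_supp ->; rewrite eqxx.
Qed.

Lemma test_partial (Om : set 'rV[R]_d) phi i :
  test_function Om phi -> test_function Om (partial i phi).
Proof.
move=> [sphi cphi Op]; split; first exact: smooth_partial.
- by apply: (subclosed_compact _ cphi); [exact: closed_supp|exact: supp_partial].
- by apply: subset_trans Op; exact: supp_partial.
Qed.

Lemma test_subset (A B : set 'rV[R]_d) phi : A `<=` B ->
  test_function A phi -> test_function B phi.
Proof. by move=> AB [? ? ?]; split => //; exact: subset_trans AB. Qed.

Lemma test_bounded (Om : set 'rV[R]_d) phi : test_function Om phi ->
  exists2 M, 0 <= M & forall x, `|phi x| <= M.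
Proof.
move=> [sphi cphi _].
have : compact (phi @` supp phi).
  by apply: continuous_compact => //; apply: continuous_subspaceT; exact: smooth_continuous.
move/compact_bounded => [M [Mr hM]].
pose M' := Num.max 0 (M + 1); have M'0 : 0 <= M' by rewrite /M' le_max lexx.
exists M' => // x; have [xs|/supp_notin ->] := pselect (supp phi x); last by rewrite normr0.
have : M < M' by rewrite /M' lt_max ltrDl ltr01 orbT.
by move/hM; apply; exists x.
Qed.

(** A common bound for a test function and its first two derivatives. *)
Lemma test_C2_bound (Om : set 'rV[R]_d) phi : test_function Om phi ->
  exists M, [/\ 0 <= M, (forall x, `|phi x| <= M), (forall i x, `|partial i phi x| <= M)
    & forall j i x, `|partial i (partial j phi) x| <= M].
Proof.
move=> tphi; have [M0 M00 h0] := test_bounded tphi.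
have /choice[M1 h1] : forall i, exists M, 0 <= M /\ forall x, `|partial i phi x| <= M.
  by move=> i; have [M ? ?] := test_bounded (test_partial i tphi); exists M.
have /choice[M2 h2] : forall ij : 'I_d * 'I_d, exists M, 0 <= M /\
    forall x, `|partial ij.1 (partial ij.2 phi) x| <= M.
  move=> [i j]; have [M ? ?] := test_bounded (test_partial i (test_partial j tphi)).
  by exists M.
have s1 : 0 <= \sum_i M1 i by apply: sumr_ge0 => i _; exact: (h1 i).1.
have s2 : 0 <= \sum_ij M2 ij by apply: sumr_ge0 => k _; exact: (h2 k).1.
exists (M0 + \sum_i M1 i + \sum_ij M2 ij); split.
- by rewrite !addr_ge0.
- by move=> x; rewrite -addrA ler_wpDr ?addr_ge0.
- move=> i x; rewrite ler_wpDr// ler_wpDl// (le_trans ((h1 i).2 x))//.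
  by rewrite (bigD1 i)//= lerDl sumr_ge0// => k _; exact: (h1 k).1.
- move=> j i x; rewrite ler_wpDl ?addr_ge0// (le_trans ((h2 (i, j)).2 x))//.
  by rewrite (bigD1 (i, j))//= lerDl sumr_ge0// => k _; exact: (h2 k).1.
Qed.

Lemma test_min1_lipschitz (Om : set 'rV[R]_d) phi : test_function Om phi ->
  exists2 M, 0 <= M & forall x v, `|phi x - phi (x - v)| <= M * min1 (enorm v).
Proof.
move=> tphi; have [M [M0 h0 h1 _]] := test_C2_bound tphi.
exists ((2 + d%:R) * M); first by rewrite mulr_ge0// addr_ge0.
by apply: min1_lipschitz => //; apply: smooth_derivable; case: tphi.
Qed.

Lemma test_second_difference (Om : set 'rV[R]_d) phi : test_function Om phi ->
  exists2 M, 0 <= M & forall x z w, `|phi x - phi (x - z) - phi (x - w) + phi (x - z - w)| <=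
    M * (min1 (enorm z) * min1 (enorm w)).
Proof.
move=> tphi; have [M [M0 h0 h1 h2]] := test_C2_bound tphi.
exists ((2 + d%:R) * ((2 + d%:R) * M)); first by rewrite !mulr_ge0// addr_ge0.
have sphi : smooth phi by case: tphi.
apply: second_difference_le => //; first exact: smooth_derivable.
by move=> j; apply: smooth_derivable; exact: smooth_partial.
Qed.

Lemma measurable_smooth phi : smooth phi -> measurable_fun setT phi.
Proof. by move=> /smooth_continuous; exact: continuous_measurable_rV. Qed.

Lemma measurable_smoothT dT (T : measurableType dT) phi (f : T -> 'rV[R]_d) :
  smooth phi -> measurable_fun setT f -> measurable_fun setT (fun t => phi (f t)).
Proof. by move=> /measurable_smooth mphi mf; exact: (measurableT_comp mphi mf). Qed.

End test_function_theory.

Lemma continuous_translate {R : realType} d (phi : 'rV[R]_d -> R) (v : 'rV[R]_d) :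
  continuous phi -> continuous (fun y : 'rV[R]_d => phi (y + v)).
Proof.
move=> cphi x; have : {for x, continuous (fun y : 'rV[R]_d => y + v)}.
  by apply: continuousD; [exact: cvg_id|exact: cst_continuous].
by move=> h; exact: (continuous_comp h (cphi _)).
Qed.

Section difference_operator.
Context {R : realType} (d : nat).
Local Notation leb := (@lebesgue_rV R d).
Implicit Types (phi : 'rV[R]_d -> R) (x v w z : 'rV[R]_d) (i j : 'I_d).
Variable kappa : 'rV[R]_d -> R.
Hypothesis mk : measurable_fun setT kappa.
Hypothesis ik : leb.-integrable setT (EFin \o (fun z => min1 (enorm z) * `|kappa z|)).

Definition diffop phi x : R := \int[leb]_z ((phi x - phi (x - z)) * kappa z).

Let mdiff phi x : smooth phi ->
  measurable_fun setT (fun z => (phi x - phi (x - z)) * kappa z).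
Proof.
move=> sphi; apply: measurable_funM => //; apply: measurable_funB => //.
by apply: measurable_smoothT => //; exact: measurable_rVB.
Qed.

Lemma diffop_dominated Om phi : test_function Om phi -> exists2 M, 0 <= M &
  forall x z, `|(phi x - phi (x - z)) * kappa z| <= M * (min1 (enorm z) * `|kappa z|).
Proof.
move=> /test_min1_lipschitz[M M0 hM]; exists M => // x z.
by rewrite normrM mulrA ler_wpM2r.
Qed.

Lemma integrable_diffop Om phi x : test_function Om phi ->
  leb.-integrable setT (EFin \o (fun z => (phi x - phi (x - z)) * kappa z)).
Proof.
move=> tphi; have [M M0 hM] := diffop_dominated tphi.
apply: dom_integrable (hM x) (integrable_scaler M ik).
by apply: mdiff; case: tphi.
Qed.

Lemma continuous_diffop Om phi : test_function Om phi -> continuous (diffop phi).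
Proof.
move=> tphi; have sphi : smooth phi by case: tphi.
have [M M0 hM] := diffop_dominated tphi => x.
apply: (@continuous_Rintegral_dominated _ _ _ leb 'rV[R]_d
  (fun x z => (phi x - phi (x - z)) * kappa z) x (fun z => M * (min1 (enorm z) * `|kappa z|))).
- by move=> y; exact: mdiff.
- move=> z; apply: (@cvgM _ _ (nbhs x)); last exact: cst_continuous.
  apply: cvgB; first exact: smooth_continuous.
  by apply: continuous_translate; exact: smooth_continuous.
- by apply: (@filterE _ (nbhs x)) => y z; exact: hM.
- exact: integrable_scaler.
Qed.

Lemma diffop_partial Om phi i x : test_function Om phi ->
  derivable (diffop phi) x 'e_i /\ partial i (diffop phi) x = diffop (partial i phi) x.
Proof.
move=> tphi; have sphi : smooth phi by case: tphi.
have tp := test_partial i tphi; have [M M0 hM] := diffop_dominated tp.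
pose f (t : R) z := (phi (x + t *: 'e_i) - phi (x + t *: 'e_i - z)) * kappa z.
have dphi (y : 'rV[R]_d) : derivable phi y 'e_i by exact: smooth_derivable.
have df (t : R) z : derivable (f^~ z) t 1 /\
    'D_1 (f^~ z) t = (partial i phi (x + t *: 'e_i) - partial i phi (x + t *: 'e_i - z)) * kappa z.
  have [h1 h2] := derivable_line (dphi (x + t *: 'e_i)).
  have e : (fun t : R => phi (x + t *: 'e_i - z)) = (fun t : R => phi (x - z + t *: 'e_i)).
    by apply/funext => r; rewrite addrAC.
  have [h3 h4] := derivable_line (dphi (x - z + t *: 'e_i)).
  rewrite -e in h3; split.
    by apply: derivableM => //; exact: derivableB.
  rewrite /f deriveM//; last exact: derivableB.
  rewrite derive_cst scaler0 add0r deriveB// h2 /partial e h4 [X in _ - 'D__ _ X]addrAC.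
  by rewrite /GRing.scale/= mulrC.
have I0 : `](-1 : R), 1[%classic (0 : R) by rewrite /= in_itv/= ltrN10 ltr01.
have int_f t : leb.-integrable setT (EFin \o f t) by exact: integrable_diffop tphi.
have der_f (t : R) z : `](-1 : R), 1[%classic t -> [set: 'rV[R]_d] z -> derivable (f^~ z) t 1.
  by move=> _ _; exact: (df t z).1.
have M_ge0 z : 0 <= M * (min1 (enorm z) * `|kappa z|).
  by rewrite !mulr_ge0// min1_ge0// enorm_ge0.
have f_ub (t : R) z : `](-1 : R), 1[%classic t -> [set: 'rV[R]_d] z ->
    `|partial1of2 f t z| <= M * (min1 (enorm z) * `|kappa z|).
  by move=> _ _; rewrite partial1of2E (df t z).2; exact: hM.
have iM := integrable_scaler M ik.
have dF := derivable_under_integral measurableT I0 (fun t _ => int_f t) der_f M_ge0 iM f_ub.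
have eF := differentiation_under_integral measurableT I0 (fun t _ => int_f t) der_f M_ge0 iM f_ub.
have [h1 h2] := @derivable_at_line R d (diffop phi) x 'e_i dF; split => //.
rewrite /partial h2 -derive1E eF; apply: eq_Rintegral => z _.
by rewrite partial1of2E (df 0 z).2 scale0r addr0.
Qed.

Lemma foldr_partial_diffop Om phi (l : seq 'I_d) : test_function Om phi ->
  foldr partial (diffop phi) l = diffop (foldr partial phi l) /\ test_function Om (foldr partial phi l).
Proof.
move=> tphi; elim: l => [//|i l [/= -> tl]]; split; last exact: test_partial.
by apply/funext => x; exact: (diffop_partial i x tl).2.
Qed.

Lemma smooth_diffop Om phi : test_function Om phi -> smooth (diffop phi).
Proof.
move=> tphi l; have [-> tl] := foldr_partial_diffop l tphi; split.
  exact: continuous_diffop tl.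
by move=> i x; exact: (diffop_partial i x tl).1.
Qed.

(** A kernel of small support keeps the operator local up to that scale. *)
Lemma test_diffop Om phi (e : R) : test_function [set: 'rV[R]_d] phi ->
  (forall z, e <= enorm z -> kappa z = 0) ->
  (forall y z, supp phi y -> `|z| <= e -> Om (y + z)) ->
  test_function Om (diffop phi).
Proof.
move=> tphi k0 hOm; have [sphi cphi _] := tphi.
pose B := [set z : 'rV[R]_d | `|z| <= e].
have cB : compact B.
  apply: bounded_closed_compact.
    exists e; split; first exact: num_real.
    by move=> r er z /= zB; exact: le_trans zB (ltW er).
  have : closed ((fun z : 'rV[R]_d => `|z|) @^-1` [set r : R | r <= e]).
    by apply: preimage_closed; [move=> z _; exact: norm_continuous|exact: closed_le].
  by [].
pose K := (fun yz : 'rV[R]_d * 'rV[R]_d => yz.1 + yz.2) @` (supp phi `*` B).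
have cK : compact K.
  apply: continuous_compact; last exact: compact_setX.
  by apply: continuous_subspaceT => yz; exact: add_continuous.
have clK : closed K by apply: compact_closed => //; exact: norm_hausdorff.
have sK : supp (diffop phi) `<=` K.
  apply: supp_subset => // x; apply: contra_neqP => nK.
  rewrite /diffop /Rintegral integral0_eq// => z _.
  have [ez|ez] := leP e (enorm z); first by rewrite k0// mulr0.
  have ze : `|z| <= e by rewrite (le_trans (norm_le_enorm z))// ltW.
  have e0 : 0 <= e by exact: le_trans ze.
  have -> : phi x = 0.
    apply: supp_notin => xs; apply: nK; exists (x, 0); last by rewrite /= addr0.
    by split => //=; rewrite /B /= normr0.
  have -> : phi (x - z) = 0.
    by apply: supp_notin => xs; apply: nK; exists (x - z, z); rewrite //= subrK.
  by rewrite subrr mul0r.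
split; first exact: smooth_diffop tphi.
- by apply: (subclosed_compact _ cK) => //; exact: closed_supp.
- by move=> x /sK [[y z] [/= ys zB] <-]; exact: hOm.
Qed.

End difference_operator.

Section frullani.
Context {R : realType}.
Local Notation mu := (@lebesgue_measure R).
Implicit Types (b t : R) (M : R -> R).

Let chi (c t : R) : R := if c < t then 1 else 0.

Let measurable_chi dT (T : measurableType dT) (f g : T -> R) :
  measurable_fun setT f -> measurable_fun setT g ->
  measurable_fun setT (fun x => chi (g x) (f x)).
Proof. by move=> mf mg; apply: measurable_fun_ifT => //; exact: measurable_fun_ltr. Qed.

Lemma hpow_ltE (g1 g2 t : R) : 0 < t -> g1 <= g2 ->
  Num.min (hpow g2 t) (hpow g1 t) = if t <= 1 then hpow g2 t else hpow g1 t.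
Proof.
move=> t0 g12; rewrite /hpow t0; case: (leP t 1) => t1.
  by rewrite min_l// ger_powR ?t0 ?t1//; lra.
by rewrite min_r// ler_powR ?(ltW t1)//; lra.
Qed.

(** The logarithm, as the integral of dt/t over ]1, b], in the form in which it
    comes out of Frullani's integral. *)
Definition log_integral b : R := \int[mu]_t (hpow 0 t * (chi 1 t - chi b t)).

Let log_bound b t : 1 < b -> `|hpow 0 t * (chi 1 t - chi b t)| <=
  b * Num.min (hpow 2^-1 t) (hpow (- 2^-1) t).
Proof.
move=> b1; have b0 : 0 < b by apply: lt_trans b1.
have [t0|t0] := ltP 0 t; last by rewrite /hpow ltNge t0/= mul0r normr0 minxx mulr0.
rewrite hpow_ltE//; last lra.
rewrite /chi; case: (leP t 1) => t1.
  rewrite [b < t]ltNge (le_trans t1 (ltW b1))/=.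
  by rewrite subrr mulr0 normr0 mulr_ge0 ?hpow_ge0// ltW.
case: ifPn => tb; first by rewrite subrr mulr0 normr0 mulr_ge0 ?hpow_ge0// ltW.
rewrite subr0 mulr1 ger0_norm ?hpow_ge0// /hpow t0.
have tb' : t <= b by rewrite leNgt.
have -> : t `^ (0 - 1) = t `^ 2^-1 * t `^ (- 2^-1 - 1).
  rewrite -powRD; first by congr (_ `^ _); lra.
  by rewrite (gt_eqF t0) implybT.
rewrite ler_wpM2r ?powR_ge0// (le_trans _ tb')//.
by rewrite ler1_powR ?(ltW t1)//; lra.
Qed.

Lemma integrable_log b : 1 < b ->
  mu.-integrable setT (EFin \o (fun t => hpow 0 t * (chi 1 t - chi b t))).
Proof.
move=> b1; have hi : mu.-integrable setT (EFin \o (fun t => Num.min (hpow 2^-1 t) (hpow (- 2^-1) t))).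
  by apply: hpow_min_integrable; lra.
apply: dom_integrable (integrable_scaler b hi).
  apply: measurable_funM; first exact: measurable_hpow.
  by apply: measurable_funB; exact: measurable_chi.
by move=> t; exact: log_bound.
Qed.

(** Frullani's integral.  Up to a multiple of the indicator of the half-line
    t > 1, [M] is integrable for the dilation invariant measure dt/t, so that
    only the indicator contributes. *)
Lemma frullani M (Moo C b : R) : measurable_fun setT M -> 1 < b -> 0 <= C ->
  (forall t, 0 < t -> `|M t| <= C * t `^ 2^-1) ->
  (forall t, 0 < t -> `|M t - Moo| <= C * t `^ (- 2^-1)) ->
  mu.-integrable setT (EFin \o (fun t => hpow 0 t * (M t - M (t / b)))) /\
  \int[mu]_t (hpow 0 t * (M t - M (t / b))) = Moo * log_integral b.
Proof.
move=> mM b1 C0 M1 M2; have b0 : 0 < b by apply: lt_trans b1.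
pose N t := M t - Moo * chi 1 t; pose f t := hpow 0 t * N t.
have hi : mu.-integrable setT (EFin \o (fun t => Num.min (hpow 2^-1 t) (hpow (- 2^-1) t))).
  by apply: hpow_min_integrable; lra.
have mN : measurable_fun setT N.
  by apply: measurable_funB => //; apply: measurable_funM => //; exact: measurable_chi.
have fi : mu.-integrable setT (EFin \o f).
  apply: dom_integrable (integrable_scaler C hi).
    by apply: measurable_funM => //; exact: measurable_hpow.
  move=> t; have [t0|t0] := ltP 0 t; last by rewrite /f /hpow ltNge t0/= mul0r normr0 minxx mulr0.
  rewrite hpow_ltE//; last lra.
  have pw (r : R) : t `^ r * t `^ (0 - 1) = hpow r t.
    rewrite /hpow t0 -powRD; first by congr (_ `^ _); lra.
    by rewrite (gt_eqF t0) implybT.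
  rewrite /f normrM (ger0_norm (hpow_ge0 _ _)) mulrC {1}/hpow t0 /N /chi.
  by case: (leP t 1) => t1; rewrite -pw mulrA ler_wpM2r ?powR_ge0// ?mulr0 ?subr0 ?mulr1; [exact: M1|exact: M2].
have bi0 : 0 < b^-1 by rewrite invr_gt0.
have bin0 : b^-1 != 0 by rewrite gt_eqF.
have fe t : f (b^-1 * t) = b * (hpow 0 t * N (t / b)).
  by rewrite /f hpowM// sub0r powR_inv1 ?ltW// invrK -!mulrA (mulrC t).
have fbi : mu.-integrable setT (EFin \o (fun t => hpow 0 t * N (t / b))).
  have := integrable_scaler b^-1 (integrable_affine 0 bin0 fi).
  by apply: eq_integrable => // t _ /=; rewrite addr0 fe mulKf// gt_eqF.
have e : \int[mu]_t (hpow 0 t * N (t / b)) = \int[mu]_t f t.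
  have := Rintegral_dilate bi0 fi; rewrite invrK => h.
  apply: (@mulfI _ b); first by rewrite gt_eqF.
  rewrite -h -RintegralZl//; apply: eq_Rintegral => t _; exact/esym/fe.
have E t : hpow 0 t * (M t - M (t / b)) =
    (f t - hpow 0 t * N (t / b)) + Moo * (hpow 0 t * (chi 1 t - chi b t)).
  rewrite /f /N (_ : chi 1 (t / b) = chi b t); last by rewrite /chi ltr_pdivlMr// mul1r.
  ring.
have i1 := integrable_subr fi fbi; have i2 := integrable_scaler Moo (integrable_log b1).
split; first by apply: eq_integrable (integrable_addr i1 i2) => // t _ /=; rewrite E.
under eq_Rintegral do rewrite E.
rewrite RintegralD// RintegralB// e subrr add0r RintegralZl//; exact: integrable_log.
Qed.

Lemma frullani_dilated M (Moo C b r : R) : measurable_fun setT M -> 1 < b -> 0 < r -> 0 <= C ->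
  (forall t, 0 < t -> `|M t| <= C * t `^ 2^-1) ->
  (forall t, 0 < t -> `|M t - Moo| <= C * t `^ (- 2^-1)) ->
  mu.-integrable setT (EFin \o (fun t => hpow 0 t * (M (t * r) - M (t * r / b)))) /\
  \int[mu]_t (hpow 0 t * (M (t * r) - M (t * r / b))) = Moo * log_integral b.
Proof.
move=> mM b1 r0 C0 M1 M2; have [fi fe] := frullani mM b1 C0 M1 M2.
pose f t := hpow 0 t * (M t - M (t / b)).
have E t : hpow 0 t * (M (t * r) - M (t * r / b)) = r * f (r * t).
  rewrite /f hpowM// sub0r powR_inv1 ?(ltW r0)// (mulrC r t) -!mulrA mulVKf// gt_eqF//.
have [gi ge] := Rintegral_dilateZ r0 fi.
split; first by apply: eq_integrable gi => // t _; rewrite /= E.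
by under eq_Rintegral do rewrite E; rewrite -ge.
Qed.

Let log_le1 t b : 1 < b -> 0 <= hpow 0 t * (chi 1 t - chi b t).
Proof.
move=> b1; rewrite mulr_ge0 ?hpow_ge0// subr_ge0 /chi; case: ifPn => // tb.
  by rewrite (lt_trans b1).
by case: ifP.
Qed.

Lemma log_integral_gt0 b : 1 < b -> 0 < log_integral b.
Proof.
move=> b1; have b0 : 0 < b by apply: lt_trans b1.
apply: (Rintegral_gt0_itv b1); first exact: integrable_log.
- by move=> t; exact: log_le1.
- move=> t /andP[t1 tb]; have t0 : 0 < t by apply: lt_trans t1.
  by rewrite /hpow t0 /chi t1 [b < t]ltNge (ltW tb)/= subr0 mulr1 powR_gt0.
Qed.

Lemma log_integral_le b (g : R) : 1 < b -> 0 < g -> log_integral b <= g^-1 * (b `^ g - 1).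
Proof.
move=> b1 g0; have b0 : 0 < b by apply: lt_trans b1.
rewrite -lee_fin EFin_Rintegral; last exact: integrable_log.
have -> : g^-1 * (b `^ g - 1) = g^-1 * (b `^ g - 1 `^ g) by rewrite powR1.
rewrite -(@integral_powR_itv R g 1 b (lt0r_neq0 g0) ltr01 b1).
rewrite [leRHS]integral_mkcond; apply: ge0_le_integral => //.
- by move=> t _; rewrite lee_fin log_le1.
- apply/measurable_EFinP; exact: integrableT_measurable (integrable_log b1).
- by apply/(measurable_restrictT _ _).1 => //; apply/measurable_EFinP; exact: measurable_funTS.
move=> t _; rewrite patchE; case: ifPn; rewrite ?inE ?notin_setE /= in_itv/=.
  move=> /andP[t1 tb]; have t0 : 0 < t by apply: lt_le_trans t1.
  rewrite lee_fin /hpow t0 -[leRHS]mulr1 ler_pM ?powR_ge0//.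
  - by have := @log_le1 t b b1; rewrite /hpow t0 pmulr_rge0// powR_gt0.
  - by rewrite ler_powR//; lra.
  - by rewrite /chi; do 2 case: ifP => _; lra.
move=> h; rewrite lee_fin le_eqVlt; apply/orP; left; apply/eqP.
rewrite /chi; case: ifPn => t1.
  case: ifPn => tb; first by rewrite subrr mulr0.
  by exfalso; apply: h; rewrite (ltW t1) leNgt.
case: ifPn => tb; last by rewrite subrr mulr0.
by exfalso; move: t1; rewrite (lt_trans b1).
Qed.

Lemma measurable_log_integral : measurable_fun setT log_integral.
Proof.
apply: (@measurable_Rintegral2 _ _ _ _ R mu (fun z => hpow 0 z.2 * (chi 1 z.2 - chi z.1 z.2))).
apply: measurable_funM; first exact: (measurableT_comp (measurable_hpow 0)).
by apply: measurable_funB; exact: measurable_chi.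
Qed.

Lemma integrable_hpow_log (a : R) : 0 < a < 1 ->
  mu.-integrable setT (EFin \o (fun t => hpow (- a) t * log_integral (1 + t))).
Proof.
move=> /andP[a0 a1]; pose g := a / 2; have g0 : 0 < g by rewrite divr_gt0.
pose K := 1 + g^-1 * 2 `^ g.
have K0 : 0 <= g^-1 * 2 `^ g by rewrite mulr_ge0 ?powR_ge0// invr_ge0 ltW.
have hi : mu.-integrable setT (EFin \o (fun t => Num.min (hpow (1 - a) t) (hpow (- g) t))).
  by apply: hpow_min_integrable; rewrite /g; lra.
apply: dom_integrable (integrable_scaler K hi).
  apply: measurable_funM; first exact: measurable_hpow.
  by apply: (measurableT_comp measurable_log_integral); exact: measurable_funD.
move=> t; have [t0|t0] := ltP 0 t; last by rewrite /hpow ltNge t0/= mul0r normr0 minxx mulr0.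
have t1 : 1 < 1 + t by rewrite ltrDl.
rewrite hpow_ltE//; last by rewrite /g; lra.
rewrite ger0_norm; last by rewrite mulr_ge0 ?hpow_ge0// ltW// log_integral_gt0.
rewrite /hpow t0; case: (leP t 1) => t2.
  have -> : t `^ (1 - a - 1) = t `^ (- a - 1) * t.
    rewrite -[X in _ * X]powRr1 ?(ltW t0)// -powRD; first by congr (_ `^ _); lra.
    by rewrite (gt_eqF t0) implybT.
  rewrite mulrCA ler_wpM2l ?powR_ge0//.
  have := log_integral_le t1 ltr01; rewrite invr1 mul1r powRr1; last by rewrite addr_ge0// ltW.
  move=> h.
  apply: (le_trans h); rewrite addrAC subrr add0r; apply: ler_peMl; first exact: ltW.
  by rewrite /K lerDl.
have -> : t `^ (- g - 1) = t `^ (- a - 1) * t `^ g.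
  rewrite -powRD; first by congr (_ `^ _); rewrite /g; lra.
  by rewrite (gt_eqF t0) implybT.
rewrite mulrCA ler_wpM2l ?powR_ge0// (le_trans (log_integral_le t1 g0))//.
apply: (@le_trans _ _ (g^-1 * (2 * t) `^ g)).
  rewrite ler_wpM2l ?invr_ge0 ?(ltW g0)// (le_trans (y := (1 + t) `^ g)) ?lerBlDr ?lerDl//.
  by rewrite ge0_ler_powR ?nnegrE//; lra.
by rewrite powRM ?(ltW t0)// mulrA ler_wpM2r ?powR_ge0// /K lerDr.
Qed.

Lemma Rintegral_hpow_log_gt0 (a : R) : 0 < a < 1 ->
  0 < \int[mu]_t (hpow (- a) t * log_integral (1 + t)).
Proof.
move=> a01; apply: (@Rintegral_gt0_itv _ _ 0 1) => //; first exact: integrable_hpow_log.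
- move=> t; have [t0|t0] := ltP 0 t; last by rewrite /hpow ltNge t0/= mul0r.
  by rewrite mulr_ge0 ?hpow_ge0// ltW// log_integral_gt0// ltrDl.
- move=> t /andP[t0 _]; rewrite mulr_gt0//; last by rewrite log_integral_gt0// ltrDl.
  by rewrite /hpow t0 powR_gt0.
Qed.

End frullani.

Section kernels_of_operators.
Context {R : realType} (d : nat).
Local Notation leb := (@lebesgue_rV R d).
Implicit Types (s : R) (w z : 'rV[R]_d) (i : 'I_d).

(** The kernels of D^s and, up to a constant, of the fractional Laplacian of
    order s. *)
Definition vker s i w : R := (enorm w `^ (d%:R + s))^-1 * (w ord0 i / enorm w).
Definition sker s z : R := enorm z `^ (- (d%:R + s)).

Lemma sker_ge0 s z : 0 <= sker s z. Proof. exact: powR_ge0. Qed.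

Lemma measurable_vkerT s i dT (T : measurableType dT) (f : T -> 'rV[R]_d) :
  measurable_fun setT f -> measurable_fun setT (fun t => vker s i (f t)).
Proof.
move=> mf; have E t : vker s i (f t) = enorm (f t) `^ (- (d%:R + s)) * (f t ord0 i * enorm (f t) `^ (-1)).
  by rewrite /vker powRN powR_inv1// enorm_ge0.
under eq_fun do rewrite E.
have me := measurable_enormT mf.
apply: measurable_funM; first exact: measurable_powRT.
by apply: measurable_funM; [exact: measurable_coordT|exact: measurable_powRT].
Qed.

Lemma measurable_sker s : measurable_fun setT (sker s).
Proof. by apply: measurable_powRT; exact: measurable_enormT. Qed.

Lemma vker_le s i w : `|vker s i w| <= sker s w.
Proof.
rewrite /vker /sker powRN normrM ger0_norm ?invr_ge0 ?powR_ge0//.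
rewrite -[leRHS]mulr1 ler_wpM2l ?invr_ge0 ?powR_ge0// normrM normfV (ger0_norm (enorm_ge0 w)).
have [->|w0] := eqVneq w 0; first by rewrite mxE normr0 mul0r.
by rewrite ler_pdivrMr ?enorm_gt0// mul1r; exact: coord_le_enorm.
Qed.

Lemma vkerE s i w : 0 < d%:R + s -> vker s i w = w ord0 i * enorm w `^ (- ((d%:R + s + 1) / 2 * 2)).
Proof.
move=> ds; have [->|w0] := eqVneq w 0; first by rewrite /vker mxE !mul0r mulr0.
rewrite divfK// opprD powRD; last by rewrite (gt_eqF (enorm_gt0 w0)) implybT.
by rewrite powRN powR_inv1 ?enorm_ge0// /vker mulrCA mulrA.
Qed.

Lemma skerE s z : sker s z = enorm z `^ (- ((d%:R + s) / 2 * 2)).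
Proof. by rewrite divfK. Qed.

Lemma integrable_min1_sker s : 0 < s < 1 ->
  leb.-integrable setT (EFin \o (fun z => min1 (enorm z) * `|sker s z|)).
Proof.
move=> /(integrable_min1_kernel d); apply: eq_integrable => // z _ /=.
by rewrite (ger0_norm (sker_ge0 _ _)).
Qed.

Lemma integrable_min1_vker s i : 0 < s < 1 ->
  leb.-integrable setT (EFin \o (fun z => min1 (enorm z) * `|vker s i z|)).
Proof.
move=> /integrable_min1_sker; apply: dom_integrable.
  apply: measurable_funM; first by apply: measurable_min1; exact: measurable_enormT.
  by apply: measurableT_comp => //; exact: measurable_vkerT.
move=> z; rewrite normrM normr_id (ger0_norm (min1_ge0 (enorm_ge0 _))) (ger0_norm (sker_ge0 _ _)).
by rewrite ler_wpM2l ?min1_ge0 ?enorm_ge0//; exact: vker_le.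
Qed.

Lemma fpartialE s i phi x : 0 < s < 1 -> test_function setT phi ->
  fpartial s i phi x = @fgrad_const R d s * diffop (vker s i) phi x.
Proof.
move=> s01 tphi; congr (_ * _); rewrite /diffop -[RHS](Rintegral_subl x).
  apply: eq_Rintegral => y _; rewrite subKr /vker -mulrA; congr (_ * (_ * (_ / _))).
  by rewrite !mxE.
apply: integrable_diffop tphi; first by apply: measurable_vkerT.
exact: integrable_min1_vker.
Qed.

Lemma fgrad_const_gt0 s : 0 < s < 1 -> 0 < @fgrad_const R d s.
Proof.
move=> /andP[s0 s1]; rewrite /fgrad_const !mulr_gt0 ?invr_gt0 ?powR_gt0 ?pi_gt0//.
- by apply: Gamma_gt0; rewrite divr_gt0// addr_gt0// ltr_wpDl.
- by apply: Gamma_gt0; rewrite divr_gt0// subr_gt0.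
Qed.

End kernels_of_operators.

Section difference_operators.
Context {R : realType} (d : nat).
Local Notation leb := (@lebesgue_rV R d).
Implicit Types (x w z : 'rV[R]_d) (k nu : 'rV[R]_d -> R).

Definition admissible k := measurable_fun setT k /\
  leb.-integrable setT (EFin \o (fun z => min1 (enorm z) * `|k z|)).

Variables (phi : 'rV[R]_d -> R) (tphi : test_function setT phi).

Definition diff2 x z w : R := phi x - phi (x - z) - phi (x - w) + phi (x - z - w).

Lemma measurable_diff2T x dT (T : measurableType dT) (f g : T -> 'rV[R]_d) :
  measurable_fun setT f -> measurable_fun setT g ->
  measurable_fun setT (fun t => diff2 x (f t) (g t)).
Proof.
move=> mf mg; have sphi : smooth phi by case: tphi.
have m1 : measurable_fun setT (fun t => x - f t) by exact: measurable_rVB.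
have m2 : measurable_fun setT (fun t => x - g t) by exact: measurable_rVB.
have m3 : measurable_fun setT (fun t => x - f t - g t) by exact: measurable_rVB.
by apply: measurable_funD; [apply: measurable_funB; [apply: measurable_funB|]|] => //; exact: measurable_smoothT.
Qed.

Lemma integrable_diff2 k nu x : admissible k -> admissible nu ->
  (leb \x leb)%E.-integrable setT (EFin \o (fun wz => diff2 x wz.2 wz.1 * k wz.2 * nu wz.1)).
Proof.
move=> [mk ik] [mn i_n]; have [M M0 hM] := test_second_difference tphi.
apply: integrable_tensor_dominated i_n (integrable_scaler M ik).
  apply: measurable_funM; last exact: measurableT_comp.
  by apply: measurable_funM; [exact: measurable_diff2T|exact: measurableT_comp].
move=> w z /=; rewrite !normrM.
rewrite [leRHS](_ : _ = M * (min1 (enorm z) * min1 (enorm w)) * `|k z| * `|nu w|); last by ring.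
by rewrite !ler_wpM2r//; exact: hM.
Qed.

Lemma diffopB_diffop k x w : admissible k ->
  diffop k phi x - diffop k phi (x - w) = \int[leb]_z (diff2 x z w * k z).
Proof.
move=> [mk ik]; rewrite /diffop -RintegralB//; last 2 first.
- exact: integrable_diffop tphi.
- exact: integrable_diffop tphi.
by apply: eq_Rintegral => z _; rewrite /diff2 [x - w - z]addrAC; ring.
Qed.

Lemma diffop_diffop_integrand k nu x w : admissible k ->
  (diffop k phi x - diffop k phi (x - w)) * nu w = \int[leb]_z (diff2 x z w * k z * nu w).
Proof.
move=> ak; rewrite diffopB_diffop// RintegralZr//; have [mk ik] := ak.
have [M M0 hM] := test_second_difference tphi.
apply: dom_integrable (integrable_scaler (M * min1 (enorm w)) ik).
  by apply: measurable_funM => //; exact: measurable_diff2T.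
move=> z; rewrite normrM.
rewrite [leRHS](_ : _ = M * (min1 (enorm z) * min1 (enorm w)) * `|k z|); last by ring.
by rewrite ler_wpM2r//; exact: hM.
Qed.

Lemma diffop_diffop k nu x : admissible k -> admissible nu ->
  leb.-integrable setT (EFin \o (fun w => (diffop k phi x - diffop k phi (x - w)) * nu w)) /\
  diffop nu (diffop k phi) x = \int[leb]_w \int[leb]_z (diff2 x z w * k z * nu w).
Proof.
move=> ak an; split.
  have := integrable_Rintegral2 (integrable_diff2 x ak an).
  by apply: eq_integrable => // w _ /=; rewrite diffop_diffop_integrand.
by apply: eq_Rintegral => w _; rewrite diffop_diffop_integrand.
Qed.

End difference_operators.

Section gaussian_quotient.
Context {R : realType} (d : nat).
Local Notation leb := (@lebesgue_rV R d).
Implicit Types (w z v : 'rV[R]_d).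
Variables (phi : 'rV[R]_d -> R) (tphi : test_function setT phi) (x : 'rV[R]_d) (i : 'I_d).

Let sphi : smooth phi. Proof. by case: tphi. Qed.

Let bphi : exists2 B, 0 <= B & forall y, `|phi y| <= B. Proof. exact: test_bounded tphi. Qed.

Definition gauss_first (l : R) : R := \int[leb]_w (phi (x - w) * (w ord0 i * gauss l w)).

(** The weak form of the derivative of the Gaussian regularization of [phi]
    at time 1/l. *)
Definition gauss_quotient (l : R) : R := l `^ (d%:R / 2 + 1) * gauss_first l.

Lemma integrable_gauss_first (f : 'rV[R]_d -> R) (B l : R) : 0 < l -> measurable_fun setT f ->
  (forall w, `|f w| <= B) ->
  leb.-integrable setT (EFin \o (fun w => f w * (w ord0 i * gauss l w))).
Proof.
move=> l0 mf fB; have B0 : 0 <= B by apply: le_trans (fB 0).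
have gi := integrable_normr (integrable_coord_gauss i l0).
apply: dom_integrable (integrable_scaler B gi).
  apply: measurable_funM => //; apply: measurable_funM; first exact: measurable_coordT.
  exact: measurable_gaussT.
by move=> w; rewrite normrM ler_wpM2r.
Qed.

Let mtrans (r : R) : measurable_fun setT (fun w => phi (x - r *: w)).
Proof. by apply: measurable_smoothT => //; apply: measurable_rVB => //; exact: measurable_rVZ. Qed.

Lemma measurable_gauss_quotient : measurable_fun setT gauss_quotient.
Proof.
apply: measurable_funM; first exact: measurable_powRT.
apply: (@measurable_Rintegral2 _ _ _ _ R leb (fun lw => phi (x - lw.2) * (lw.2 ord0 i * gauss lw.1 lw.2))).
apply: measurable_funM.
  by apply: measurable_smoothT => //; exact: measurable_rVB.
by apply: measurable_funM; [exact: measurable_coordT|exact: measurable_gaussT].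
Qed.

Lemma gauss_quotientE (l : R) : 0 < l -> gauss_quotient l =
  Num.sqrt l * \int[leb]_w (phi (x - (Num.sqrt l)^-1 *: w) * (w ord0 i * gauss 1 w)).
Proof.
move=> l0; have [B B0 hB] := bphi; set r := Num.sqrt l.
have r0 : 0 < r by rewrite sqrtr_gt0.
have ri0 : 0 < r^-1 by rewrite invr_gt0.
have fi : leb.-integrable setT (EFin \o (fun w => phi (x - w) * (w ord0 i * gauss l w))).
  apply: (integrable_gauss_first (B := B)) => //.
  by apply: measurable_smoothT => //; exact: measurable_rVB.
have := Rintegral_scale ri0 fi.
have -> : \int[leb]_w (phi (x - r^-1 *: w) * ((r^-1 *: w) ord0 i * gauss l (r^-1 *: w))) =
    r^-1 * \int[leb]_w (phi (x - r^-1 *: w) * (w ord0 i * gauss 1 w)).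
  rewrite -RintegralZl//; last exact: (integrable_gauss_first (B := B)).
  apply: eq_Rintegral => w _; rewrite mxE gauss_scale// scalerA mulfV ?gt_eqF// scale1r.
  by ring.
move=> e; rewrite /gauss_quotient /gauss_first.
have -> : l `^ (d%:R / 2 + 1) = r ^+ d * r ^+ 2.
  rewrite powRD ?(gt_eqF l0) ?implybT// powRr1 ?(ltW l0)// /r sqr_sqrtr ?(ltW l0)//; congr (_ * _).
  by apply: invr_inj; rewrite -powRN -sqrtrXn.
have -> : \int[leb]_w (phi (x - w) * (w ord0 i * gauss l w)) =
    r^-1 ^+ d * (r^-1 * \int[leb]_w (phi (x - r^-1 *: w) * (w ord0 i * gauss 1 w))).
  by rewrite e mulrA mulfV ?mul1r// expf_neq0// gt_eqF.
rewrite mulrACA -exprMn mulfV ?gt_eqF// expr1n mul1r mulrA; congr (_ * _).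
by rewrite expr2 mulfK// gt_eqF.
Qed.

Lemma gauss_quotient_le : exists2 C, 0 <= C & forall l, 0 < l ->
  `|gauss_quotient l| <= C * l `^ 2^-1.
Proof.
have [B B0 hB] := bphi; have gi := integrable_normr (integrable_coord_gauss i ltr01).
exists (B * \int[leb]_w `|w ord0 i * gauss 1 w|).
  by rewrite mulr_ge0//; apply: Rintegral_ge0.
move=> l l0; rewrite gauss_quotientE// normrM powR12_sqrt ?(ltW l0)//.
rewrite ger0_norm ?sqrtr_ge0// mulrC ler_wpM2r ?sqrtr_ge0// -RintegralZl//.
apply: normr_Rintegral_le; [exact: (integrable_gauss_first (B := B))|exact: integrable_scaler|].
by move=> w; rewrite normrM ler_wpM2r.
Qed.

(** Since the integrand of [gauss_quotient] is odd in the i-th coordinate, the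
    value of [phi] on the hyperplane where this coordinate vanishes may be
    subtracted: only a difference quotient in the i-th direction is left. *)
Lemma gauss_quotient_cvg : exists2 C, 0 <= C & forall l, 0 < l ->
  `|gauss_quotient l - (- gauss_moment d * partial i phi x)| <= C * l `^ (- 2^-1).
Proof.
have [B B0 hB] := bphi.
have [M M0 hM] : exists2 M, 0 <= M & forall y v, `|partial i phi (y + v) - partial i phi y| <= M * enorm v.
  have [M [M0 _ h1 h2]] := test_C2_bound (test_partial i tphi).
  exists (M * d%:R); first by rewrite mulr_ge0.
  move=> y v; apply: (le_trans (lipschitz_partial _ h1 y v)).
    by apply: smooth_derivable; exact: smooth_partial.
  by rewrite -mulrA ler_wpM2l// sum_coord_le.
have l2 : 0 < 2^-1 :> R by rewrite invr_gt0.
have qi := integrable_sqr_gauss d l2.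
exists (2 * M * \int[leb]_w (enorm w ^+ 2 * gauss 2^-1 w)).
  by rewrite !mulr_ge0//; apply: Rintegral_ge0 => w _; rewrite mulr_ge0 ?sqr_ge0 ?gauss_ge0.
move=> l l0; set r := Num.sqrt l; have r0 : 0 < r by rewrite sqrtr_gt0.
have ri0 : 0 < r^-1 by rewrite invr_gt0.
have -> : l `^ (- 2^-1) = r^-1 by rewrite powRN powR12_sqrt// ltW.
pose y w := x - r^-1 *: w; pose y0 w := y w + (r^-1 * w ord0 i) *: 'e_i.
have my : measurable_fun setT y by apply: measurable_rVB => //; exact: measurable_rVZ.
have my0 : measurable_fun setT y0.
  apply: measurable_rVD => //; apply: measurable_rVZ => //.
  by apply: measurable_funM => //; exact: measurable_coordT.
have i1 : leb.-integrable setT (EFin \o (fun w => phi (y w) * (w ord0 i * gauss 1 w))).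
  by apply: (integrable_gauss_first (B := B)) => //; exact: measurable_smoothT.
have i2 : leb.-integrable setT (EFin \o (fun w => phi (y0 w) * (w ord0 i * gauss 1 w))).
  by apply: (integrable_gauss_first (B := B)) => //; exact: measurable_smoothT.
have odd0 : \int[leb]_w (phi (y0 w) * (w ord0 i * gauss 1 w)) = 0.
  apply: (Rintegral_odd_coord (i := i)) => // w.
  rewrite /gauss enorm_reflect [in X in _ * (X * _)]mxE eqxx addr0 mulN1r mulNr mulrN; congr (- (phi _ * _)).
  apply/rowP => j; rewrite /y0 /y !mxE eqxx/= !addr0.
  by case: (eqVneq j i) => [->|ji]; rewrite ?mulr1 ?mulr0 ?mul1r//; ring.
have mom : leb.-integrable setT (EFin \o (fun w => w ord0 i ^+ 2 * gauss 1 w)).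
  apply: dom_integrable (integrable_sqr_gauss d ltr01).
    by apply: measurable_funM; [apply: measurable_funX; exact: measurable_coordT|exact: measurable_gaussT].
  move=> w; rewrite normrM (ger0_norm (gauss_ge0 _ _)) ler_wpM2r ?gauss_ge0//.
  by rewrite normrX lerXn2r ?nnegrE ?enorm_ge0// coord_le_enorm.
rewrite gauss_quotientE// -/r -(subr0 (\int[leb]_w _)) -odd0 -RintegralB//.
rewrite mulNr opprK -(Rintegral_coord2_gauss i) -RintegralZl//; last exact: integrable_subr.
rewrite -RintegralZr// -RintegralD//; last 2 first.
- exact/integrable_scaler/integrable_subr.
- have := integrable_scaler (partial i phi x) mom.
  by apply: eq_integrable => // w _ /=; rewrite mulrC.
rewrite mulrAC -RintegralZl//; apply: normr_Rintegral_le.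
- apply: integrable_addr; first exact/integrable_scaler/integrable_subr.
  have := integrable_scaler (partial i phi x) mom.
  by apply: eq_integrable => // w _ /=; rewrite mulrC.
- exact: integrable_scaler.
move=> w; have [c hc e] := line_MVT (y w) (r^-1 * w ord0 i) (fun y => @smooth_derivable _ _ _ sphi i y).
rewrite -mulrBl -(opprB (phi (y0 w))) {1}/y0 e.
have -> : r * (- (r^-1 * w ord0 i * partial i phi (y w + c *: 'e_i)) * (w ord0 i * gauss 1 w)) +
    w ord0 i ^+ 2 * gauss 1 w * partial i phi x =
    - (w ord0 i ^+ 2 * gauss 1 w) * (partial i phi (y w + c *: 'e_i) - partial i phi x).
  by field; rewrite gt_eqF.
rewrite normrM normrN normrM (ger0_norm (gauss_ge0 _ _)) normrX.
have h1 : `|w ord0 i| ^+ 2 <= enorm w ^+ 2 by rewrite lerXn2r ?nnegrE ?enorm_ge0// coord_le_enorm.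
have h2 : `|partial i phi (y w + c *: 'e_i) - partial i phi x| <= M * (2 * r^-1 * enorm w).
  have := hM x (- (r^-1 *: w) + c *: 'e_i); rewrite addrA => h; apply: (le_trans h).
  rewrite ler_wpM2l// (le_trans (enormD _ _))// enormN !enormZ (gtr0_norm ri0).
  have ei : enorm ('e_i : 'rV[R]_d) <= 1.
    apply: enorm_le => //; rewrite expr1n (bigD1 i)//= mxE !eqxx expr1n big1 ?addr0// => j ji.
    by rewrite mxE (negbTE ji) expr0n.
  have : `|c| * enorm ('e_i : 'rV[R]_d) <= r^-1 * enorm w.
    rewrite -[leRHS]mulr1 ler_pM ?enorm_ge0// (le_trans hc)// normrM (gtr0_norm ri0).
    by rewrite ler_wpM2l ?(ltW ri0)// coord_le_enorm.
  by lra.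
have h3 : enorm w * gauss 1 w <= gauss 2^-1 w.
  have -> : gauss 1 w = gauss 2^-1 w * gauss 2^-1 w by rewrite /gauss -expRD; congr expR; lra.
  rewrite mulrA ler_piMl ?gauss_ge0// /gauss expRN ler_pdivrMr ?expR_gt0// mul1r.
  have := expR_ge1Dx (2^-1 * enorm w ^+ 2); have := sqr_ge0 (enorm w - 1).
  by rewrite sqrrB; lra.
apply: (le_trans (ler_pM _ _ (ler_wpM2r (gauss_ge0 1 w) h1) h2)); rewrite ?mulr_ge0 ?gauss_ge0 ?exprn_ge0//.
rewrite [leLHS](_ : _ = 2 * M * r^-1 * (enorm w ^+ 2 * (enorm w * gauss 1 w))); last by ring.
rewrite ler_wpM2l//; first by rewrite !mulr_ge0// ltW.
by rewrite ler_wpM2l// sqr_ge0.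
Qed.

End gaussian_quotient.

Section gaussian_convolution.
Context {R : realType} (d : nat).
Local Notation leb := (@lebesgue_rV R d).
Implicit Types (x w z v : 'rV[R]_d).
Variables (phi : 'rV[R]_d -> R) (tphi : test_function setT phi) (i : 'I_d).

Let sphi : smooth phi. Proof. by case: tphi. Qed.

Let bphi : exists2 B, 0 <= B & forall y, `|phi y| <= B. Proof. exact: test_bounded tphi. Qed.

Definition gauss_smooth (l : R) x : R := \int[leb]_z (phi (x - z) * gauss l z).

Lemma integrable_gauss_smooth (l : R) x : 0 < l ->
  leb.-integrable setT (EFin \o (fun z => phi (x - z) * gauss l z)).
Proof.
move=> l0; have [B B0 hB] := bphi.
apply: dom_integrable (integrable_scaler B (integrable_gauss d l0)).
  apply: measurable_funM; last exact: measurable_gaussT.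
  by apply: measurable_smoothT => //; exact: measurable_rVB.
by move=> z; rewrite normrM (ger0_norm (gauss_ge0 _ _)) ler_wpM2r ?gauss_ge0.
Qed.

Lemma gauss_smooth_bounded (l : R) : 0 < l -> exists2 B, 0 <= B & forall x, `|gauss_smooth l x| <= B.
Proof.
move=> l0; have [B B0 hB] := bphi.
have gi := integrable_scaler B (integrable_gauss d l0).
exists (\int[leb]_z (B * gauss l z)).
  by apply: Rintegral_ge0 => z _; rewrite mulr_ge0 ?gauss_ge0.
move=> x; apply: normr_Rintegral_le => //; first exact: integrable_gauss_smooth.
by move=> z; rewrite normrM (ger0_norm (gauss_ge0 _ _)) ler_wpM2r ?gauss_ge0.
Qed.

Lemma measurable_gauss_smoothT (l : R) dT (T : measurableType dT) (f : T -> 'rV[R]_d) :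
  measurable_fun setT f -> measurable_fun setT (fun t => gauss_smooth l (f t)).
Proof.
move=> mf; apply: (@measurable_Rintegral2 _ _ _ _ R leb (fun tz => phi (f tz.1 - tz.2) * gauss l tz.2)).
apply: measurable_funM; last exact: measurable_gaussT.
by apply: measurable_smoothT => //; apply: measurable_rVB => //; exact: measurableT_comp.
Qed.

(** The semigroup property of the Gaussians, on the weak derivative. *)
Lemma gauss_first_smooth (l h : R) x : 0 < l -> 0 < h ->
  \int[leb]_w (gauss_smooth h (x - w) * (w ord0 i * gauss l w)) =
  h / (l + h) * (l + h) `^ (- (d%:R / 2)) * gauss_mass d * gauss_first phi x i (l * h / (l + h)).
Proof.
move=> l0 h0; have lh : 0 < l + h by rewrite addr_gt0.
have [B B0 hB] := bphi.
pose f (wv : 'rV[R]_d * 'rV[R]_d) :=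
  phi (x - wv.2) * (wv.1 ord0 i * gauss l wv.1 * gauss h (wv.2 - wv.1)).
have mf : measurable_fun setT f.
  apply: measurable_funM; first by apply: measurable_smoothT => //; exact: measurable_rVB.
  apply: measurable_funM; last by apply: measurable_gaussT => //; exact: measurable_rVB.
  by apply: measurable_funM; [exact: measurable_coordT|exact: measurable_gaussT].
have gs w : leb.-integrable setT (EFin \o (fun v => gauss h (v - w))).
  by have := integrable_shift (- w) (integrable_gauss d h0).
have fi : (leb \x leb)%E.-integrable setT (EFin \o f).
  pose g (wv : 'rV[R]_d * 'rV[R]_d) := B * (enorm wv.1 * gauss l wv.1) * gauss h (wv.2 - wv.1).
  have gi : (leb \x leb)%E.-integrable setT (EFin \o g).
    apply: (@integrable_iterated_Rintegral _ _ _ _ _ leb leb g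
      (fun w => B * (h `^ (- (d%:R / 2)) * gauss_mass d) * (enorm w * gauss l w))).
    - apply: measurable_funM; last by apply: measurable_gaussT => //; exact: measurable_rVB.
      by apply: measurable_funM => //; apply: measurable_funM; [exact: measurable_enormT|exact: measurable_gaussT].
    - by move=> wv; rewrite !mulr_ge0 ?enorm_ge0 ?gauss_ge0.
    - by move=> w; exact: (integrable_scaler (B * (enorm w * gauss l w)) (gs w)).
    - exact/integrable_scaler/integrable_norm_gauss.
    - move=> w; rewrite /g/= RintegralZl// (Rintegral_shift (- w) (integrable_gauss d h0)).
      by rewrite Rintegral_gauss// le_eqVlt; apply/orP; left; apply/eqP; ring.
  apply: dom_integrable mf _ gi => -[w v]; rewrite /f /g/= !normrM !(ger0_norm (gauss_ge0 _ _)).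
  rewrite mulrA ler_wpM2r ?gauss_ge0//; apply: ler_pM => //; first by rewrite mulr_ge0 ?gauss_ge0.
  by rewrite ler_wpM2r ?gauss_ge0// coord_le_enorm.
transitivity (\int[leb]_w \int[leb]_v f (w, v)).
  apply: eq_Rintegral => w _.
  have ish := integrable_shift (- w) (integrable_gauss_smooth (x - w) h0).
  have e : \int[leb]_v (phi (x - w - (v - w)) * gauss h (v - w)) = gauss_smooth h (x - w).
    exact: (Rintegral_shift (- w) (integrable_gauss_smooth (x - w) h0)).
  rewrite -e -(RintegralZr _ measurableT ish).
  apply: eq_Rintegral => v _; rewrite /f/=.
  have -> : x - w - (v - w) = x - v by apply/rowP => j; rewrite !mxE; ring.
  ring.
rewrite (Rintegral_swap fi).
rewrite /gauss_first -RintegralZl//; last first.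
  apply: (@integrable_gauss_first R d i _ B) => //.
    by rewrite divr_gt0// mulr_gt0.
  by apply: measurable_smoothT => //; exact: measurable_rVB.
apply: eq_Rintegral => v _; rewrite /f/= RintegralZl//.
  by rewrite Rintegral_coord_gauss_conv//; ring.
apply: dom_integrable (integrable_norm_gauss d l0).
  apply: measurable_funM; last by apply: measurable_gaussT => //; exact: measurable_rVB.
  by apply: measurable_funM; [exact: measurable_coordT|exact: measurable_gaussT].
move=> w; rewrite !normrM !(ger0_norm (gauss_ge0 _ _)).
rewrite -[leRHS]mulr1 ler_pM ?mulr_ge0 ?gauss_ge0//.
  by rewrite ler_wpM2r ?gauss_ge0// coord_le_enorm.
by rewrite /gauss -expR0 ler_expR oppr_le0 mulr_ge0 ?(ltW h0)// sqr_ge0.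
Qed.

(** Second differences of [phi] against a product of Gaussians. *)
Lemma diff2_gauss (l h : R) x : 0 < l -> 0 < h ->
  \int[leb]_w ((\int[leb]_z (diff2 phi x z w * gauss h z)) * (w ord0 i * gauss l w)) =
  - (gauss_mass d * h `^ (- (d%:R / 2)) * l `^ (- (d%:R / 2) - 1) *
    (gauss_quotient phi x i l - gauss_quotient phi x i (l * h / (l + h)))).
Proof.
move=> l0 h0; have lh : 0 < l + h by rewrite addr_gt0.
have [B B0 hB] := bphi; have [B' B'0 hB'] := gauss_smooth_bounded h0.
pose N := h `^ (- (d%:R / 2)) * gauss_mass d.
have gi := integrable_gauss d h0.
have P w : \int[leb]_z (diff2 phi x z w * gauss h z) =
    (phi x * N - gauss_smooth h x) - (N * phi (x - w) - gauss_smooth h (x - w)).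
  transitivity (\int[leb]_z (((phi x - phi (x - w)) * gauss h z - phi (x - z) * gauss h z)
      + phi (x - w - z) * gauss h z)).
    by apply: eq_Rintegral => z _; rewrite /diff2 [x - w - z]addrAC; ring.
  have ii := integrable_gauss_smooth.
  rewrite RintegralD//; last 2 first.
  - by apply: integrable_subr; [exact: integrable_scaler|exact: ii].
  - exact: ii.
  rewrite RintegralB//; last 2 first.
  - exact: integrable_scaler.
  - exact: ii.
  by rewrite RintegralZl// Rintegral_gauss// /gauss_smooth -/N; ring.
under eq_Rintegral do rewrite P.
have ci := integrable_coord_gauss i l0.
have i1 : leb.-integrable setT (EFin \o (fun w => phi (x - w) * (w ord0 i * gauss l w))).
  by apply: (@integrable_gauss_first R d i _ B) => //; apply: measurable_smoothT => //; exact: measurable_rVB.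
have i2 : leb.-integrable setT (EFin \o (fun w => gauss_smooth h (x - w) * (w ord0 i * gauss l w))).
  by apply: (@integrable_gauss_first R d i _ B') => //; apply: measurable_gauss_smoothT; exact: measurable_rVB.
transitivity (\int[leb]_w ((phi x * N - gauss_smooth h x) * (w ord0 i * gauss l w) -
   (N * (phi (x - w) * (w ord0 i * gauss l w)) - gauss_smooth h (x - w) * (w ord0 i * gauss l w)))).
  by apply: eq_Rintegral => w _; ring.
rewrite RintegralB//; last 2 first.
- exact: integrable_scaler.
- by apply: integrable_subr => //; exact: integrable_scaler.
rewrite RintegralZl// Rintegral_coord_gauss// mulr0 sub0r RintegralB//; last exact: integrable_scaler.
rewrite RintegralZl// gauss_first_smooth// -/(gauss_first _ _ _ _); congr (- _).
set m := l * h / (l + h); have m0 : 0 < m by rewrite /m divr_gt0// mulr_gt0.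
rewrite /gauss_quotient mulrBr /N; congr (_ - _).
  have e : l `^ (- (d%:R / 2) - 1) * l `^ (d%:R / 2 + 1) = 1.
    rewrite -powRD ?(gt_eqF l0) ?implybT//.
    by rewrite (_ : _ + _ = 0) ?powRr0//; ring.
  by rewrite mulrA -(mulrA _ _ (l `^ (d%:R / 2 + 1))) e; ring.
have -> : m `^ (d%:R / 2 + 1) = l `^ (d%:R / 2 + 1) * h `^ (d%:R / 2 + 1) * (l + h) `^ (- (d%:R / 2 + 1)).
  rewrite /m powRM ?mulr_ge0 ?invr_ge0 ?ltW// powRM ?ltW//; congr (_ * _).
  by rewrite -[(l + h)^-1]powR_inv1 ?(ltW lh)// -powRrM mulN1r.
have e1 : l `^ (- (d%:R / 2) - 1) * l `^ (d%:R / 2 + 1) = 1.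
  rewrite -powRD ?(gt_eqF l0) ?implybT//.
  by rewrite (_ : _ + _ = 0) ?powRr0//; ring.
have e2 : h `^ (- (d%:R / 2)) * h `^ (d%:R / 2 + 1) = h.
  rewrite -powRD ?(gt_eqF h0) ?implybT//.
  have -> : - (d%:R / 2) + (d%:R / 2 + 1) = 1 :> R by ring.
  by rewrite powRr1// ltW.
have e3 : (l + h) `^ (- (d%:R / 2 + 1)) = (l + h) `^ (- (d%:R / 2)) * (l + h)^-1.
  rewrite -[(l + h)^-1]powR_inv1 ?(ltW lh)// -powRD ?(gt_eqF lh) ?implybT//; congr (_ `^ _); ring.
rewrite [RHS](_ : _ = gauss_mass d * (h `^ (- (d%:R / 2)) * h `^ (d%:R / 2 + 1)) *
  (l `^ (- (d%:R / 2) - 1) * l `^ (d%:R / 2 + 1)) * (l + h) `^ (- (d%:R / 2 + 1)) * gauss_first phi x i m); last by ring.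
by rewrite e1 e2 e3; ring.
Qed.

End gaussian_convolution.

Section inversion.
Context {R : realType} (d : nat).
Local Notation leb := (@lebesgue_rV R d).
Local Notation mu := (@lebesgue_measure R).
Implicit Types (w z v : 'rV[R]_d) (l h r : R).
Variables (s : R) (s01 : 0 < s < 1).

Let a1 : R := (d%:R + s + 1) / 2.
Let a2 : R := (d%:R + (1 - s)) / 2.
Let b : R := (1 - s) / 2.

Let s0 : 0 < s. Proof. by case/andP: s01. Qed.
Let s1 : s < 1. Proof. by case/andP: s01. Qed.
Let a10 : 0 < a1. Proof. by rewrite divr_gt0// ltr_wpDl// addr_ge0// ltW. Qed.
Let a20 : 0 < a2. Proof. by rewrite divr_gt0// ltr_wpDl// subr_gt0. Qed.
Let b01 : 0 < b < 1. Proof. by have := s01; rewrite /b => /andP[? ?]; apply/andP; split; lra. Qed.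
Let s01' : 0 < 1 - s < 1. Proof. by have := s01 => /andP[? ?]; apply/andP; split; lra. Qed.

Definition inversion_const : R :=
  gauss_mass d * gauss_moment d * (\int[mu]_t (hpow (- b) t * log_integral (1 + t))) /
  (Gamma a1 * Gamma a2).

Lemma inversion_const_gt0 : 0 < inversion_const.
Proof.
apply: divr_gt0; last by apply: mulr_gt0; exact: Gamma_gt0.
apply: mulr_gt0; last exact: Rintegral_hpow_log_gt0 b01.
by apply: mulr_gt0; [exact: gauss_mass_gt0|exact: gauss_moment_gt0].
Qed.

Lemma admissible_sker : @admissible R d (sker (1 - s)).
Proof. by split; [exact: measurable_sker|exact: integrable_min1_sker]. Qed.

Lemma admissible_vker i : @admissible R d (vker s i).
Proof. by split; [exact: measurable_vkerT|exact: integrable_min1_vker]. Qed.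

(* The Gaussian layers of the two kernels, times the bounds on second differences. *)
Let layer2 hz := min1 (enorm hz.2) * (hpow a2 hz.1 * @gauss R d hz.1 hz.2).
Let layer1 lw := (min1 (enorm lw.2) * enorm lw.2) * (hpow a1 lw.1 * @gauss R d lw.1 lw.2).

Let layer2_int : (mu \x leb)%E.-integrable setT (EFin \o layer2).
Proof.
apply: (@integrable_subordinated R d (fun z => min1 (enorm z))) => //.
- by apply: measurable_min1; exact: measurable_enormT.
- by move=> w; rewrite min1_ge0// enorm_ge0.
- by rewrite enorm0 /min1 min_r.
- have := integrable_min1_sker d s01'; apply: eq_integrable => // z _ /=.
  by rewrite (ger0_norm (sker_ge0 _ _)) skerE.
Qed.

Let layer1_int : (mu \x leb)%E.-integrable setT (EFin \o layer1).
Proof.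
apply: (@integrable_subordinated R d (fun z => min1 (enorm z) * enorm z)) => //.
- by apply: measurable_funM => //; first (by apply: measurable_min1; exact: measurable_enormT); exact: measurable_enormT.
- by move=> w; rewrite mulr_ge0 ?min1_ge0// enorm_ge0.
- by rewrite enorm0 mulr0.
- have := integrable_min1_sker d s01; apply: eq_integrable => // z _ /=.
  rewrite (ger0_norm (sker_ge0 _ _)) /sker -mulrA; congr (EFin (_ * _)).
  have [->|z0] := eqVneq z 0.
    by rewrite enorm0 mul0r powR0// oppr_eq0 gt_eqF// ltr_wpDl.
  rewrite /a1 divfK// -[X in X * _]powRr1 ?enorm_ge0// -powRD; first by congr (_ `^ _); ring.
  by rewrite (gt_eqF (enorm_gt0 z0)) implybT.
Qed.

Variables (phi : 'rV[R]_d -> R) (tphi : test_function setT phi) (x : 'rV[R]_d) (i : 'I_d).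

Let P h w := \int[leb]_z (diff2 phi x z w * (hpow a2 h * gauss h z)).
Let K h l := \int[leb]_w (P h w * w ord0 i * (hpow a1 l * gauss l w)).
Let Q h := \int[leb]_z layer2 (h, z).
Let S l := \int[leb]_w layer1 (l, w).

Let layer2_ge0 hz : 0 <= layer2 hz.
Proof. by rewrite /layer2 !mulr_ge0 ?min1_ge0 ?enorm_ge0 ?hpow_ge0 ?gauss_ge0. Qed.

Let layer1_ge0 hz : 0 <= layer1 hz.
Proof. by rewrite /layer1 !mulr_ge0 ?min1_ge0 ?enorm_ge0 ?hpow_ge0 ?gauss_ge0. Qed.

Let Q_ge0 h : 0 <= Q h. Proof. by apply: Rintegral_ge0 => z _. Qed.
Let S_ge0 l : 0 <= S l. Proof. by apply: Rintegral_ge0 => z _. Qed.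
Let Q_int : mu.-integrable setT (EFin \o Q). Proof. exact: integrable_Rintegral2 layer2_int. Qed.
Let S_int : mu.-integrable setT (EFin \o S). Proof. exact: integrable_Rintegral2 layer1_int. Qed.

Let mhg (a : R) dT (T : measurableType dT) (f : T -> R) (g : T -> 'rV[R]_d) :
  measurable_fun setT f -> measurable_fun setT g ->
  measurable_fun setT (fun t => hpow a (f t) * gauss (f t) (g t)).
Proof.
move=> mf mg; apply: measurable_funM; last exact: measurable_gaussT.
exact: (measurableT_comp (measurable_hpow a)).
Qed.

Let hpow_le0 (a : R) l : l <= 0 -> hpow a l = 0.
Proof. by move=> l0; rewrite /hpow ltNge l0. Qed.

Let layer2_sec h : leb.-integrable setT (EFin \o (fun z => layer2 (h, z))).
Proof.
have [h0|h0] := ltP 0 h; last first.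
  by apply: eq_integrable (integrable0 leb setT) => // z _; rewrite /= /layer2/= hpow_le0// mul0r mulr0.
apply: dom_integrable (integrable_scaler (hpow a2 h) (integrable_gauss d h0)).
  rewrite /layer2/=.
  by apply: measurable_funM; [apply: measurable_min1; exact: measurable_enormT|exact: mhg].
move=> z; rewrite ger0_norm// /layer2/= ler_piMl ?mulr_ge0 ?hpow_ge0 ?gauss_ge0//.
by rewrite /min1 ge_min lexx.
Qed.

Let layer1_sec l : leb.-integrable setT (EFin \o (fun z => layer1 (l, z))).
Proof.
have [l0|l0] := ltP 0 l; last first.
  by apply: eq_integrable (integrable0 leb setT) => // z _; rewrite /= /layer1/= hpow_le0// mul0r mulr0.
apply: dom_integrable (integrable_scaler (hpow a1 l) (integrable_norm_gauss d l0)).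
  rewrite /layer1/=; apply: measurable_funM; last exact: mhg.
  by apply: measurable_funM => //; first (by apply: measurable_min1; exact: measurable_enormT); exact: measurable_enormT.
move=> z; rewrite ger0_norm// /layer1/= mulrCA ler_wpM2l ?hpow_ge0// ler_wpM2r ?gauss_ge0//.
by rewrite ler_piMl ?enorm_ge0// /min1 ge_min lexx.
Qed.

Let M_ : {M | 0 <= M & forall x z w,
  `|diff2 phi x z w| <= M * (min1 (enorm z) * min1 (enorm w))}.
Proof. by apply: cid2; exact: test_second_difference tphi. Qed.

Let M := s2val M_.
Let M0 : 0 <= M. Proof. exact: (s2valP M_). Qed.
Let hM z w : `|diff2 phi x z w| <= M * (min1 (enorm z) * min1 (enorm w)).
Proof. exact: (s2valP' M_). Qed.

Let P_dom h w z : `|diff2 phi x z w * (hpow a2 h * gauss h z)| <=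
  M * min1 (enorm w) * layer2 (h, z).
Proof.
rewrite normrM (ger0_norm (mulr_ge0 (hpow_ge0 _ _) (gauss_ge0 _ _))).
rewrite /layer2/= [leRHS]mulrA ler_wpM2r ?mulr_ge0 ?hpow_ge0 ?gauss_ge0//.
by rewrite (le_trans (hM z w))// (mulrC (min1 (enorm z))) mulrA.
Qed.

Let mdiff2 dT (T : measurableType dT) (f g : T -> 'rV[R]_d) :
  measurable_fun setT f -> measurable_fun setT g ->
  measurable_fun setT (fun t => diff2 phi x (f t) (g t)).
Proof. exact: measurable_diff2T. Qed.

Let P_le h w : `|P h w| <= M * min1 (enorm w) * Q h.
Proof.
rewrite /Q -RintegralZl//; apply: normr_Rintegral_le.
- apply: dom_integrable (P_dom h w) (integrable_scaler _ (layer2_sec h)).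
  by apply: measurable_funM; [exact: mdiff2|exact: mhg].
- exact: (integrable_scaler _ (layer2_sec h)).
- exact: P_dom.
Qed.

Let measurable_P dT (T : measurableType dT) (f : T -> R) (g : T -> 'rV[R]_d) :
  measurable_fun setT f -> measurable_fun setT g ->
  measurable_fun setT (fun t => P (f t) (g t)).
Proof.
move=> mf mg; apply: (@measurable_Rintegral2 _ _ _ _ R leb (fun tz =>
  diff2 phi x tz.2 (g tz.1) * (hpow a2 (f tz.1) * gauss (f tz.1) tz.2))).
have mf' : measurable_fun setT (fun tz : T * 'rV[R]_d => f tz.1) by exact: measurableT_comp.
have mg' : measurable_fun setT (fun tz : T * 'rV[R]_d => g tz.1) by exact: measurableT_comp.
by apply: measurable_funM; [exact: mdiff2|exact: mhg].
Qed.

Let P_integral w : \int[mu]_h P h w = Gamma a2 * \int[leb]_z (diff2 phi x z w * sker (1 - s) z).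
Proof.
pose f (hz : R * 'rV[R]_d) := diff2 phi x hz.2 w * (hpow a2 hz.1 * gauss hz.1 hz.2).
have fi : (mu \x leb)%E.-integrable setT (EFin \o f).
  apply: dom_integrable (integrable_scaler (M * min1 (enorm w)) layer2_int).
    by apply: measurable_funM; [exact: mdiff2|exact: mhg].
  by move=> [h z]; exact: P_dom.
rewrite (Rintegral_swap fi) -RintegralZl//; last first.
  apply: dom_integrable (integrable_scaler (M * min1 (enorm w)) (integrable_min1_sker d s01')).
    by apply: measurable_funM; [exact: mdiff2|exact: measurable_sker].
  move=> z; rewrite normrM mulrA ler_wpM2r//.
  by rewrite (le_trans (hM z w))// mulrA mulrAC.
apply: eq_Rintegral => z _; rewrite /f/= skerE.
have [|_ ->] := @subordination R d (diff2 phi x z w) a2 z a20; last by [].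
by move=> ->; rewrite /diff2 !subr0; ring.
Qed.

Let diffop_P : Gamma a2 * diffop (vker s i) (diffop (sker (1 - s)) phi) x =
  \int[mu]_h \int[leb]_w (P h w * vker s i w).
Proof.
pose f (hw : R * 'rV[R]_d) := P hw.1 hw.2 * vker s i hw.2.
have fi : (mu \x leb)%E.-integrable setT (EFin \o f).
  apply: (@integrable_tensor_dominated _ _ _ _ R mu leb f (fun h => M * Q h)
    (fun w => min1 (enorm w) * `|vker s i w|)); last 2 first.
  - exact: integrable_scaler.
  - exact: integrable_min1_vker.
    by apply: measurable_funM; [exact: measurable_P|exact: measurable_vkerT].
  move=> h w; rewrite /f normrM [leRHS](_ : _ = M * min1 (enorm w) * Q h * `|vker s i w|); last by ring.
  by rewrite ler_wpM2r.
have [vi _] := diffop_diffop tphi x admissible_sker (admissible_vker i).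
rewrite /diffop -/(diffop _ phi) -RintegralZl// (Rintegral_swap fi).
apply: eq_Rintegral => w _; rewrite /f/=.
have hPi : mu.-integrable setT (EFin \o (fun h => P h w)).
  apply: dom_integrable (integrable_scaler (M * min1 (enorm w)) Q_int); first exact: measurable_P.
  by move=> h; exact: P_le.
rewrite RintegralZr// P_integral -(diffopB_diffop tphi x w admissible_sker).
by rewrite mulrA.
Qed.

Let K_dom h l w : `|P h w * w ord0 i * (hpow a1 l * gauss l w)| <= M * Q h * layer1 (l, w).
Proof.
rewrite !normrM (ger0_norm (hpow_ge0 _ _)) (ger0_norm (gauss_ge0 _ _)).
rewrite /layer1/= [leRHS](_ : _ = (M * min1 (enorm w) * Q h) * enorm w * (hpow a1 l * gauss l w)); last by ring.
rewrite ler_wpM2r ?mulr_ge0 ?hpow_ge0 ?gauss_ge0// ler_pM//.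
exact: coord_le_enorm.
Qed.

Let measurable_K_integrand dT (T : measurableType dT) (f g : T -> R) (w : T -> 'rV[R]_d) :
  measurable_fun setT f -> measurable_fun setT g -> measurable_fun setT w ->
  measurable_fun setT (fun t => P (f t) (w t) * w t ord0 i * (hpow a1 (g t) * gauss (g t) (w t))).
Proof.
move=> mf mg mw; apply: measurable_funM; last exact: mhg.
by apply: measurable_funM; [exact: measurable_P|exact: measurable_coordT].
Qed.

Let measurable_K dT (T : measurableType dT) (f g : T -> R) :
  measurable_fun setT f -> measurable_fun setT g -> measurable_fun setT (fun t => K (f t) (g t)).
Proof.
move=> mf mg; apply: (@measurable_Rintegral2 _ _ _ _ R leb (fun tw =>
  P (f tw.1) tw.2 * tw.2 ord0 i * (hpow a1 (g tw.1) * gauss (g tw.1) tw.2))).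
by apply: measurable_K_integrand => //; exact: measurableT_comp.
Qed.

Let K_le h l : `|K h l| <= M * Q h * S l.
Proof.
rewrite /S -RintegralZl//; apply: normr_Rintegral_le.
- apply: dom_integrable (K_dom h l) (integrable_scaler _ (layer1_sec l)).
  exact: measurable_K_integrand.
- exact: (integrable_scaler _ (layer1_sec l)).
- exact: K_dom.
Qed.

Let K_integral h : \int[mu]_l K h l = Gamma a1 * \int[leb]_w (P h w * vker s i w).
Proof.
pose f (lw : R * 'rV[R]_d) := P h lw.2 * lw.2 ord0 i * (hpow a1 lw.1 * gauss lw.1 lw.2).
have fi : (mu \x leb)%E.-integrable setT (EFin \o f).
  apply: dom_integrable (integrable_scaler (M * Q h) layer1_int).
    exact: measurable_K_integrand.
  by move=> [l w]; exact: K_dom.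
rewrite (Rintegral_swap fi) -RintegralZl//; last first.
  apply: dom_integrable (integrable_scaler (M * Q h) (integrable_min1_vker i s01)).
    by apply: measurable_funM; [exact: measurable_P|exact: measurable_vkerT].
  move=> w; rewrite normrM [leRHS](_ : _ = M * min1 (enorm w) * Q h * `|vker s i w|); last by ring.
  by rewrite ler_wpM2r.
apply: eq_Rintegral => w _; rewrite /f/= vkerE ?ltr_wpDl//.
have [|_ ->] := @subordination R d (P h w * w ord0 i) a1 w a10; last by rewrite -[in LHS](mulrA (P h w)) /a1.
by move=> ->; rewrite mxE mulr0.
Qed.

(* The substitution l = h r leaves a function of h to which Frullani's formula applies. *)
Let L h r := - gauss_mass d * hpow (- b) r * (hpow 0 h *
  (gauss_quotient phi x i (h * r) - gauss_quotient phi x i (h * r / (1 + r)))).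

Let K_L h r : h * K h (h * r) = L h r.
Proof.
have [h0|h0] := ltP 0 h; last first.
  rewrite /L (hpow_le0 0 h0) mul0r mulr0 (_ : K h (h * r) = 0) ?mulr0//.
  apply/eqP; rewrite -normr_le0; apply: (le_trans (K_le _ _)).
  rewrite (_ : Q h = 0) ?mulr0 ?mul0r//.
  by rewrite /Q /Rintegral integral0_eq// => z _; rewrite /layer2/= hpow_le0// mul0r mulr0.
have [r0|r0] := ltP 0 r; last first.
  rewrite /L (hpow_le0 (- b) r0) mulr0 mul0r (_ : K h (h * r) = 0) ?mulr0//.
  apply/eqP; rewrite -normr_le0; apply: (le_trans (K_le _ _)).
  rewrite (_ : S (h * r) = 0) ?mulr0//.
  rewrite /S /Rintegral integral0_eq// => z _; rewrite /layer1/= hpow_le0 ?mul0r ?mulr0//.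
  by rewrite pmulr_rle0.
have l0 : 0 < h * r by rewrite mulr_gt0.
have lh : 0 < 1 + r by rewrite addr_gt0.
have gi w : leb.-integrable setT (EFin \o (fun z => diff2 phi x z w * gauss h z)).
  apply: dom_integrable (integrable_scaler (M * min1 (enorm w)) (integrable_gauss d h0)).
    by apply: measurable_funM; [exact: mdiff2|exact: measurable_gaussT].
  move=> z; rewrite normrM (ger0_norm (gauss_ge0 _ _)) ler_wpM2r ?gauss_ge0//.
  rewrite (le_trans (hM z w))// mulrCA ler_piMl ?mulr_ge0 ?min1_ge0 ?enorm_ge0//.
  by rewrite /min1 ge_min lexx.
have PE w : P h w = hpow a2 h * \int[leb]_z (diff2 phi x z w * gauss h z).
  by rewrite -RintegralZl//; apply: eq_Rintegral => z _; rewrite mulrCA.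
have wi : leb.-integrable setT
    (EFin \o (fun w => (\int[leb]_z (diff2 phi x z w * gauss h z)) * (w ord0 i * gauss (h * r) w))).
  have i0 : leb.-integrable setT (EFin \o (fun w => P h w * w ord0 i * (hpow a1 (h * r) * gauss (h * r) w))).
    apply: dom_integrable (K_dom h (h * r)) (integrable_scaler _ (layer1_sec (h * r))).
    exact: measurable_K_integrand.
  have := integrable_scaler ((hpow a2 h)^-1 * (hpow a1 (h * r))^-1) i0.
  have n1 : hpow a2 h != 0 by rewrite /hpow h0 gt_eqF// powR_gt0.
  have n2 : hpow a1 (h * r) != 0 by rewrite /hpow l0 gt_eqF// powR_gt0.
  apply: eq_integrable => // w _ /=; congr EFin; rewrite PE /cst; field.
  by rewrite n1 n2.
have KE : K h (h * r) = hpow a2 h * hpow a1 (h * r) *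
    \int[leb]_w ((\int[leb]_z (diff2 phi x z w * gauss h z)) * (w ord0 i * gauss (h * r) w)).
  by rewrite -RintegralZl//; apply: eq_Rintegral => w _; rewrite PE; ring.
rewrite KE (diff2_gauss tphi i x l0 h0) /L.
have -> : h * r * h / (h * r + h) = h * r / (1 + r).
  have hr : h * r + h != 0 by rewrite gt_eqF// addr_gt0.
  by field; rewrite hr gt_eqF.
set G := gauss_quotient phi x i (h * r) - _.
rewrite [LHS](_ : _ = - gauss_mass d * (h * hpow a2 h * h `^ (- (d%:R / 2)) *
  (hpow a1 (h * r) * (h * r) `^ (- (d%:R / 2) - 1))) * G); last by ring.
rewrite [RHS](_ : _ = - gauss_mass d * (hpow (- b) r * hpow 0 h) * G); last by ring.
congr (_ * _ * _).
have e1 : hpow a1 (h * r) * (h * r) `^ (- (d%:R / 2) - 1) = h `^ (- b - 1) * r `^ (- b - 1).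
  rewrite /hpow l0 -powRD ?(gt_eqF l0) ?implybT// -powRM ?(ltW h0) ?(ltW r0)//.
  by congr (_ `^ _); rewrite /a1 /b; lra.
have e2 : h * hpow a2 h * h `^ (- (d%:R / 2)) = h `^ b.
  rewrite /hpow h0 -[X in X * _ * _]powRr1 ?(ltW h0)// -!powRD ?(gt_eqF h0) ?implybT//.
  by congr (_ `^ _); rewrite /a2 /b; lra.
rewrite e1 e2 mulrA -powRD ?(gt_eqF h0) ?implybT// /hpow h0 r0 mulrC; congr (_ * _ `^ _).
by lra.
Qed.

Let measurable_L : measurable_fun setT (fun hr => L hr.1 hr.2).
Proof.
have E : (fun hr => L hr.1 hr.2) = (fun hr => hr.1 * K hr.1 (hr.1 * hr.2)).
  by apply/funext => hr; rewrite K_L.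
rewrite E; apply: measurable_funM => //; apply: measurable_K => //.
exact: measurable_funM.
Qed.

Let measurable_L' : measurable_fun [set: measurableTypeR R * measurableTypeR R] (fun hr => L hr.1 hr.2).
Proof. exact: measurable_L. Qed.

Let K_sec h : mu.-integrable setT (EFin \o K h).
Proof.
by apply: dom_integrable (integrable_scaler (M * Q h) S_int); [exact: measurable_K|exact: K_le].
Qed.

Let L_int : (mu \x mu)%E.-integrable setT (EFin \o (fun hr => L hr.1 hr.2)).
Proof.
have Lz h : h <= 0 -> forall r, L h r = 0.
  by move=> h0 r; rewrite /L (hpow_le0 0 h0) mul0r mulr0.
have Lsec h : mu.-integrable setT (EFin \o (fun r => `|L h r|)).
  have [h0|h0] := ltP 0 h; last first.
    by apply: eq_integrable (integrable0 mu setT) => // r _; rewrite /= Lz// normr0.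
  have [ki _] := Rintegral_dilateZ h0 (K_sec h).
  apply: integrable_normr; apply: eq_integrable ki => // r _.
  by rewrite /= K_L.
have mL : measurable_fun setT (fun hr => `|L hr.1 hr.2|) by exact: measurableT_comp.
have : (mu \x mu)%E.-integrable setT (EFin \o (fun hr => `|L hr.1 hr.2|)).
  apply: (@integrable_iterated_Rintegral _ _ _ _ _ mu mu _ (fun h => (M * \int[mu]_l S l) * Q h)) => //.
    exact: (integrable_scaler (M * \int[mu]_l S l) Q_int).
  move=> h /=; have [h0|h0] := ltP 0 h; last first.
    rewrite /Rintegral integral0_eq => [|r _]; last by rewrite Lz// normr0.
    by rewrite !mulr_ge0//; apply: Rintegral_ge0.
  have nK := integrable_normr (K_sec h).
  have -> : \int[mu]_r `|L h r| = \int[mu]_l `|K h l|.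
    have [_ ->] := Rintegral_dilateZ h0 nK.
    by apply: eq_Rintegral => r _; rewrite -K_L normrM (gtr0_norm h0).
  rewrite mulrAC -(RintegralZl _ measurableT S_int); apply: le_Rintegral => //.
  exact: (integrable_scaler (M * Q h) S_int).
by apply: dom_integrable => //; exact: measurable_L'.
Qed.

Let L_integral r : \int[mu]_h L h r =
  gauss_mass d * gauss_moment d * partial i phi x * (hpow (- b) r * log_integral (1 + r)).
Proof.
have [r0|r0] := ltP 0 r; last first.
  rewrite (hpow_le0 (- b) r0) mul0r mulr0 /Rintegral integral0_eq// => h _.
  by rewrite /L (hpow_le0 (- b) r0) mulr0 mul0r.
have [C1 C10 h1] := gauss_quotient_le tphi x i.
have [C2 C20 h2] := gauss_quotient_cvg tphi x i.
have r1 : 1 < 1 + r by rewrite ltrDl.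
pose f h := hpow 0 h * (gauss_quotient phi x i (h * r) - gauss_quotient phi x i (h * r / (1 + r))).
have [fi fe] : mu.-integrable setT (EFin \o f) /\ \int[mu]_h f h =
    - gauss_moment d * partial i phi x * log_integral (1 + r).
  apply: (@frullani_dilated R _ _ (C1 + C2)) => //.
  - exact: measurable_gauss_quotient.
  - by rewrite addr_ge0.
  - by move=> t t0; rewrite (le_trans (h1 t t0))// ler_wpM2r ?powR_ge0// lerDl.
  - by move=> t t0; rewrite (le_trans (h2 t t0))// ler_wpM2r ?powR_ge0// lerDr.
rewrite [LHS](_ : _ = \int[mu]_h (- gauss_mass d * hpow (- b) r * f h)); last by [].
rewrite (RintegralZl _ measurableT fi) fe; ring.
Qed.

(** The Riesz fractional gradient of order [s] inverts the fractional Laplacian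
    of order [1 - s], up to a positive constant and one derivative. *)
Lemma diffop_vker_sker :
  diffop (vker s i) (diffop (sker (1 - s)) phi) x = inversion_const * partial i phi x.
Proof.
have g1 := Gamma_gt0 a10; have g2 := Gamma_gt0 a20.
apply: (@mulfI _ (Gamma a1 * Gamma a2)); first by rewrite gt_eqF// mulr_gt0.
rewrite -mulrA diffop_P.
have e h : Gamma a1 * (\int[leb]_w (P h w * vker s i w)) = \int[mu]_r L h r.
  rewrite -K_integral; have [h0|h0] := ltP 0 h.
    have [_ ->] := Rintegral_dilateZ h0 (K_sec h).
    by apply: eq_Rintegral => r _; rewrite K_L.
  rewrite /Rintegral !integral0_eq// => r _; first by rewrite /L (hpow_le0 0 h0) mul0r mulr0.
  congr EFin; apply/eqP; rewrite -normr_le0; apply: (le_trans (K_le _ _)).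
  rewrite (_ : Q h = 0) ?mulr0 ?mul0r//.
  by rewrite /Q /Rintegral integral0_eq// => z _; rewrite /layer2/= hpow_le0// mul0r mulr0.
rewrite -RintegralZl//; last first.
  have := integrable_scaler (Gamma a1)^-1 (integrable_Rintegral2 L_int).
  by apply: eq_integrable => // h _ /=; rewrite -e mulKf// gt_eqF.
under eq_Rintegral do rewrite e.
rewrite (Rintegral_swap L_int).
under eq_Rintegral do rewrite L_integral.
rewrite RintegralZl//; last exact: integrable_hpow_log.
rewrite /inversion_const.
by field; rewrite !gt_eqF.
Qed.

End inversion.

Section decay.
Context {R : realType} (d : nat).
Local Notation leb := (@lebesgue_rV R d).
Implicit Types (x y w z : 'rV[R]_d) (f : 'rV[R]_d -> R).
Variables (s : R) (s01 : 0 < s < 1).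

Let m : R := d%:R + (1 - s).
Let s01' : 0 < 1 - s < 1. Proof. by have := s01 => /andP[? ?]; apply/andP; split; lra. Qed.
Let s0 : 0 < s. Proof. by case/andP: s01. Qed.
Let m0 : 0 < m. Proof. by rewrite ltr_wpDl//; case/andP: s01'. Qed.

(** The decay at infinity of the fractional gradient of an integrable function. *)
Definition fdecay x : R := enorm1 x `^ (- (d%:R + (1 - s))) + enorm1 x `^ (- (d%:R + s)).

Lemma fdecay_ge0 x : 0 <= fdecay x. Proof. by rewrite addr_ge0 ?powR_ge0. Qed.

Lemma integrable_fdecay : leb.-integrable setT (EFin \o fdecay).
Proof. by apply: integrable_addr; exact: integrable_enorm1. Qed.

Lemma powR_le1 (a r : R) : 1 <= a -> 0 <= r -> a `^ (- r) <= 1.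
Proof. by move=> a1 r0; rewrite -(powRr0 a) ler_powR// oppr_le0. Qed.

Lemma fdecay_le2 x : fdecay x <= 2.
Proof.
have h1 := powR_le1 (enorm1_ge1 x) (ltW m0).
have h2 : enorm1 x `^ (- (d%:R + s)) <= 1.
  by apply: powR_le1; [exact: enorm1_ge1|rewrite addr_ge0// ltW].
by rewrite /fdecay; move: h1; rewrite /m; lra.
Qed.

(** [f] decays like |x|^(-m) and its increments like those of |x|^(-m). *)
Definition decaying f (C : R) := [/\ measurable_fun setT f,
  forall x, `|f x| <= C * enorm1 x `^ (- m) &
  forall x w, enorm w <= enorm1 x / 2 ->
    `|f x - f (x - w)| <= C * (enorm w * enorm1 x `^ (- m - 1))].

Lemma decaying_integrable f C : decaying f C -> leb.-integrable setT (EFin \o f).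
Proof.
move=> [mf fC _]; apply: dom_integrable mf fC _.
exact/integrable_scaler/integrable_enorm1.
Qed.

Let decaying_pointwise f C x w i : 0 <= C -> decaying f C ->
  `|(f x - f (x - w)) * vker s i w| <=
  2 * C * enorm1 x `^ (- m) * (min1 (enorm w) * `|sker s w|) +
  2 `^ (d%:R + s) * enorm1 x `^ (- (d%:R + s)) * `|f (x - w)|.
Proof.
move=> C0 [_ fC fD]; set r := enorm1 x; have r1 : 1 <= r := enorm1_ge1 x.
have r0 : 0 < r by apply: lt_le_trans r1.
have w0 := enorm_ge0 w.
rewrite normrM (ger0_norm (sker_ge0 s w)).
have vs := vker_le s i w; have sk0 := sker_ge0 s w.
apply: (@le_trans _ _ (`|f x - f (x - w)| * sker s w)); first by rewrite ler_wpM2l.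
have e1 : r `^ (- m - 1) = r `^ (- m) * r^-1.
  by rewrite -[r^-1]powR_inv1 ?(ltW r0)// -powRD// (gt_eqF r0) implybT.
have p0 : 0 <= r `^ (- m) by exact: powR_ge0.
have [wr|wr] := leP (enorm w) (r / 2).
  rewrite ler_wpDr ?mulr_ge0 ?powR_ge0// mulrA ler_wpM2r//.
  have k : enorm w * r^-1 <= 2 * min1 (enorm w).
    rewrite ler_pdivrMr// /min1; case: (leP 1 (enorm w)) => w1; first by lra.
    have : enorm w * 1 <= enorm w * r by rewrite ler_wpM2l.
    by lra.
  rewrite (le_trans (fD x w wr))// -/r e1.
  rewrite [leLHS](_ : _ = C * r `^ (- m) * (enorm w * r^-1)); last by ring.
  rewrite [leRHS](_ : _ = C * r `^ (- m) * (2 * min1 (enorm w))); last by ring.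
  by rewrite ler_wpM2l// mulr_ge0.
have mw : 2^-1 <= min1 (enorm w).
  by rewrite /min1 le_min; apply/andP; split; lra.
apply: (@le_trans _ _ (`|f x| * sker s w + `|f (x - w)| * sker s w)).
  by rewrite -mulrDl ler_wpM2r//; exact: ler_normB.
apply: lerD.
  rewrite mulrA ler_wpM2r// (le_trans (fC x))// -/r.
  rewrite [leRHS](_ : _ = C * r `^ (- m) * (2 * min1 (enorm w))); last by ring.
  by rewrite ler_peMr ?mulr_ge0//; lra.
rewrite mulrC ler_wpM2r// /sker.
have r20 : 0 < r / 2 by rewrite divr_gt0.
apply: (@le_trans _ _ ((r / 2) `^ (- (d%:R + s)))).
  rewrite !powRN lef_pV2 ?posrE ?powR_gt0//; last exact: lt_trans wr.
  by rewrite ge0_ler_powR ?nnegrE ?addr_ge0 ?(ltW s0) ?(ltW r20) ?(ltW wr).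
rewrite powRM ?(ltW r0)// mulrC -[2^-1]powR_inv1// -powRrM mulrN mulN1r opprK.
exact: lexx.
Qed.

Lemma decaying_fgrad f C i : 0 <= C -> decaying f C ->
  (forall x, leb.-integrable setT (EFin \o (fun w => (f x - f (x - w)) * vker s i w))) /\
  exists2 C', 0 <= C' & forall x, `|diffop (vker s i) f x| <= C' * fdecay x.
Proof.
move=> C0 df; have fi := decaying_integrable df; have [mf fC fD] := df.
have nfi := integrable_normr fi.
pose W := \int[leb]_w (min1 (enorm w) * `|sker s w|).
have ki := integrable_min1_sker d s01.
have W0 : 0 <= W by apply: Rintegral_ge0 => w _; rewrite mulr_ge0 ?min1_ge0 ?enorm_ge0.
pose F := \int[leb]_w `|f w|.
have F0 : 0 <= F by apply: Rintegral_ge0.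
have gi x := integrable_addr (integrable_scaler (2 * C * enorm1 x `^ (- m)) ki)
  (integrable_scaler (2 `^ (d%:R + s) * enorm1 x `^ (- (d%:R + s))) (integrable_subl x nfi)).
have di x : leb.-integrable setT (EFin \o (fun w => (f x - f (x - w)) * vker s i w)).
  apply: dom_integrable (gi x); last by move=> w; exact: decaying_pointwise.
  apply: measurable_funM; last exact: measurable_vkerT.
  apply: measurable_funB => //; apply: (measurableT_comp mf); exact: measurable_rVB.
split => //; exists (2 * C * W + 2 `^ (d%:R + s) * F).
  by rewrite addr_ge0 ?mulr_ge0 ?powR_ge0.
move=> x; apply: (@le_trans _ _ (2 * C * enorm1 x `^ (- m) * W +
    2 `^ (d%:R + s) * enorm1 x `^ (- (d%:R + s)) * F)).
  apply: (le_trans (normr_Rintegral_le (di x) (gi x) (fun w => @decaying_pointwise f C x w i C0 df))).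
  rewrite RintegralD//; last 2 first.
  - exact: integrable_scaler.
  - exact: (integrable_scaler _ (integrable_subl x nfi)).
  by rewrite RintegralZl// (RintegralZl _ measurableT (integrable_subl x nfi)) (Rintegral_subl x nfi).
rewrite /fdecay mulrDr -/m.
set A := 2 * C * W; set B := 2 `^ (d%:R + s) * F.
have A0 : 0 <= A by rewrite /A !mulr_ge0.
have B0 : 0 <= B by rewrite /B mulr_ge0 ?powR_ge0.
have p1 := powR_ge0 (enorm1 x) (- m); have p2 := powR_ge0 (enorm1 x) (- (d%:R + s)).
rewrite (_ : 2 * C * _ * W = A * enorm1 x `^ (- m)); last by rewrite /A; ring.
rewrite (_ : _ * _ * F = B * enorm1 x `^ (- (d%:R + s))); last by rewrite /B; ring.
by apply: lerD; rewrite ler_wpM2r// ?lerDl ?lerDr.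
Qed.

Lemma enorm1_subl x y : enorm1 x <= (1 + enorm y) * enorm1 (x - y).
Proof.
have h1 := enorm1_ge1 (x - y); have y0 := enorm_ge0 y.
have h2 : enorm (x - y) <= enorm1 (x - y) by rewrite /enorm1 le_max lexx orbT.
have h3 := enormD (x - y) y; rewrite subrK in h3.
have h4 : enorm y * 1 <= enorm y * enorm1 (x - y) by rewrite ler_wpM2l.
by rewrite {1}/enorm1 ge_max mulrDl mul1r; apply/andP; split; lra.
Qed.

Lemma fdecay_translate (rho : R) : 0 <= rho -> exists2 C, 0 <= C &
  forall x y, enorm y <= rho -> fdecay (x - y) <= C * fdecay x.
Proof.
move=> rho0; have r1 : 1 <= 1 + rho by rewrite lerDl.
have r0 : 0 < 1 + rho by apply: lt_le_trans r1.
have key (a : R) x y : 0 <= a -> enorm y <= rho ->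
    enorm1 (x - y) `^ (- a) <= (1 + rho) `^ a * enorm1 x `^ (- a).
  move=> a0 yr; rewrite !powRN ler_pdivlMr ?powR_gt0 ?enorm1_gt0//.
  rewrite mulrC ler_pdivrMr ?powR_gt0 ?enorm1_gt0//.
  rewrite -powRM ?(ltW r0) ?(ltW (enorm1_gt0 _))//.
  rewrite ge0_ler_powR ?nnegrE ?mulr_ge0 ?(ltW r0) ?(ltW (enorm1_gt0 _))//.
  rewrite (le_trans (enorm1_subl x y))// ler_wpM2r ?lerD2l//.
  exact: ltW (enorm1_gt0 _).
exists ((1 + rho) `^ m + (1 + rho) `^ (d%:R + s)); first by rewrite addr_ge0 ?powR_ge0.
move=> x y yr; rewrite /fdecay mulrDr; apply: lerD.
  rewrite (le_trans (key _ x y (ltW m0) yr))// ler_wpM2r ?powR_ge0//.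
  by rewrite lerDl powR_ge0.
rewrite (le_trans (key (d%:R + s) x y _ yr)) ?addr_ge0 ?(ltW s0)//.
by rewrite ler_wpM2r ?powR_ge0// lerDr powR_ge0.
Qed.

Lemma test_supp_bounded (phi : 'rV[R]_d -> R) : test_function setT phi ->
  exists2 rho, 0 <= rho & forall y, supp phi y -> enorm y <= rho.
Proof.
move=> [_ /compact_bounded[M [Mr hM]] _].
pose M' := Num.max 0 (M + 1); have M'0 : 0 <= M' by rewrite /M' le_max lexx.
exists (d%:R * M'); first by rewrite mulr_ge0.
move=> y ys; rewrite (le_trans (enorm_le_norm y))// ler_wpM2l//.
by apply: hM ys; rewrite /M' lt_max ltrDl ltr01 orbT.
Qed.

Lemma test_decaying (phi : 'rV[R]_d -> R) : test_function setT phi ->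
  exists2 C, 0 <= C & decaying phi C.
Proof.
move=> tphi; have sphi : smooth phi by case: tphi.
have [rho rho0 hrho] := test_supp_bounded tphi.
have [B B0 hB] := test_bounded tphi.
have [M M0 hM] := test_min1_lipschitz tphi.
pose r := 2 * (1 + rho); have r0 : 0 < r by rewrite mulr_gt0// ltr_wpDr.
have far x : r < enorm1 x -> 1 + rho < enorm x /\ 2 * rho < enorm x.
  rewrite /enorm1 /r lt_max => /orP[|]; first by lra.
  by move=> h; split; lra.
exists (B * r `^ m + M * r `^ (m + 1)); first by rewrite addr_ge0 ?mulr_ge0 ?powR_ge0.
have inv (a : R) x : 0 <= a -> enorm1 x <= r -> 1 <= r `^ a * enorm1 x `^ (- a).
  move=> a0 xr; rewrite powRN ler_pdivlMr ?powR_gt0 ?enorm1_gt0// mul1r.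
  by rewrite ge0_ler_powR ?nnegrE ?(ltW (enorm1_gt0 _)) ?(ltW r0).
split; first exact: measurable_smooth.
- move=> x; have [xr|/far[x1 _]] := leP (enorm1 x) r.
    rewrite mulrDl ler_wpDr ?mulr_ge0 ?powR_ge0// (le_trans (hB x))// -mulrA ler_peMr//.
    exact: inv (ltW m0) xr.
  rewrite supp_notin ?normr0 ?mulr_ge0 ?addr_ge0 ?mulr_ge0 ?powR_ge0// => /hrho; lra.
- move=> x w wr; have [xr|xr] := leP (enorm1 x) r.
    rewrite mulrDl ler_wpDl ?mulr_ge0 ?enorm_ge0 ?powR_ge0//.
    rewrite (le_trans (hM x w))// -mulrA ler_wpM2l// mulrCA.
    apply: (@le_trans _ _ (enorm w)); first by rewrite /min1 ge_min lexx orbT.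
    rewrite ler_peMr ?enorm_ge0// -opprD; apply: inv => //; exact: addr_ge0 (ltW m0) ler01.
  have [x1 x2] := far _ xr.
  have ex : enorm1 x = enorm x by rewrite /enorm1; apply: max_r; lra.
  have h := enormD (x - w) w; rewrite subrK in h; rewrite ex in wr.
  rewrite supp_notin; last by move=> /hrho; lra.
  rewrite supp_notin; last by move=> /hrho; lra.
  by rewrite subrr normr0 !mulr_ge0 ?enorm_ge0 ?addr_ge0 ?mulr_ge0 ?powR_ge0.
Qed.

End decay.

Section regularized_kernel.
Context {R : realType} (d : nat).
Local Notation leb := (@lebesgue_rV R d).
Implicit Types (x y w z : 'rV[R]_d).
Variables (s : R) (s01 : 0 < s < 1) (e : R) (e01 : 0 < e <= 1).

Let m : R := d%:R + (1 - s).
Let s01' : 0 < 1 - s < 1. Proof. by have := s01 => /andP[? ?]; apply/andP; split; lra. Qed.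
Let m0 : 0 < m. Proof. by rewrite ltr_wpDl//; case/andP: s01'. Qed.
Let e0 : 0 < e. Proof. by case/andP: e01. Qed.

(** The kernel of the fractional Laplacian, made bounded and Lipschitz by a
    truncation that does not change it away from the ball of radius [e]. *)
Definition reg_ker z : R := Num.max (enorm z) e `^ (- (d%:R + (1 - s))).

Let mx z : R := Num.max (enorm z) e.

Let mx_gt0 z : 0 < mx z. Proof. by rewrite /mx lt_max e0 orbT. Qed.

Lemma reg_ker_far z : e <= enorm z -> sker (1 - s) z - reg_ker z = 0.
Proof. by move=> ez; rewrite /reg_ker max_l// /sker subrr. Qed.

Lemma measurable_reg_kerT dT (T : measurableType dT) (f : T -> 'rV[R]_d) :
  measurable_fun setT f -> measurable_fun setT (fun t => reg_ker (f t)).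
Proof.
move=> mf; apply: measurable_powRT; apply: measurable_maxr => //.
exact: measurable_enormT.
Qed.

Lemma reg_ker_ge0 z : 0 <= reg_ker z. Proof. exact: powR_ge0. Qed.

Lemma continuous_reg_ker : continuous reg_ker.
Proof.
move=> z.
have c1 : {for z, continuous (fun z : 'rV[R]_d => Num.max (enorm z) e)}.
  by apply: continuous_max; [exact: continuous_enorm|exact: cst_continuous].
have c2 : {for mx z, continuous (fun t : R => t `^ (- (d%:R + (1 - s))))}.
  apply: differentiable_continuous; apply/derivable1_diffP.
  by apply: derivable_powR; rewrite in_itv/= andbT; exact: mx_gt0.
exact: (continuous_comp c1 c2).
Qed.

(* The mean value inequality for t^(-m), from 1 - t <= exp(-t). *)
Let powR_lip (a b : R) : 0 < a -> a <= b -> a `^ (- m) - b `^ (- m) <= m * (b - a) * a `^ (- m - 1).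
Proof.
move=> a0 ab; have b0 : 0 < b by apply: lt_le_trans ab.
have -> : a `^ (- m - 1) = a `^ (- m) * a^-1.
  by rewrite -[a^-1]powR_inv1 ?(ltW a0)// -powRD// (gt_eqF a0) implybT.
have -> : b `^ (- m) = a `^ (- m) * (b / a) `^ (- m).
  by rewrite -powRM ?(ltW a0) ?divr_ge0 ?(ltW b0) ?(ltW a0)// mulrC divfK// gt_eqF.
rewrite [leRHS](_ : _ = a `^ (- m) * (m * ((b - a) / a))); last by ring.
rewrite -[X in X - _]mulr1 -mulrBr ler_wpM2l ?powR_ge0//.
have ba0 : 0 < b / a by rewrite divr_gt0.
have h : ln (b / a) <= (b - a) / a.
  have := @le_ln1Dx R ((b - a) / a); rewrite mulrBl divff ?gt_eqF// [1 + _]addrC subrK; apply.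
  by rewrite ltrBrDr addNr.
rewrite /powR gt_eqF// mulNr; have := expR_ge1Dx (- (m * ln (b / a))).
have : m * ln (b / a) <= m * ((b - a) / a) by rewrite ler_wpM2l// ltW.
lra.
Qed.

Lemma reg_ker_dist x y (c : R) : 0 < c -> c <= mx x -> c <= mx y ->
  `|reg_ker x - reg_ker y| <= m * (enorm (x - y) * c `^ (- m - 1)).
Proof.
move=> c0 cx cy; have md z w : mx z - mx w <= enorm (z - w).
  have h := enorm_dist z w; have h0 := enorm_ge0 (z - w); rewrite ler_norml in h; case/andP: h => _ h.
  rewrite lerBlDr /mx ge_max; apply/andP; split.
    rewrite -lerBlDr (le_trans _ h)// lerB// le_max lexx//.
  by rewrite ler_wpDl// le_max lexx orbT.
have key z w : c <= mx z -> mx z <= mx w -> reg_ker z - reg_ker w <= m * (enorm (w - z) * c `^ (- m - 1)).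
  move=> cz zw; apply: (le_trans (powR_lip (mx_gt0 z) zw)).
  rewrite -mulrA ler_wpM2l ?(ltW m0)// ler_pM ?subr_ge0 ?powR_ge0 ?md//.
  rewrite -opprD !powRN lef_pV2 ?posrE ?powR_gt0 ?mx_gt0//.
  have m1 : 0 <= m + 1 by rewrite addr_ge0 ?(ltW m0).
  apply: ge0_ler_powR => //; rewrite nnegrE ?(ltW c0) ?(ltW (mx_gt0 _))//.
have anti z w : mx z <= mx w -> reg_ker w <= reg_ker z.
  move=> zw; rewrite /reg_ker !powRN lef_pV2 ?posrE ?powR_gt0 ?mx_gt0//.
  by rewrite ge0_ler_powR ?nnegrE ?(ltW m0) ?(ltW (mx_gt0 _)).
have [xy|yx] := leP (mx x) (mx y).
  have h := anti _ _ xy; rewrite ger0_norm ?subr_ge0// enormB.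
  exact: (key _ _ cx xy).
have h := anti _ _ (ltW yx); rewrite distrC ger0_norm ?subr_ge0//.
exact: (key _ _ cy (ltW yx)).
Qed.

Let mx_enorm1 x : e * enorm1 x <= mx x.
Proof.
rewrite /enorm1 /mx; case/andP: e01 => _ e1; case: (leP 1 (enorm x)) => x1.
  by rewrite le_max; apply/orP; left; rewrite ler_piMl ?enorm_ge0.
by rewrite mulr1 le_max lexx orbT.
Qed.

Lemma reg_ker_decaying : exists2 C, 0 <= C & @decaying R d s reg_ker C.
Proof.
pose C := e `^ (- m) + m * (e / 2) `^ (- m - 1).
have e20 : 0 < e / 2 by rewrite divr_gt0.
have C0 : 0 <= C by rewrite addr_ge0 ?mulr_ge0 ?powR_ge0 ?(ltW m0).
exists C => //; split; first exact: measurable_reg_kerT.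
- move=> x; rewrite ger0_norm ?reg_ker_ge0// /C mulrDl ler_wpDr ?mulr_ge0 ?powR_ge0 ?(ltW m0)//.
  rewrite -powRM ?(ltW e0) ?(ltW (enorm1_gt0 _))// /reg_ker !powRN.
  rewrite lef_pV2 ?posrE ?powR_gt0 ?mx_gt0 ?mulr_gt0 ?enorm1_gt0//.
  by rewrite ge0_ler_powR ?nnegrE ?(ltW m0) ?(ltW (mx_gt0 _)) ?mulr_ge0 ?(ltW e0) ?(ltW (enorm1_gt0 _))// mx_enorm1.
- move=> x w wx; have x1 := enorm1_ge1 x; have x0 := enorm1_gt0 x.
  pose c := e / 2 * enorm1 x; have c0 : 0 < c by rewrite mulr_gt0.
  have half : enorm1 x / 2 <= enorm1 (x - w).
    have h := enormD (x - w) w; rewrite subrK in h.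
    rewrite {2}/enorm1 le_max; have [x2|x2] := leP (enorm1 x / 2) 1 => //=.
    have ex : enorm1 x = enorm x by rewrite /enorm1; apply: max_r; move: x2; rewrite /enorm1; case: (leP 1 (enorm x)); lra.
    by move: wx; rewrite ex; lra.
  have cx : c <= mx x.
    by rewrite (le_trans _ (mx_enorm1 x))// /c ler_wpM2r ?(ltW x0)// ler_pdivrMr//; lra.
  have cw : c <= mx (x - w).
    by rewrite (le_trans _ (mx_enorm1 (x - w)))// /c -mulrA ler_wpM2l ?(ltW e0)// mulrC.
  have := reg_ker_dist c0 cx cw; rewrite subKr => h; apply: (le_trans h).
  rewrite /c powRM ?(ltW e20) ?(ltW x0)//.
  rewrite [leLHS](_ : _ = m * (e / 2) `^ (- m - 1) * (enorm w * enorm1 x `^ (- m - 1))); last by ring.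
  by rewrite ler_wpM2r ?mulr_ge0 ?enorm_ge0 ?powR_ge0// lerDr powR_ge0.
Qed.

Lemma reg_ker_min1 : exists2 C, 0 <= C & forall x w, `|reg_ker x - reg_ker (x - w)| <= C * min1 (enorm w).
Proof.
pose C := m * e `^ (- m - 1) + e `^ (- m).
have C0 : 0 <= C by rewrite addr_ge0 ?mulr_ge0 ?powR_ge0 ?(ltW m0).
have re z : reg_ker z <= e `^ (- m).
  rewrite /reg_ker !powRN lef_pV2 ?posrE ?powR_gt0 ?mx_gt0//.
  by rewrite ge0_ler_powR ?nnegrE ?(ltW m0) ?(ltW (mx_gt0 _)) ?(ltW e0)// le_max lexx orbT.
exists C => // x w; rewrite /min1; case: (leP 1 (enorm w)) => w1.
  rewrite mulr1 /C ler_wpDl ?mulr_ge0 ?powR_ge0 ?(ltW m0)//.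
  have := re x; have := re (x - w); have := reg_ker_ge0 x; have := reg_ker_ge0 (x - w).
  set a := reg_ker x; set b := reg_ker _; set c := e `^ _ => *.
  by rewrite ler_norml; apply/andP; split; lra.
have h z : e <= mx z by rewrite /mx le_max lexx orbT.
have := reg_ker_dist e0 (h x) (h (x - w)); rewrite subKr => k; apply: (le_trans k).
rewrite mulrCA mulrC ler_wpM2r ?enorm_ge0// /C lerDl powR_ge0//.
Qed.

Lemma integrable_reg_ker : leb.-integrable setT (EFin \o reg_ker).
Proof. by have [C _ h] := reg_ker_decaying; exact: (decaying_integrable s01 h). Qed.

Lemma admissible_reg_ker : admissible reg_ker.
Proof.
split; first exact: measurable_reg_kerT.
apply: dom_integrable integrable_reg_ker.
  apply: measurable_funM; first by apply: measurable_min1; exact: measurable_enormT.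
  by apply: measurableT_comp => //; exact: measurable_reg_kerT.
move=> z; rewrite normrM normr_id (ger0_norm (reg_ker_ge0 _)) (ger0_norm (min1_ge0 (enorm_ge0 _))).
by rewrite ler_piMl ?reg_ker_ge0// /min1 ge_min lexx.
Qed.

Definition loc_ker z : R := sker (1 - s) z - reg_ker z.

Lemma admissible_loc_ker : admissible loc_ker.
Proof.
have [_ i1] := admissible_sker d s01; have [_ i2] := admissible_reg_ker.
have mk : measurable_fun setT loc_ker.
  by apply: measurable_funB; [exact: measurable_sker|exact: measurable_reg_kerT].
split => //; apply: dom_integrable (integrable_addr i1 i2).
  apply: measurable_funM; first by apply: measurable_min1; exact: measurable_enormT.
  exact: measurableT_comp.
move=> z; rewrite normrM normr_id (ger0_norm (min1_ge0 (enorm_ge0 _))) -mulrDr.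
by rewrite ler_wpM2l ?min1_ge0 ?enorm_ge0//; exact: ler_normB.
Qed.

(** The fractional gradient of the regularized kernel. *)
Definition reg_grad i x : R := diffop (vker s i) reg_ker x.

Lemma reg_grad_le i : exists2 C, 0 <= C & forall x, `|reg_grad i x| <= C * fdecay s x.
Proof.
have [C C0 h] := reg_ker_decaying.
by have [_ []] := decaying_fgrad s01 i C0 h => C'; exists C'.
Qed.

Lemma continuous_reg_grad i : continuous (reg_grad i).
Proof.
have [C C0 hC] := reg_ker_min1 => x.
apply: (@continuous_Rintegral_dominated _ _ _ leb 'rV[R]_d
  (fun x w => (reg_ker x - reg_ker (x - w)) * vker s i w) x
  (fun w => C * (min1 (enorm w) * `|vker s i w|))).
- move=> y; apply: measurable_funM; last exact: measurable_vkerT.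
  by apply: measurable_funB => //; apply: measurable_reg_kerT; exact: measurable_rVB.
- move=> w; apply: (@cvgM _ _ (nbhs x)); last exact: cst_continuous.
  apply: cvgB; first exact: continuous_reg_ker.
  by apply: continuous_translate; exact: continuous_reg_ker.
- by apply: (@filterE _ (nbhs x)) => y w; rewrite normrM mulrA ler_wpM2r.
- by apply: integrable_scaler; exact: integrable_min1_vker.
Qed.

Section decomposition.
Variables (phi : 'rV[R]_d -> R) (tphi : test_function setT phi) (x : 'rV[R]_d) (i : 'I_d).

Let sphi : smooth phi. Proof. by case: tphi. Qed.

Let iphi : leb.-integrable setT (EFin \o phi).
Proof. by have [C C0 h] := test_decaying s01 tphi; exact: (decaying_integrable s01 h). Qed.

Let conv (y : 'rV[R]_d) : R := \int[leb]_z (phi (y - z) * reg_ker z).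

Let bphi : exists2 B, 0 <= B & forall y, `|phi y| <= B. Proof. exact: test_bounded tphi. Qed.

Let conv_int y : leb.-integrable setT (EFin \o (fun z => phi (y - z) * reg_ker z)).
Proof.
have [B B0 hB] := bphi; apply: dom_integrable (integrable_scaler B integrable_reg_ker).
  apply: measurable_funM; last exact: measurable_reg_kerT.
  by apply: measurable_smoothT => //; exact: measurable_rVB.
by move=> z; rewrite normrM (ger0_norm (reg_ker_ge0 _)) ler_wpM2r ?reg_ker_ge0.
Qed.

Let diffop_reg y : diffop reg_ker phi y = phi y * (\int[leb]_z reg_ker z) - conv y.
Proof.
rewrite /diffop /conv -(RintegralZl _ measurableT integrable_reg_ker).
rewrite -(RintegralB measurableT (integrable_scaler _ integrable_reg_ker) (conv_int y)).
by apply: eq_Rintegral => z _; rewrite mulrBl.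
Qed.

Let convB w : conv x - conv (x - w) = \int[leb]_z (phi (x - z) * (reg_ker z - reg_ker (z - w))).
Proof.
have ish := integrable_shift (- w) (conv_int (x - w)).
have e1 : conv (x - w) = \int[leb]_z (phi (x - z) * reg_ker (z - w)).
  rewrite /conv -(Rintegral_shift (- w) (conv_int (x - w))).
  by apply: eq_Rintegral => z _; congr (phi _ * _); apply/rowP => j; rewrite !mxE; ring.
have i2 : leb.-integrable setT (EFin \o (fun z => phi (x - z) * reg_ker (z - w))).
  rewrite (_ : (fun z => phi (x - z) * _) = fun z => phi (x - w - (z - w)) * reg_ker (z - w)).
    exact: ish.
  by apply/funext => z; congr (phi _ * _); apply/rowP => j; rewrite !mxE; ring.
rewrite e1 /conv -(RintegralB measurableT (conv_int x) i2).
by apply: eq_Rintegral => z _; rewrite mulrBr.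
Qed.

Let f (wz : 'rV[R]_d * 'rV[R]_d) := phi (x - wz.2) * ((reg_ker wz.2 - reg_ker (wz.2 - wz.1)) * vker s i wz.1).

Let f_int : (leb \x leb)%E.-integrable setT (EFin \o f).
Proof.
have [C C0 hC] := reg_ker_min1.
apply: (@integrable_tensor_dominated _ _ _ _ R leb leb f
  (fun w => C * (min1 (enorm w) * `|vker s i w|)) (fun z => `|phi (x - z)|)).
- apply: measurable_funM; first by apply: measurable_smoothT => //; exact: measurable_rVB.
  apply: measurable_funM; last exact: measurable_vkerT.
  by apply: measurable_funB; apply: measurable_reg_kerT => //; exact: measurable_rVB.
- move=> w z; rewrite /f/= normrM mulrC ler_wpM2r// normrM mulrA ler_wpM2r//; exact: hC.
- by apply: integrable_scaler; exact: integrable_min1_vker.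
- exact/integrable_normr/integrable_subl.
Qed.

Let conv_f w : (conv x - conv (x - w)) * vker s i w = \int[leb]_z f (w, z).
Proof.
rewrite convB -RintegralZr//.
  by apply: eq_Rintegral => z _; rewrite /f/= mulrA.
have [C C0 hC] := reg_ker_min1.
apply: dom_integrable (integrable_scaler (C * min1 (enorm w)) (integrable_normr (integrable_subl x iphi))).
  apply: measurable_funM; first by apply: measurable_smoothT => //; exact: measurable_rVB.
  by apply: measurable_funB; apply: measurable_reg_kerT => //; exact: measurable_rVB.
by move=> z; rewrite normrM mulrC ler_wpM2r.
Qed.

(** Up to a smoothing operator, and up to a multiple of the fractional gradient,
    the fractional gradient of the truncated fractional Laplacian of [phi] is
    the gradient of [phi]. *)
Lemma diffop_vker_loc_ker : diffop (vker s i) (diffop loc_ker phi) x =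
  inversion_const d s * partial i phi x - (\int[leb]_z reg_ker z) * diffop (vker s i) phi x +
  \int[leb]_y (phi y * reg_grad i (x - y)).
Proof.
have [i1 e1] := diffop_diffop tphi x (admissible_sker d s01) (admissible_vker s01 i).
have [i2 e2] := diffop_diffop tphi x admissible_reg_ker (admissible_vker s01 i).
have iphi' : leb.-integrable setT (EFin \o (fun w => (phi x - phi (x - w)) * vker s i w)).
  by apply: integrable_diffop tphi; [exact: measurable_vkerT|exact: integrable_min1_vker].
have ic : leb.-integrable setT (EFin \o (fun w => (conv x - conv (x - w)) * vker s i w)).
  have := integrable_Rintegral2 f_int.
  by apply: eq_integrable => // w _ /=; rewrite conv_f.
have eloc y : diffop loc_ker phi y = diffop (sker (1 - s)) phi y - diffop reg_ker phi y.
  have [mk ik] := admissible_sker d s01; have [mr ir] := admissible_reg_ker.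
  rewrite /diffop -RintegralB//; last 2 first.
  - exact: (integrable_diffop mk ik y tphi).
  - exact: (integrable_diffop mr ir y tphi).
  by apply: eq_Rintegral => z _; rewrite -mulrBr.
rewrite -diffop_vker_sker//.
have ereg : diffop (vker s i) (diffop reg_ker phi) x =
    (\int[leb]_z reg_ker z) * diffop (vker s i) phi x - \int[leb]_w \int[leb]_z f (w, z).
  rewrite [diffop _ phi x]/diffop -(RintegralZl (\int[leb]_z reg_ker z) measurableT iphi').
  transitivity (\int[leb]_w ((\int[leb]_z reg_ker z) * ((phi x - phi (x - w)) * vker s i w) -
      (conv x - conv (x - w)) * vker s i w)).
    by apply: eq_Rintegral => w _; rewrite !diffop_reg; ring.
  rewrite RintegralB//; last exact: (integrable_scaler _ iphi').
  by congr (_ - _); apply: eq_Rintegral => w _; exact: conv_f.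
have -> : diffop (vker s i) (diffop loc_ker phi) x =
    diffop (vker s i) (diffop (sker (1 - s)) phi) x - diffop (vker s i) (diffop reg_ker phi) x.
  transitivity (\int[leb]_w
      ((diffop (sker (1 - s)) phi x - diffop (sker (1 - s)) phi (x - w)) * vker s i w -
       (diffop reg_ker phi x - diffop reg_ker phi (x - w)) * vker s i w)).
    apply: eq_Rintegral => w _; rewrite !eloc.
    by set a1 := diffop _ _ _; set a2 := diffop _ _ _; set a3 := diffop _ _ _; set a4 := diffop _ _ _; set v := vker _ _ _; ring.
  exact: (RintegralB measurableT i1 i2).
have assoc (a b c : R) : a - (b - c) = a - b + c by ring.
suff sub : \int[leb]_w \int[leb]_z f (w, z) = \int[leb]_y (phi y * reg_grad i (x - y)).
  by rewrite ereg sub; exact: assoc.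
rewrite (Rintegral_swap f_int).
have inner z : \int[leb]_w f (w, z) = phi (x - z) * reg_grad i z.
  have [C C0 hC] := reg_ker_decaying; have [hi _] := decaying_fgrad s01 i C0 hC.
  exact: (RintegralZl (phi (x - z)) measurableT (hi z)).
have hi : leb.-integrable setT (EFin \o (fun z => phi (x - z) * reg_grad i z)).
  rewrite (_ : (fun z => _) = fun z => \int[leb]_w f (w, z)); last by apply/funext => z; rewrite inner.
  exact: (integrable_Rintegral1 f_int).
transitivity (\int[leb]_z (phi (x - z) * reg_grad i z)).
  by apply: eq_Rintegral => z _; exact: inner.
apply: (etrans (esym (Rintegral_subl x hi))).
by apply: eq_Rintegral => y _; rewrite subKr.
Qed.

End decomposition.

End regularized_kernel.

Section bump.
Context {R : realType} (d : nat).
Local Notation leb := (@lebesgue_rV R d).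
Implicit Types (f g h phi : 'rV[R]_d -> R) (x y v : 'rV[R]_d) (i : 'I_d).

(** Smoothness is the greatest property of continuous, partially derivable
    functions that is stable under partial derivatives. *)
Lemma smooth_coinduction (P : ('rV[R]_d -> R) -> Prop) :
  (forall h, P h -> [/\ continuous h, forall i x, derivable h x 'e_i & forall i, P (partial i h)]) ->
  forall h, P h -> smooth h.
Proof.
move=> HP h Ph l; suff /HP[ch dh _] : P (foldr (@partial R d) h l) by [].
by elim: l => //= i l /HP[].
Qed.

Inductive sum_of_products : ('rV[R]_d -> R) -> Prop :=
| one_product f g : smooth f -> smooth g -> sum_of_products (fun x => f x * g x)
| add_products f g : sum_of_products f -> sum_of_products g ->
    sum_of_products (fun x => f x + g x).

Lemma smooth_mul f g : smooth f -> smooth g -> smooth (fun x => f x * g x).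
Proof.
move=> sf sg; have : sum_of_products (fun x => f x * g x) by exact: one_product.
apply: smooth_coinduction; move=> h; elim=> {f g sf sg h} [f g sf sg|f g _ [cf df pf] _ [cg dg pg]].
  have df := smooth_derivable sf; have dg := smooth_derivable sg; split.
  - by move=> x; apply: (@cvgM _ _ (nbhs x)); exact: smooth_continuous.
  - by move=> i x; exact: derivableM.
  - move=> i; rewrite (_ : partial i _ = fun x => f x * partial i g x + g x * partial i f x).
      by apply: add_products; apply: one_product => //; exact: smooth_partial.
    by apply/funext => x; rewrite /partial deriveM.
split.
- by move=> x; apply: (@cvgD _ _ _ (nbhs x)); [exact: cf|exact: cg].
- by move=> i x; exact: derivableD.
- move=> i; rewrite (_ : partial i _ = fun x => partial i f x + partial i g x).
    exact: add_products.
  by apply/funext => x; rewrite /partial deriveD.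
Qed.

Lemma derivable_dilate f x v (l : R) i : derivable f (v + l *: x) 'e_i ->
  derivable (fun y => f (v + l *: y)) x 'e_i /\
  partial i (fun y => f (v + l *: y)) x = l * partial i f (v + l *: x).
Proof.
move=> df; pose g (t : R) := f (v + l *: x + t *: 'e_i).
have df0 : derivable f (v + l *: x + (0 : R) *: 'e_i) 'e_i by rewrite scale0r addr0.
have [dg eg] := derivable_line df0; rewrite -/g in dg eg.
have hD : is_derive (0 : R) (1 : R) (fun t : R => g (l * t)) (l * partial i f (v + l *: x)).
  have h1 : is_derive (l * (0 : R)) (1 : R) g (partial i f (v + l *: x)).
    rewrite mulr0 /partial -[v + l *: x]addr0 -[X in 'D__ _ (_ + X)](scale0r 'e_i) -eg.
    exact: DeriveDef.
  have h2 : is_derive (0 : R) (1 : R) (fun t : R => l * t) l.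
    apply: is_derive_eq; rewrite /GRing.scale/=; ring.
  have := is_derive1_comp h1 h2.
  by rewrite mulrC.
have E : (fun t : R => f (v + l *: (x + t *: 'e_i))) = fun t : R => g (l * t).
  by apply/funext => t; rewrite /g scalerDr addrA scalerA.
have [|d1 e1] := @derivable_at_line R d (fun y => f (v + l *: y)) x 'e_i.
  by rewrite E; exact: (@ex_derive _ _ _ _ _ _ _ hD).
by split => //; rewrite /partial e1 E; exact: (@derive_val _ _ _ _ _ _ _ hD).
Qed.

Lemma continuous_dilate f v (l : R) : continuous f -> continuous (fun y : 'rV[R]_d => f (v + l *: y)).
Proof.
move=> cf x; have : {for x, continuous (fun y : 'rV[R]_d => v + l *: y)}.
  by apply: continuousD; [exact: cst_continuous|exact: scaler_continuous].
by move=> h; exact: (continuous_comp h (cf _)).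
Qed.

Lemma smooth_dilate phi v (l : R) : smooth phi -> smooth (fun y : 'rV[R]_d => phi (v + l *: y)).
Proof.
move=> sphi; pose P h := exists c : R, exists2 f, smooth f & h = fun y => c * f (v + l *: y).
have : P (fun y => phi (v + l *: y)).
  by exists 1; exists phi => //; apply/funext => y; rewrite mul1r.
apply: smooth_coinduction => h [c [f sf ->]].
have df i x := derivable_dilate (@smooth_derivable _ _ _ sf i (v + l *: x)).
split.
- move=> x; apply: (@cvgM _ _ (nbhs x)); first exact: cst_continuous.
  by apply: continuous_dilate; exact: smooth_continuous.
- by move=> i x; apply: derivableM => //; exact: (df i x).1.
- move=> i; exists (c * l); exists (partial i f); first exact: smooth_partial.
  apply/funext => x; have [d1 e1] := df i x.
  rewrite /partial deriveM// derive_cst scaler0 addr0 -mulrA -e1.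
  by rewrite /GRing.scale/= mulrC.
Qed.

(** Rescaling any nonzero test function produces bumps at every place and
    scale; squaring makes them nonnegative. *)
Lemma bump_exists phi x0 y0 (r : R) : test_function setT phi -> phi x0 != 0 -> 0 < r ->
  exists chi, [/\ test_function [set y | `|y - y0| < r] chi, forall y, 0 <= chi y & 0 < chi y0].
Proof.
move=> [sphi cphi _] phi0 r0.
have [M [Mr hM]] := compact_bounded cphi.
pose B := Num.max 0 (M + 1).
have hB z : supp phi z -> `|z| <= B by apply: hM; rewrite /B lt_max ltrDl ltr01 orbT.
pose l := (B + `|x0| + 1) / r; have B0 : 0 <= B by rewrite /B le_max lexx.
have N0 : 0 < B + `|x0| + 1 by rewrite ltr_wpDl// addr_ge0.
have l0 : 0 < l by rewrite divr_gt0.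
pose v := x0 - l *: y0; pose f y := phi (v + l *: y).
have sf : smooth f by exact: smooth_dilate.
pose T (z : 'rV[R]_d) := - (l^-1 *: v) + l^-1 *: z.
have TK z : v + l *: T z = z.
  by rewrite /T scalerDr scalerN !scalerA divff ?gt_eqF// !scale1r addNKr.
have KT y : T (v + l *: y) = y.
  by rewrite /T [l^-1 *: (v + _)]scalerDr addKr scalerA mulVf ?gt_eqF// scale1r.
have cT : continuous T.
  move=> z; have : {for z, continuous (fun z : 'rV[R]_d => - (l^-1 *: v) + l^-1 *: z)}.
    by apply: continuousD; [exact: cst_continuous|exact: scaler_continuous].
  by [].
have cK : compact (T @` supp phi).
  by apply: continuous_compact => //; exact: continuous_subspaceT.
have clK : closed (T @` supp phi) by apply: compact_closed => //; exact: norm_hausdorff.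
have sK : supp (fun y => f y * f y) `<=` T @` supp phi.
  apply: supp_subset => // y; rewrite mulf_eq0 orbb => fy; exists (v + l *: y); last exact: KT.
  by apply: (@subset_closure _ [set x | phi x != 0]).
exists (fun y => f y * f y); split.
- split; first exact: smooth_mul.
    by apply: (subclosed_compact _ cK) => //; exact: closed_supp.
  move=> y /sK[z /hB zB <-] /=.
  have -> : T z - y0 = l^-1 *: (z - x0).
    apply: (scalerI (lt0r_neq0 l0)); rewrite scalerBr scalerA divff ?gt_eqF// scale1r.
    have <- : v + l *: T z - v = l *: T z by rewrite addrC addKr.
    by rewrite TK; apply/rowP => j; rewrite !mxE; ring.
  rewrite normrZ gtr0_norm ?invr_gt0// mulrC ltr_pdivrMr//.
  rewrite /l mulrC divfK ?gt_eqF// (le_lt_trans (ler_normB _ _))//.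
  by move: zB; lra.
- by move=> y; rewrite -expr2 sqr_ge0.
- have -> : f y0 = phi x0 by rewrite /f /v subrK.
  by rewrite -expr2 exprn_even_gt0.
Qed.

(** A continuous function that charges no neighbourhood of a point where it is
    positive would have vanishing Gaussian averages at small scales. *)
Lemma Rintegral_gt0_continuous f (B : R) y0 : continuous f ->
  leb.-integrable setT (EFin \o f) -> (forall y, 0 <= f y <= B) -> 0 < f y0 ->
  0 < \int[leb]_y f y.
Proof.
move=> cf fi fB fy0; have f0 y : 0 <= f y by case/andP: (fB y).
rewrite lt_neqAle Rintegral_ge0// andbT; apply/eqP => e0.
pose F n x := f (y0 + n.+1%:R^-1 *: x) * gauss 1 x.
have l0 n : (0 : R) < n.+1%:R^-1 by rewrite invr_gt0.
have mf n : measurable_fun setT (fun x => f (y0 + n.+1%:R^-1 *: x)).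
  by apply: continuous_measurable_rV; exact: continuous_dilate.
have mF n : measurable_fun setT (F n).
  by apply: measurable_funM => //; exact: measurable_gaussT.
have ig := integrable_gauss d (@ltr01 R).
have lim : \int[leb]_x F n x @[n --> \oo] --> \int[leb]_x (f y0 * gauss 1 x).
  apply: (@cvg_Rintegral_dominated _ _ _ leb F (fun x => f y0 * gauss 1 x) (fun x => B * gauss 1 x)) => //.
  - move=> x; apply: cvgM; last exact: cvg_cst.
    have h : (fun n : nat => y0 + n.+1%:R^-1 *: x) @ \oo --> y0.
      rewrite -[X in _ --> X]addr0 -[X in _ + X](scale0r x).
      apply: cvgD; first exact: cvg_cst.
      exact: (cvgZ (@cvg_harmonic R) (cvg_cst x)).
    exact: (cvg_comp _ _ h (cf y0)).
  - by move=> n x; rewrite normrM !ger0_norm ?gauss_ge0// ler_wpM2r ?gauss_ge0//; case/andP: (fB (y0 + n.+1%:R^-1 *: x)).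
  - exact: integrable_scaler.
have F0 n : \int[leb]_x F n x = 0.
  have i1 : leb.-integrable setT (EFin \o (fun x => f (x + y0))) by exact: integrable_shift.
  have i2 := integrable_scale (lt0r_neq0 (l0 n)) i1.
  have z : \int[leb]_x f (n.+1%:R^-1 *: x + y0) = 0.
    by rewrite (Rintegral_scale (l0 n) i1) (Rintegral_shift y0 fi) -e0 mulr0.
  have le x : `|F n x| <= f (n.+1%:R^-1 *: x + y0).
    rewrite /F normrM !ger0_norm ?gauss_ge0// [y0 + _]addrC ler_piMr//.
    by rewrite /gauss -[leRHS]expR0 ler_expR oppr_le0 mul1r sqr_ge0.
  apply/eqP; rewrite -normr_le0 -z.
  by apply: normr_Rintegral_le => //; exact: (dom_integrable (mF n) le i2).
have : \int[leb]_x (f y0 * gauss 1 x) = 0.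
  rewrite (_ : (fun n => _) = fun=> 0 : R) in lim; last by apply/funext => n; exact: F0.
  by have := cvg_lim (@Rhausdorff R) lim; rewrite lim_cst => [-> |].
rewrite RintegralZl// => /eqP; rewrite mulf_eq0 gt_eqF//=.
by rewrite (gt_eqF (@gauss_mass_gt0 R d)).
Qed.

Lemma integrable_test phi : test_function setT phi -> leb.-integrable setT (EFin \o phi).
Proof.
have s01 : 0 < (2^-1 : R) < 1 by rewrite invr_gt0 ltr0n invf_lt1 ?ltr1n.
by move=> /(test_decaying s01)[C _ h]; exact: (decaying_integrable s01 h).
Qed.

Let bump_detects phi x0 h y0 (r : R) : test_function setT phi -> phi x0 != 0 ->
  continuous h -> 0 < h y0 -> 0 < r ->
  exists chi, [/\ test_function [set y | `|y - y0| < r] chi,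
    leb.-integrable setT (EFin \o (fun y => h y * chi y)) & 0 < \int[leb]_y (h y * chi y)].
Proof.
move=> tphi phi0 ch h0 r0.
have h20 : 0 < h y0 / 2 by rewrite divr_gt0.
have /cvgrPdist_lt/(_ _ h20)/nbhs_ballP[e /= e0 he] := ch y0.
have re0 : 0 < Num.min r e by rewrite lt_min r0.
have [chi [tchi chi0 chiy]] := bump_exists y0 tphi phi0 re0.
have sub : supp chi `<=` [set y | `|y - y0| < Num.min r e] by case: tchi.
have t1 : test_function setT chi by apply: test_subset tchi.
have ichi := integrable_test t1; have [B B0 hB] := test_bounded t1.
have bd y : h y0 / 2 * chi y <= h y * chi y <= 2 * h y0 * chi y.
  have [/sub/=|/supp_notin->] := pselect (supp chi y); last by rewrite !mulr0 lexx.
  rewrite lt_min => /andP[_ ye]; have : `|h y0 - h y| < h y0 / 2.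
    by apply: he; rewrite -ball_normE /= distrC.
  rewrite ltr_norml => /andP[? ?]; apply/andP.
  by split; rewrite ler_wpM2r//; lra.
have pos y : 0 <= h y0 / 2 * chi y by rewrite mulr_ge0// ltW.
have ih : leb.-integrable setT (EFin \o (fun y => h y * chi y)).
  apply: dom_integrable (integrable_scaler (2 * h y0) ichi).
    apply: measurable_funM; first exact: continuous_measurable_rV.
    by apply: measurable_smooth; case: t1.
  by move=> y; have /andP[b1 b2] := bd y; rewrite ger0_norm// (le_trans (pos y)).
exists chi; split => //.
  by apply: test_subset tchi => y /=; rewrite lt_min => /andP[].
apply: (@lt_le_trans _ _ (h y0 / 2 * \int[leb]_y chi y)).
  rewrite mulr_gt0//; apply: (@Rintegral_gt0_continuous chi B y0) => //.
    by apply: smooth_continuous; case: t1.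
  by move=> y; rewrite chi0 (le_trans (ler_norm _)).
rewrite -(RintegralZl _ measurableT ichi) (le_trans (ler_norm _))//.
apply: normr_Rintegral_le => //; first exact: integrable_scaler.
by move=> y; rewrite ger0_norm//; case/andP: (bd y).
Qed.

(** The fundamental lemma of the calculus of variations. *)
Lemma continuous_eq0 phi x0 h y0 (r : R) : test_function setT phi -> phi x0 != 0 ->
  continuous h -> 0 < r ->
  (forall chi, test_function [set y | `|y - y0| < r] chi -> \int[leb]_y (h y * chi y) = 0) ->
  h y0 = 0.
Proof.
move=> tphi phi0 ch r0 H; have [h0|h0|//] := ltgtP (h y0) 0; last first.
  have [chi [tchi _]] := bump_detects tphi phi0 ch h0 r0.
  by rewrite H// ltxx.
have cN : continuous (fun y => - h y) by move=> y; apply: (@cvgN _ _ _ (nbhs y)); exact: ch.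
have [|chi [tchi ichi]] := @bump_detects phi x0 (fun y => - h y) y0 r tphi phi0 cN _ r0.
  by rewrite oppr_gt0.
have E : (fun y => - h y * chi y) = fun y => -1 * (h y * chi y).
  by apply/funext => y; rewrite mulN1r mulNr.
have i1 : leb.-integrable setT (EFin \o (fun y => h y * chi y)).
  have := integrable_scaler (-1) ichi.
  rewrite (_ : (fun x => _) = fun y => h y * chi y)//.
  by apply/funext => y; rewrite mulN1r mulNr opprK.
by rewrite E RintegralZl// H// mulr0 ltxx.
Qed.

End bump.

Lemma Rintegral_sum {R : realType} dT (T : measurableType dT) (mu : {measure set T -> \bar R})
    (I : Type) (r : seq I) (a : I -> T -> R) :
  (forall i, mu.-integrable setT (EFin \o a i)) ->
  mu.-integrable setT (EFin \o (fun y => \sum_(i <- r) a i y)) /\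
  \int[mu]_y (\sum_(i <- r) a i y) = \sum_(i <- r) \int[mu]_y a i y.
Proof.
move=> ia; elim: r => [|i r [IH1 IH2]].
  have E : (fun y : T => \sum_(i <- [::]) a i y) = cst (0 : R).
    by apply/funext => y; rewrite big_nil.
  rewrite E; split; first exact: integrable0.
  by rewrite big_nil /Rintegral integral0_eq.
have E : (fun y : T => \sum_(j <- i :: r) a j y) = fun y => a i y + \sum_(j <- r) a j y.
  by apply/funext => y; rewrite big_cons.
rewrite E big_cons; split; first exact: integrable_addr.
by rewrite (RintegralD measurableT (ia i) IH1) IH2.
Qed.

Section flux.
Context {R : realType} (d : nat).
Local Notation leb := (@lebesgue_rV R d).
Implicit Types (x y w z : 'rV[R]_d) (i : 'I_d) (phi g : 'rV[R]_d -> R).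
Variables (s : R) (s01 : 0 < s < 1) (F : 'I_d -> 'rV[R]_d -> R).
Hypothesis mF : forall i, measurable_fun setT (F i).
Hypothesis iF : forall i, leb.-integrable setT (EFin \o (fun x => `|F i x| * fdecay s x)).

Lemma integrable_flux i g (C : R) : measurable_fun setT g ->
  (forall x, `|g x| <= C * fdecay s x) ->
  leb.-integrable setT (EFin \o (fun x => F i x * g x)).
Proof.
move=> mg gC; apply: dom_integrable (integrable_scaler C (iF i)).
  exact: measurable_funM.
by move=> x; rewrite normrM mulrCA ler_wpM2l.
Qed.

Lemma fdecay_ge_m x : enorm1 x `^ (- (d%:R + (1 - s))) <= fdecay s x.
Proof. by rewrite /fdecay lerDl powR_ge0. Qed.

Lemma integrable_flux_test i phi : test_function setT phi ->
  leb.-integrable setT (EFin \o (fun x => F i x * phi x)).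
Proof.
move=> tphi; have [C C0 [m h _]] := test_decaying s01 tphi.
apply: (integrable_flux i m (C := C)) => x; rewrite (le_trans (h x))// ler_wpM2l//.
exact: fdecay_ge_m.
Qed.

Lemma integrable_flux_fgrad i phi : test_function setT phi ->
  leb.-integrable setT (EFin \o (fun x => F i x * diffop (vker s i) phi x)).
Proof.
move=> tphi; have [C C0 h] := test_decaying s01 tphi.
have [_ [C' _ hC']] := decaying_fgrad s01 i C0 h.
apply: integrable_flux hC'; apply: continuous_measurable_rV.
by apply: (continuous_diffop _ _ tphi); [exact: measurable_vkerT|exact: integrable_min1_vker].
Qed.

(** The divergence of the flux, as the distribution [phi] pairs with it through
    the fractional gradient of the localized fractional Laplacian. *)
Definition flux_potential (e : R) y : R :=
  - (inversion_const d s)^-1 * \sum_i \int[leb]_x (F i x * reg_grad s e i (x - y)).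

Section scale.
Variables (e : R) (e01 : 0 < e <= 1).

Let near_bounded y0 : \forall y \near y0, enorm y <= enorm y0 + 1.
Proof.
have /cvgrPdist_le/(_ 1 ltr01) := @continuous_enorm R d y0.
apply: filterS => y; rewrite ler_norml => /andP[]; lra.
Qed.

Lemma integrable_flux_reg_grad i y :
  leb.-integrable setT (EFin \o (fun x => F i x * reg_grad s e i (x - y))).
Proof.
have [C C0 hC] := reg_grad_le s01 e01 i.
have [C' C'0 hC'] := fdecay_translate d s01 (enorm_ge0 y).
apply: (@integrable_flux i _ (C * C')).
  apply: continuous_measurable_rV.
  exact: (@continuous_translate R d (reg_grad s e i) (- y) (@continuous_reg_grad R d s s01 e e01 i)).
by move=> x; rewrite (le_trans (hC _))// -mulrA ler_wpM2l// hC'.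
Qed.

Lemma continuous_flux_potential : continuous (flux_potential e).
Proof.
move=> y0; apply: (@cvgM _ _ (nbhs y0)); first exact: cst_continuous.
apply: cvg_big => [|i _]; first exact: add_continuous.
have [C C0 hC] := reg_grad_le s01 e01 i.
have [C' C'0 hC'] := fdecay_translate d s01 (addr_ge0 (enorm_ge0 y0) ler01).
have cg := @continuous_reg_grad R d s s01 e e01 i.
apply: (@continuous_Rintegral_dominated _ _ _ leb 'rV[R]_d
  (fun y x => F i x * reg_grad s e i (x - y)) y0 (fun x => C * C' * (`|F i x| * fdecay s x))).
- move=> y; apply: measurable_funM => //; apply: continuous_measurable_rV.
  exact: (@continuous_translate R d (reg_grad s e i) (- y) cg).
- move=> x; apply: (@cvgM _ _ (nbhs y0)); first exact: cst_continuous.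
  have h : continuous (fun y : 'rV[R]_d => reg_grad s e i (x - y)).
    rewrite (_ : (fun y => _) = fun y => reg_grad s e i (x + (-1) *: y)).
      exact: (@continuous_dilate R d (reg_grad s e i) x (-1) cg).
    by apply/funext => y; rewrite scaleN1r.
  exact: h.
- apply: filterS (near_bounded y0) => y hy x.
  rewrite normrM mulrCA -mulrA ler_wpM2l// mulrA (le_trans (hC _))//.
  by rewrite -mulrA ler_wpM2l// hC'.
- exact: integrable_scaler.
Qed.

Variable Omega : set 'rV[R]_d.
Hypothesis weak : forall phi, test_function Omega phi ->
  \sum_i \int[leb]_x (F i x * diffop (vker s i) phi x) = 0.

Lemma flux_representation phi : test_function setT phi ->
  (forall y z, supp phi y -> `|z| <= e -> Omega (y + z)) ->
  \sum_i \int[leb]_x (F i x * partial i phi x) = \int[leb]_y (flux_potential e y * phi y).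
Proof.
move=> tphi hphi; have [e0 e1] := andP e01; have [sphi cphi _] := tphi.
have tO : test_function Omega phi.
  by split => // y /hphi/(_ _) h; rewrite -[y]addr0; apply: h; rewrite normr0 ltW.
pose psi := diffop (loc_ker s e) phi.
have tpsi : test_function Omega psi.
  have [mk ik] := admissible_loc_ker d s01 e01.
  by apply: (test_diffop mk ik tphi _ hphi) => z; exact: reg_ker_far.
have iphi := integrable_test tphi.
pose g i := reg_grad s e i.
pose f i (xy : 'rV[R]_d * 'rV[R]_d) := F i xy.1 * (phi xy.2 * g i (xy.1 - xy.2)).
have fi i : (leb \x leb)%E.-integrable setT (EFin \o f i).
  have [C C0 hC] := reg_grad_le s01 e01 i.
  have [rho rho0 hrho] := test_supp_bounded tphi.
  have [C' C'0 hC'] := fdecay_translate d s01 rho0.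
  apply: (@integrable_tensor_dominated _ _ _ _ R leb leb (f i)
    (fun x => `|F i x| * fdecay s x) (fun y => C * C' * `|phi y|)).
  - apply: measurable_funM; first exact: (measurableT_comp (mF i) measurable_fst).
    apply: measurable_funM; first by apply: measurable_smoothT.
    apply: (measurableT_comp (continuous_measurable_rV (@continuous_reg_grad R d s s01 e e01 i))).
    exact: measurable_rVB.
  - move=> x y; rewrite /f /= !normrM.
    have [ys|/supp_notin ->] := pselect (supp phi y); last by rewrite normr0 !(mul0r, mulr0).
    have h : `|g i (x - y)| <= C * C' * fdecay s x.
      by rewrite (le_trans (hC _))// -mulrA ler_wpM2l// hC'// hrho.
    rewrite [leRHS](_ : _ = `|F i x| * (`|phi y| * (C * C' * fdecay s x))); last by ring.
    by rewrite !ler_wpM2l.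
  - exact: iF.
  - exact/integrable_scaler/integrable_normr.
pose c := inversion_const d s; have c0 : 0 < c by exact: inversion_const_gt0.
pose K := \int[leb]_z reg_ker s e z.
have iA i := integrable_flux_test i (test_partial i tphi).
have iB i := integrable_flux_fgrad i tphi.
have fE i x : \int[leb]_y f i (x, y) = F i x * \int[leb]_y (phi y * g i (x - y)).
  rewrite -RintegralZl//.
  have [C C0 hC] := reg_grad_le s01 e01 i.
  apply: dom_integrable (integrable_scaler (C * 2) (integrable_normr iphi)).
    apply: measurable_funM; first by apply: measurable_smoothT.
    apply: (measurableT_comp (continuous_measurable_rV (@continuous_reg_grad R d s s01 e e01 i))).
    exact: measurable_rVB.
  move=> y; rewrite normrM mulrC ler_wpM2r// (le_trans (hC _))// ler_wpM2l//.
  exact: fdecay_le2.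
have term i : \int[leb]_x (F i x * diffop (vker s i) psi x) =
    c * \int[leb]_x (F i x * partial i phi x) - K * \int[leb]_x (F i x * diffop (vker s i) phi x) +
    \int[leb]_y (phi y * \int[leb]_x (F i x * g i (x - y))).
  have iC := integrable_Rintegral2 (fi i).
  transitivity (\int[leb]_x (c * (F i x * partial i phi x) - K * (F i x * diffop (vker s i) phi x) +
      \int[leb]_y f i (x, y))).
    apply: eq_Rintegral => x _; rewrite fE /psi (diffop_vker_loc_ker s01 e01 tphi).
    by rewrite -/c -/K; ring.
  rewrite (RintegralD measurableT (integrable_subr (integrable_scaler c (iA i)) (integrable_scaler K (iB i))) iC).
  rewrite (RintegralB measurableT (integrable_scaler c (iA i)) (integrable_scaler K (iB i))).
  rewrite (RintegralZl c measurableT (iA i)) (RintegralZl K measurableT (iB i)).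
  congr (_ + _); rewrite (Rintegral_swap (fi i)); apply: eq_Rintegral => y _.
  rewrite -(RintegralZl (phi y) measurableT (integrable_flux_reg_grad i y)).
  by apply: eq_Rintegral => x _; rewrite /f/= mulrCA.
have h : \sum_i (c * \int[leb]_x (F i x * partial i phi x) - K * \int[leb]_x (F i x * diffop (vker s i) phi x) +
    \int[leb]_y (phi y * \int[leb]_x (F i x * g i (x - y)))) = 0.
  by apply: etrans (weak tpsi); apply: eq_bigr => i _; rewrite term.
rewrite big_split/= sumrB -!mulr_sumr (weak tO) mulr0 subr0 in h.
have iD i : leb.-integrable setT (EFin \o (fun y => phi y * \int[leb]_x (F i x * g i (x - y)))).
  have := integrable_Rintegral1 (fi i).
  rewrite (_ : (fun y => _) = fun y => phi y * \int[leb]_x (F i x * g i (x - y)))//.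
  apply/funext => y; rewrite -(RintegralZl (phi y) measurableT (integrable_flux_reg_grad i y)).
  by apply: eq_Rintegral => x _; rewrite /f/= mulrCA.
have {}h : c * (\sum_i \int[leb]_x (F i x * partial i phi x)) =
    - \sum_i \int[leb]_y (phi y * \int[leb]_x (F i x * g i (x - y))).
  by apply/eqP; rewrite -addr_eq0 h.
apply: (mulfI (lt0r_neq0 c0)); rewrite h -(Rintegral_sum _ iD).2.
have [iS _] := Rintegral_sum (index_enum 'I_d) iD.
rewrite -mulN1r -(RintegralZl (-1) measurableT iS).
have pE y : flux_potential e y * phi y =
    - c^-1 * \sum_i (phi y * \int[leb]_x (F i x * g i (x - y))).
  by rewrite /flux_potential -mulr_sumr mulrA [RHS]mulrAC.
have ip : leb.-integrable setT (EFin \o (fun y => flux_potential e y * phi y)).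
  have := integrable_scaler (- c^-1) iS.
  rewrite (_ : (fun y => _) = fun y => flux_potential e y * phi y)//.
  by apply/funext => y; rewrite pE.
transitivity (\int[leb]_y (c * (flux_potential e y * phi y))).
  by apply: eq_Rintegral => y _; rewrite pE mulrA mulrN divff ?gt_eqF.
exact: (RintegralZl c measurableT ip).
Qed.

End scale.
End flux.

Section gluing.
Context {R : realType} (d : nat).
Local Notation leb := (@lebesgue_rV R d).
Implicit Types (x y w z : 'rV[R]_d) (i : 'I_d) (phi g : 'rV[R]_d -> R) (Omega : set 'rV[R]_d).

Lemma integrable_mul_test g phi : continuous g -> test_function setT phi ->
  leb.-integrable setT (EFin \o (fun y => g y * phi y)).
Proof.
move=> cg tphi; have [sphi cphi _] := tphi.
have : compact (g @` supp phi) by apply: continuous_compact => //; exact: continuous_subspaceT.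
move/compact_bounded => [M [Mr hM]].
have hB y : supp phi y -> `|g y| <= M + 1 by move=> ys; apply: (hM (M + 1)); [rewrite ltrDl|exists y].
apply: dom_integrable (integrable_scaler (M + 1) (integrable_normr (integrable_test tphi))).
  by apply: measurable_funM; [exact: continuous_measurable_rV|exact: measurable_smooth].
move=> y; rewrite normrM; have [/hB h|/supp_notin->] := pselect (supp phi y).
  by rewrite ler_wpM2r.
by rewrite normr0 !mulr0.
Qed.

Definition room Omega y : set R :=
  [set e | 0 < e <= 1 /\ forall z, `|z| <= 2 * e -> Omega (y + z)].

Lemma room_shift Omega y w (e e' : R) : room Omega y e -> 0 < e' -> `|w| + 2 * e' <= 2 * e ->
  room Omega (y + w) e'.
Proof.
move=> [/andP[e0 e1] h] e'0 we; have w0 := normr_ge0 w; split; first by apply/andP; split; lra.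
by move=> z ze; rewrite -addrA; apply: h; rewrite (le_trans (ler_normD _ _))//; lra.
Qed.

Lemma room_exists Omega y : open Omega -> Omega y -> exists e, room Omega y e.
Proof.
rewrite openE => oO /oO /nbhs_ballP[e /= e0 he]; exists (Num.min 1 (e / 3)); split.
  by rewrite lt_min ltr01 divr_gt0//= ge_min lexx.
move=> z ze; apply: he; rewrite -ball_normE /= opprD addNKr normrN.
have : Num.min 1 (e / 3) <= e / 3 by rewrite ge_min lexx orbT.
by lra.
Qed.

Lemma room_compact Omega (K : set 'rV[R]_d) : open Omega -> compact K -> K `<=` Omega ->
  exists e, 0 < e <= 1 /\ forall y, K y -> room Omega y e.
Proof.
move=> oO /compact_near_coveringP cK KO.
have : \forall e \near (0 : R)^'+, K `<=` (fun y => room Omega y e).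
  apply: cK => y Ky; have [e0 he0] := room_exists oO (KO y Ky).
  have [/andP[p0 p1] _] := he0.
  exists (ball y e0, [set e : R | 0 < e < e0 / 2]) => /=.
    split; first exact: nbhsx_ballx.
    near=> e; apply/andP; split; near: e; [exact: nbhs_right_gt|apply: nbhs_right_lt; lra].
  move=> [y' e] /= [yy' /andP[q0 q1]]; rewrite -[y'](subrK y) addrC.
  apply: (room_shift he0) => //; move: yy'; rewrite -ball_normE /= distrC; lra.
move=> H; have : \forall e \near (0 : R)^'+, 0 < e <= 1 /\ (K `<=` (fun y => room Omega y e)).
  near=> e; split; last by near: e.
  by apply/andP; split; near: e; [exact: nbhs_right_gt|exact: nbhs_right_le].
by move=> /(@filter_ex _ _ _)[e [h1 h2]]; exists e; split => // y /h2.
Unshelve. all: by end_near. Qed.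

Section glue.
Variables (s : R) (s01 : 0 < s < 1) (F : 'I_d -> 'rV[R]_d -> R).
Hypothesis mF : forall i, measurable_fun setT (F i).
Hypothesis iF : forall i, leb.-integrable setT (EFin \o (fun x => `|F i x| * fdecay s x)).
Variable Omega : set 'rV[R]_d.
Hypothesis oO : open Omega.
Hypothesis weak : forall phi, test_function Omega phi ->
  \sum_i \int[leb]_x (F i x * diffop (vker s i) phi x) = 0.

Let pot := flux_potential s F.

Lemma flux_representation_room (e : R) phi : 0 < e <= 1 -> test_function setT phi ->
  (forall y, supp phi y -> room Omega y e) ->
  \sum_i \int[leb]_x (F i x * partial i phi x) = \int[leb]_y (pot e y * phi y).
Proof.
move=> e01 tphi h; apply: (flux_representation s01 mF iF e01 weak tphi) => y z /h[_ hz] ze.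
by apply: hz; case/andP: e01 => ? _; lra.
Qed.

(** The function representing the distribution does not depend on the scale:
    two continuous functions that represent the same distribution agree. *)
Lemma flux_potential_scale phi0 x0 y (e e' : R) : test_function setT phi0 -> phi0 x0 != 0 ->
  room Omega y e -> room Omega y e' -> pot e y = pot e' y.
Proof.
move=> tphi0 phi0x he he'; have [e01 he2] := he; have [e'01 he'2] := he'.
have /andP[p0 _] := e01; have /andP[p'0 _] := e'01.
have c1 : continuous (pot e) by exact: continuous_flux_potential.
have c2 : continuous (pot e') by exact: continuous_flux_potential.
pose r := Num.min e e' / 2; have r0 : 0 < r by rewrite divr_gt0// lt_min p0.
have re : r <= e / 2 by rewrite /r ler_pM2r ?invr_gt0// ge_min lexx.
have re' : r <= e' / 2 by rewrite /r ler_pM2r ?invr_gt0// ge_min lexx orbT.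
apply/eqP; rewrite -subr_eq0; apply/eqP.
apply: (@continuous_eq0 R d phi0 x0 (fun y => pot e y - pot e' y) y r) => //.
  by move=> w; apply: (@cvgB _ _ _ (nbhs w)); [exact: c1|exact: c2].
move=> chi tchi; have t1 : test_function setT chi by apply: test_subset tchi.
have sub : supp chi `<=` [set w | `|w - y| < r] by case: tchi.
have rep (k : R) : room Omega y k -> r <= k / 2 ->
    \sum_i \int[leb]_x (F i x * partial i chi x) = \int[leb]_y (pot k y * chi y).
  move=> [k01 hk] rk; apply: (flux_representation s01 mF iF k01 weak t1) => w z /sub/= wr zk.
  have -> : w + z = y + ((w - y) + z) by rewrite addrA [y + _]addrC subrK.
  by apply: hk; rewrite (le_trans (ler_normD _ _))//; case/andP: k01 => *; lra.
transitivity (\int[leb]_w (pot e w * chi w - pot e' w * chi w)).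
  by apply: eq_Rintegral => w _; rewrite mulrBl.
rewrite (RintegralB measurableT (integrable_mul_test c1 t1) (integrable_mul_test c2 t1)).
apply/eqP; rewrite subr_eq0; apply/eqP.
exact: etrans (esym (rep e he re)) (rep e' he' re').
Qed.

Lemma flux_density phi0 x0 : test_function setT phi0 -> phi0 x0 != 0 ->
  exists mu : 'rV[R]_d -> R, [/\ forall y, Omega y -> {for y, continuous mu} &
    forall phi, test_function Omega phi ->
      \sum_i \int[leb]_x (F i x * partial i phi x) = \int[leb]_(y in Omega) (mu y * phi y)].
Proof.
move=> tphi0 phi0x; pose mu y := pot (xget 1 (room Omega y)) y.
have muE e y : room Omega y e -> mu y = pot e y.
  move=> he; apply: (flux_potential_scale tphi0 phi0x) => //.
  by apply: xgetPex; exists e.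
exists mu; split.
  move=> y0 /(room_exists oO)[e he]; have [/andP[e0 e1] _] := he.
  have he2 y : `|y - y0| < e -> room Omega y (e / 2).
    move=> ye; rewrite -[y](subrK y0) addrC; apply: (room_shift he); first by rewrite divr_gt0.
    by lra.
  have e201 : 0 < e / 2 <= 1 by apply/andP; split; lra.
  have cpot : {for y0, continuous (pot (e / 2))} by exact: (@continuous_flux_potential R d s s01 F mF iF _ e201 y0).
  have near0 : {near y0, pot (e / 2) =1 mu}.
    near=> y; apply/esym/muE/he2; rewrite distrC.
    have : ball y0 e y by near: y; exact: nbhsx_ballx.
    by rewrite -ball_normE.
  have h : mu @ y0 --> pot (e / 2) y0 by apply: cvg_trans cpot; exact: near_eq_cvg near0.
  by rewrite (nbhs_singleton near0 : pot (e / 2) y0 = mu y0) in h.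
move=> phi tphi; have [sphi cphi Ophi] := tphi.
have t1 : test_function setT phi by exact: test_subset tphi.
have [e [e01 he]] := room_compact oO cphi Ophi.
rewrite (flux_representation_room e01 t1 he) [RHS]Rintegral_mkcond.
apply: eq_Rintegral => y _; rewrite patchE.
have [ys|/supp_notin py] := pselect (supp phi y).
  by have -> := mem_set (Ophi y ys); rewrite (muE e y (he y ys)).
have p0 (a : R) : a * phi y = 0 by rewrite py mulr0.
apply: (etrans (p0 (pot e y))); case: ifP => _; last by [].
exact: (esym (p0 (mu y))).
Unshelve. all: by end_near. Qed.

End glue.

Lemma continuous_Linfty_loc (Omega : set 'rV[R]_d) (mu : 'rV[R]_d -> R) : open Omega ->
  (forall y, Omega y -> {for y, continuous mu}) -> Linfty_loc Omega mu.
Proof.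
move=> oO cmu; split.
  move=> mO; apply: (measurability _ (RGenOpens.measurableE R)) => //.
  move=> _ [_ [a [b ->] <-]]; apply: open_measurable_rV; rewrite openE => y [Oy ay].
  apply: filterI; first by move: oO; rewrite openE; apply.
  by apply: (cmu y Oy); apply: open_nbhs_nbhs; split => //; exact: interval_open.
move=> K cK KO.
have : compact (mu @` K).
  apply: continuous_compact => //; apply: continuous_in_subspaceT => y; rewrite inE => Ky.
  exact: cmu (KO y Ky).
move/compact_bounded => [M [Mr hM]]; exists (M + 1); apply: aeW => y Ky.
by apply: (hM (M + 1)); [rewrite ltrDl|exists y].
Qed.

End gluing.

Section flux_of_gradient.
Context {R : realType} (d : nat).
Local Notation leb := (@lebesgue_rV R d).
Variables (p : R) (p1 : 1 < p).

Lemma pflux_le (z : 'rV[R]_d) i : `|pflux p z ord0 i| <= enorm z `^ (p - 1).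
Proof.
rewrite /pflux mxE normrM ger0_norm ?powR_ge0//.
have [->|z0] := eqVneq z 0; first by rewrite mxE normr0 mulr0 powR_ge0.
have e0 := enorm_gt0 z0.
have pE : p - 1 = p - 2 + 1 by ring.
rewrite pE.
rewrite [leRHS]powRD; last by rewrite (gt_eqF e0) implybT.
by rewrite powRr1 ?(ltW e0)// ler_wpM2l ?powR_ge0// coord_le_enorm.
Qed.

(* Young's inequality for b <= 1 needs no constants. *)
Lemma powR_mul_le (a b : R) : 0 <= a -> 0 <= b <= 1 -> a `^ (p - 1) * b <= a `^ p + b.
Proof.
move=> a0 /andP[b0 b1]; have [a1|a1] := leP 1 a.
  rewrite ler_wpDr// (@le_trans _ _ (a `^ (p - 1)))//; first by rewrite ler_piMr ?powR_ge0.
  by rewrite ler_powR// lerBlDr lerDl.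
rewrite ler_wpDl ?powR_ge0// ler_piMl//.
apply: (@le_trans _ _ (1 `^ (p - 1))); last by rewrite powR1.
rewrite ge0_ler_powR ?nnegrE ?subr_ge0 ?ler01 ?(ltW p1) ?(ltW a1)//.
Qed.

Variables (s : R) (s01 : 0 < s < 1) (G : 'rV[R]_d -> 'rV[R]_d).
Hypothesis mG : forall i, measurable_fun setT (fun x => G x ord0 i).
Hypothesis iG : leb.-integrable setT (EFin \o (fun x => enorm (G x) `^ p)).

Lemma measurable_pflux i : measurable_fun setT (fun x => pflux p (G x) ord0 i).
Proof.
rewrite (_ : (fun x => _) = fun x => enorm (G x) `^ (p - 2) * G x ord0 i).
  apply: measurable_funM => //; apply: measurable_powRT; apply: measurable_enormT.
  exact: measurable_rVT.
by apply/funext => x; rewrite mxE.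
Qed.

Lemma integrable_pflux_fdecay i :
  leb.-integrable setT (EFin \o (fun x => `|pflux p (G x) ord0 i| * fdecay s x)).
Proof.
have id := integrable_fdecay d s01.
apply: dom_integrable (integrable_scaler 2 (integrable_addr iG (integrable_scaler 2^-1 id))).
  apply: measurable_funM; last exact: integrableT_measurable id.
  by apply: measurableT_comp => //; exact: measurable_pflux.
move=> x; have f0 := fdecay_ge0 s x; have f2 := fdecay_le2 s01 x.
rewrite normrM normr_id (ger0_norm f0).
rewrite (@le_trans _ _ (enorm (G x) `^ (p - 1) * fdecay s x))//.
  by rewrite ler_wpM2r// pflux_le.
have -> : enorm (G x) `^ (p - 1) * fdecay s x = 2 * (enorm (G x) `^ (p - 1) * (2^-1 * fdecay s x)).
  by rewrite mulrCA [2 * (2^-1 * _)]mulrA divff// mul1r.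
rewrite ler_wpM2l//.
by apply: powR_mul_le; [exact: enorm_ge0|apply/andP; split; lra].
Qed.

End flux_of_gradient.

Lemma Hsp_fgrad {R : realType} (d : nat) (s p : R) (u : 'rV[R]_d -> R) : 0 < p -> Hsp s p u ->
  (forall i, measurable_fun setT (fun x => fgrad s u x ord0 i)) /\
  (lebesgue_rV d).-integrable setT (EFin \o (fun x => enorm (fgrad s u x) `^ p)).
Proof.
move=> p0 [_ exG uoo].
have hG : is_fgrad s u (fgrad s u) by exact: (xgetPex (fun=> 0) exG).
have mG i : measurable_fun setT (fun x => fgrad s u x ord0 i) by have [[]] := hG i.
split=> //; apply: integrable_ltyP => [|x|]; last 1 first.
- have := poweR_lty p uoo; rewrite /Hsp_seminorm poweR_Lnorm ?gt_eqF//.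
  congr (_ < _)%E; apply: eq_integral => x _ /=.
  by rewrite ger0_norm ?enorm_ge0.
- by apply: measurable_powRT; apply: measurable_enormT; exact: measurable_rVT.
- exact: powR_ge0.
Qed.

Theorem proposition1p2 (R : realType) (d : nat) (d_ge1 : (1 <= d)%N)
    (Omega : set 'rV[R]_d) (openOmega : open Omega)
    (p : R) (p_gt : 2 - d%:R^-1 < p)
    (s : R) (s_gt0 : 0 < s) (s_le1 : s <= 1)
    (u : 'rV[R]_d -> R) (Hu : Hsp s p u)
    (u_eq : forall phi, test_function Omega phi ->
      \int[lebesgue_rV d]_x dotv (pflux p (fgrad s u x)) (fgrad_test s phi x)
      = 0) :
  let Dv := riesz_gradient s u in
  exists mu : 'rV[R]_d -> R, Linfty_loc Omega mu /\
    forall phi, test_function Omega phi ->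
      \int[lebesgue_rV d]_x dotv (pflux p (Dv x)) (gradient phi x)
      = \int[lebesgue_rV d]_(x in Omega) (mu x * phi x).
Proof.
move=> Dv; have p1 : 1 < p.
  apply: le_lt_trans p_gt; rewrite lerBrDl -lerBrDr.
  by rewrite (_ : 2 - 1 = 1)//; [rewrite invf_le1 ?ler1n ?ltr0n|ring].
have zero_density : (forall phi, test_function Omega phi ->
      \int[lebesgue_rV d]_x dotv (pflux p (Dv x)) (gradient phi x) = 0) ->
    exists mu : 'rV[R]_d -> R, Linfty_loc Omega mu /\
    forall phi, test_function Omega phi ->
      \int[lebesgue_rV d]_x dotv (pflux p (Dv x)) (gradient phi x)
      = \int[lebesgue_rV d]_(x in Omega) (mu x * phi x).
  move=> H; exists (cst 0); split.
    by apply: continuous_Linfty_loc => // y _; exact: cst_continuous.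
  move=> phi tphi; rewrite H//; apply/esym.
  by rewrite /Rintegral integral0_eq// => x _; rewrite mul0r.
have [s1|s1] := eqVneq s 1.
  apply: zero_density => phi tphi; have := u_eq phi tphi.
  have -> // : fgrad_test s phi = gradient phi by apply/funext => x; rewrite /fgrad_test s1 eqxx.
have s01 : 0 < s < 1 by rewrite s_gt0 lt_neqAle s1.
have [[phi0 [x0 [tphi0 phi0x]]]|none] := pselect (exists phi0 : 'rV[R]_d -> R, exists x0,
    test_function setT phi0 /\ phi0 x0 != 0); last first.
  apply: zero_density => phi tphi.
  have phiE : phi = cst 0.
    apply/funext => x; apply: contrapT => /eqP px; apply: none; exists phi; exists x.
    by split => //; exact: test_subset tphi.
  rewrite /Rintegral integral0_eq// => x _; congr EFin.
  by rewrite /dotv big1// => i _; rewrite !mxE phiE /partial derive_cst mulr0.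
have [mG iG] := Hsp_fgrad (lt_trans ltr01 p1) Hu.
pose F (i : 'I_d) x := pflux p (fgrad s u x) ord0 i.
have mF i : measurable_fun setT (F i) by exact: measurable_pflux.
have iF i : (lebesgue_rV d).-integrable setT (EFin \o (fun x => `|F i x| * fdecay s x)).
  exact: integrable_pflux_fdecay.
have weak phi : test_function Omega phi ->
    \sum_i \int[lebesgue_rV d]_x (F i x * diffop (vker s i) phi x) = 0.
  move=> tphi; have t1 : test_function setT phi by exact: test_subset tphi.
  have [iS eS] := Rintegral_sum (index_enum 'I_d) (fun i => integrable_flux_fgrad s01 mF iF i t1).
  rewrite -eS; apply: (mulfI (lt0r_neq0 (fgrad_const_gt0 d s01))).
  rewrite mulr0 -(RintegralZl _ measurableT iS) -[RHS](u_eq phi tphi).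
  apply: eq_Rintegral => x _; rewrite /dotv mulr_sumr; apply: eq_bigr => i _.
  by rewrite /fgrad_test (negPf s1) mxE fpartialE// mulrCA.
have [mu [cmu hmu]] := flux_density s01 mF iF openOmega weak tphi0 phi0x.
exists mu; split; first exact: continuous_Linfty_loc.
move=> phi tphi; rewrite -hmu//.
have t1 : test_function setT phi by exact: test_subset tphi.
rewrite -(Rintegral_sum _ (fun i => integrable_flux_test s01 mF iF i (test_partial i t1))).2.
by apply: eq_Rintegral => x _; rewrite /dotv; apply: eq_bigr => i _; rewrite /gradient mxE.
Qed.
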